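(* Suppose that $G/K$ carries exactly one $G$-invariant Einstein metric up to scaling, corresponding to the unique real root $\bar y>0$ of $-(B_2+C_1)y^3+A_2y^2-A_1y+B_1+C_2=0$. Let $y(t)=x_1(t)/x_2(t)$. Then for every $G$-invariant initial metric with $y(0)\neq\bar y$ there exists $T<\infty$ such that there exists a unique solution to the HRF on $G/K$ with this initial metric which is defined on the maximal time interval $[0,T)$. $T$ is a type I singularity and, as $t\to T$, $G/K$ shrinks to a point and $y(t)\to\bar y$. In particular, there are no ancient solutions.
   Context: Setting. Let $G/K$ be a compact, connected, effective homogeneous space with $\mathfrak g=\mathfrak k\oplus\mathfrak p$, such that $K$ is maximal in $G$ and the isotropy representation splits into two inequivalent irreducible $\mathrm{Ad}|_K$-invariant summands $\mathfrak p=\mathfrak p_1\oplus\mathfrak p_2$. Let $Q$ be an $\mathrm{Ad}|_K$-invariant scalar product on $\mathfrak p$ with $\mathfrak p_1\perp\mathfrak p_2$ which on each $\mathfrak p_i$ is a negative multiple of the Killing form $B_{\mathfrak g}$ of $\mathfrak g$: $-B_{\mathfrak g}|_{\mathfrak p_i}=b_iQ|_{\mathfrak p_i}$. Put $d_i=\dim\mathfrak p_i$ and $[ijk]=\sum Q([e_\alpha,e_\beta]_{\mathfrak p},e_\gamma)^2$, the sum over $Q$-orthonormal bases of $\mathfrak p_i,\mathfrak p_j,\mathfrak p_k$; here $[112]$ and $[122]$ are both nonzero. Let $$A_1=b_1-\tfrac{[111]}{2d_1}-\tfrac{[122]}{d_1},\ B_1=\tfrac{[112]}{d_1},\ C_1=\tfrac{[122]}{2d_1},\quad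 A_2=b_2-\tfrac{[222]}{2d_2}-\tfrac{[112]}{d_2},\ B_2=\tfrac{[122]}{d_2},\ C_2=\tfrac{[112]}{2d_2},$$ which are all strictly positive. Every $G$-invariant Riemannian metric is $x_1Q|_{\mathfrak p_1}\oplus x_2Q|_{\mathfrak p_2}$ with $x_1,x_2>0$; it is Einstein if and only if $y=x_1/x_2$ is a root of $-(B_2+C_1)y^3+A_2y^2-A_1y+B_1+C_2=0$ (all real roots are strictly positive). The homogeneous Ricci flow (HRF) is the Ricci flow $\partial_tg=-2\,\mathrm{Ric}(g)$ for $g(t)=x_1(t)Q|_{\mathfrak p_1}\oplus x_2(t)Q|_{\mathfrak p_2}$, equivalently, with $y=x_1/x_2$, the system $\dot x_1=-A_1+B_1/y-C_1y^2$, $\dot x_2=-A_2+B_2y-C_2/y^2$ together with $x_1(t),x_2(t)>0$. A solution $g(t)$ on $[0,T)$ develops a type I singularity at $T$ if $T<\infty$, $\sup_{t\in[0,T)}\sup_p|\mathrm{Rm}(g(t))|_{g(t)}(p)=+\infty$ and $\sup_{t\in[0,T)}(T-t)\sup_p|\mathrm{Rm}(g(t))|_{g(t)}(p)<+\infty$. An ancient solution is one defined on $(-\infty,T)$ with $T<\infty$. ''$G/K$ shrinks to a point'' means $x_1(t),x_2(t)\to0$.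
   Formalization: ''No ancient solutions'' is claimed only for solutions whose y(t) differs from ȳ at some time, as the shrinking Einstein metric is ancient; Q is taken as the restriction of an Ad(G)-invariant scalar product on g with k ⟂ p, without which the formulas for A_i, B_i, C_i fail. *)

(* Defs.v *)
From HB Require Import structures.
From mathcomp Require Import all_boot all_order all_algebra.
From mathcomp Require Import all_classical all_reals all_analysis.

Set Implicit Arguments.
Unset Strict Implicit.
Unset Printing Implicit Defensive.

Import Order.TTheory GRing.Theory Num.Theory.
Import numFieldNormedType.Exports.

Local Open Scope classical_set_scope.
Local Open Scope ring_scope.

(* Compact Lie groups are taken as compact subgroups of GL_{n+1}(R): by the
   Peter-Weyl theorem every compact Lie group is of this form.  Their Lie
   algebras are then spaces of matrices, with the commutator as bracket and
   conjugation as adjoint action. *)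

Definition matrix_group (R : realType) (n : nat) (H : set 'M[R]_n.+1) : Prop :=
  [/\ H 1%:M,
      (forall a b, H a -> H b -> H (a *m b)) &
      (forall a, H a -> a \in unitmx /\ H (invmx a))].

(* For a closed subgroup H of GL_{n+1}(R) the velocities at 1 of curves in H
   form the Lie algebra of H; differentiability at 0 is enough. *)
Definition lie_algebra_of (R : realType) (n : nat) (H : set 'M[R]_n.+1) :
    set 'M[R]_n.+1 :=
  [set X | exists c : R -> 'M[R]_n.+1,
     [/\ c 0 = 1%:M, (forall t, H (c t)) & is_derive (0 : R) (1 : R) c X]].

Definition Ad (R : realType) (n : nat) (a X : 'M[R]_n.+1) : 'M[R]_n.+1 :=
  a *m X *m invmx a.

Definition bracket (R : realType) (n : nat) (X Y : 'M[R]_n.+1) : 'M[R]_n.+1 :=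
  X *m Y - Y *m X.

Definition Ad_invariant (R : realType) (n : nat) (H : set 'M[R]_n.+1)
    (V : {vspace 'M[R]_n.+1}) : Prop :=
  forall a X, H a -> X \in V -> Ad a X \in V.

Definition Ad_irreducible (R : realType) (n : nat) (H : set 'M[R]_n.+1)
    (V : {vspace 'M[R]_n.+1}) : Prop :=
  [/\ Ad_invariant H V, V != 0%VS &
      forall W : {vspace 'M[R]_n.+1},
        (W <= V)%VS -> Ad_invariant H W -> W = 0%VS \/ W = V].

Definition Ad_equivalent (R : realType) (n : nat) (H : set 'M[R]_n.+1)
    (V W : {vspace 'M[R]_n.+1}) : Prop :=
  exists f : 'End('M[R]_n.+1),
    [/\ (f @: V)%VS = W, (V :&: lker f)%VS = 0%VS &
        forall a X, H a -> X \in V -> f (Ad a X) = Ad a (f X)].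

(* Connectedness of the quotient topology on H/L: open and closed subsets of
   H/L correspond to L-saturated relatively open and closed subsets of H. *)
Definition connected_quotient (R : realType) (n : nat)
    (H L : set 'M[R]_n.+1) : Prop :=
  forall A : set 'M[R]_n.+1,
    A `<=` H -> A !=set0 ->
    (forall a l, A a -> L l -> A (a *m l)) ->
    (exists2 U, open U & A = H `&` U) ->
    (exists2 C, closed C & A = H `&` C) ->
    A = H.

(* H acts effectively on H/L: only the identity fixes every coset hL. *)
Definition effective_quotient (R : realType) (n : nat)
    (H L : set 'M[R]_n.+1) : Prop :=
  forall a, H a -> (forall h, H h -> L (invmx h *m a *m h)) -> a = 1%:M.

(* Subgroups of a Lie group are understood to be closed. *)
Definition maximal_subgroup (R : realType) (n : nat)
    (H L : set 'M[R]_n.+1) : Prop :=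
  L != H /\
  forall M : set 'M[R]_n.+1,
    matrix_group M -> closed M -> L `<=` M -> M `<=` H -> M = L \/ M = H.

Definition scalar_product_on (R : realType) (n : nat)
    (V : {vspace 'M[R]_n.+1}) (h : 'M[R]_n.+1 -> 'M[R]_n.+1 -> R) : Prop :=
  [/\ (forall (a : R) X Y Z, X \in V -> Y \in V -> Z \in V ->
         h (a *: X + Y) Z = a * h X Z + h Y Z),
      (forall X Y, X \in V -> Y \in V -> h X Y = h Y X) &
      (forall X, X \in V -> X != 0 -> 0 < h X X)].

Definition orthonormal_basis (R : realType) (n : nat)
    (V : {vspace 'M[R]_n.+1}) (h : 'M[R]_n.+1 -> 'M[R]_n.+1 -> R)
    (e : seq 'M[R]_n.+1) : Prop :=
  basis_of V e /\
  forall i j, (i < size e)%N -> (j < size e)%N -> h e`_i e`_j = (i == j)%:R.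

(* Trace over V of a map that restricts to an endomorphism of V. *)
Definition trace_on (R : realType) (n : nat) (V : {vspace 'M[R]_n.+1})
    (f : 'M[R]_n.+1 -> 'M[R]_n.+1) : R :=
  \sum_(i < \dim V) coord (vbasis V) i (f (vbasis V)`_i).

Definition killing_form (R : realType) (n : nat) (V : {vspace 'M[R]_n.+1})
    (X Y : 'M[R]_n.+1) : R :=
  trace_on V (fun Z => bracket X (bracket Y Z)).

(* The scalar product Q is given on the whole Lie algebra, Ad(G)-invariant and
   with lieK orthogonal to p1 + p2.  This normalisation is what makes
   [ijk] symmetric in its three indices, as the notation presupposes.
   (Q on p1 + p2 is then in particular Ad(K)-invariant.)
   The Q-orthonormal bases e1, e2 are an auxiliary choice. *)
Record two_summand_space (R : realType) (n : nat) := TwoSummandSpace {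
  grpG : set 'M[R]_n.+1;
  grpK : set 'M[R]_n.+1;
  lieG : {vspace 'M[R]_n.+1};
  lieK : {vspace 'M[R]_n.+1};
  p1 : {vspace 'M[R]_n.+1};
  p2 : {vspace 'M[R]_n.+1};
  Q : 'M[R]_n.+1 -> 'M[R]_n.+1 -> R;
  b1 : R;
  b2 : R;
  e1 : seq 'M[R]_n.+1;
  e2 : seq 'M[R]_n.+1;
  grpG_group : matrix_group grpG;
  grpG_compact : compact grpG;
  grpK_group : matrix_group grpK;
  grpK_sub : grpK `<=` grpG;
  grpK_closed : closed grpK;
  GK_connected : connected_quotient grpG grpK;
  GK_effective : effective_quotient grpG grpK;
  grpK_maximal : maximal_subgroup grpG grpK;
  lieGP : forall X, X \in lieG <-> lie_algebra_of grpG X;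
  lieKP : forall X, X \in lieK <-> lie_algebra_of grpK X;
  lieG_sum : lieG = (lieK + (p1 + p2))%VS;
  lieG_direct : directv (lieK + (p1 + p2));
  p1_irreducible : Ad_irreducible grpK p1;
  p2_irreducible : Ad_irreducible grpK p2;
  p1_p2_inequivalent : ~ Ad_equivalent grpK p1 p2;
  Q_scalar_product : scalar_product_on lieG Q;
  Q_invariant : forall a X Y, grpG a -> X \in lieG -> Y \in lieG ->
    Q (Ad a X) (Ad a Y) = Q X Y;
  Q_lieK_p : forall X Y, X \in lieK -> Y \in (p1 + p2)%VS -> Q X Y = 0;
  Q_p1_p2 : forall X Y, X \in p1 -> Y \in p2 -> Q X Y = 0;
  b1_gt0 : 0 < b1;
  b2_gt0 : 0 < b2;
  killing_p1 : forall X Y, X \in p1 -> Y \in p1 ->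
    - killing_form lieG X Y = b1 * Q X Y;
  killing_p2 : forall X Y, X \in p2 -> Y \in p2 ->
    - killing_form lieG X Y = b2 * Q X Y;
  e1_basis : orthonormal_basis p1 Q e1;
  e2_basis : orthonormal_basis p2 Q e2
}.

Section HomogeneousGeometry.
Variables (R : realType) (n : nat) (S : two_summand_space R n).
Implicit Types (X Y Z W : 'M[R]_n.+1) (x : R * R).

Definition pp : {vspace 'M[R]_n.+1} := (p1 S + p2 S)%VS.

Definition proj_p X : 'M[R]_n.+1 := daddv_pi pp (lieK S) X.
Definition proj_k X : 'M[R]_n.+1 := daddv_pi (lieK S) pp X.
Definition proj_p1 X : 'M[R]_n.+1 := daddv_pi (p1 S) (lieK S + p2 S) X.
Definition proj_p2 X : 'M[R]_n.+1 := daddv_pi (p2 S) (lieK S + p1 S) X.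

Definition bracket_p X Y : 'M[R]_n.+1 := proj_p (bracket X Y).
Definition bracket_k X Y : 'M[R]_n.+1 := proj_k (bracket X Y).

Definition triple (ei ej ek : seq 'M[R]_n.+1) : R :=
  \sum_(a <- ei) \sum_(b <- ej) \sum_(c <- ek) Q S (bracket_p a b) c ^+ 2.

Definition c111 : R := triple (e1 S) (e1 S) (e1 S).
Definition c112 : R := triple (e1 S) (e1 S) (e2 S).
Definition c122 : R := triple (e1 S) (e2 S) (e2 S).
Definition c222 : R := triple (e2 S) (e2 S) (e2 S).

Definition d1 : R := (\dim (p1 S))%:R.
Definition d2 : R := (\dim (p2 S))%:R.

Definition A1 : R := b1 S - c111 / (2 * d1) - c122 / d1.
Definition B1 : R := c112 / d1.
Definition C1 : R := c122 / (2 * d1).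
Definition A2 : R := b2 S - c222 / (2 * d2) - c112 / d2.
Definition B2 : R := c122 / d2.
Definition C2 : R := c112 / (2 * d2).

Definition einstein_cubic (y : R) : R :=
  - (B2 + C1) * y ^+ 3 + A2 * y ^+ 2 - A1 * y + B1 + C2.

(* The invariant metric x1 Q|p1 + x2 Q|p2, as a form on p1 + p2, the tangent
   space of G/K at the base point. *)
Definition metric x X Y : R :=
  x.1 * Q S (proj_p1 X) (proj_p1 Y) + x.2 * Q S (proj_p2 X) (proj_p2 Y).

Definition metric_onb x : seq 'M[R]_n.+1 :=
  [seq (Num.sqrt x.1)^-1 *: a | a <- e1 S] ++
  [seq (Num.sqrt x.2)^-1 *: a | a <- e2 S].

(* 2 <U(X,Y),Z> = <[Z,X]_p,Y> + <X,[Z,Y]_p> for Z in p1 + p2. *)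
Definition nomizu_U x X Y : 'M[R]_n.+1 :=
  \sum_(f <- metric_onb x)
    (2^-1 * (metric x (bracket_p f X) Y + metric x X (bracket_p f Y))) *: f.

(* The Levi-Civita connection of an invariant metric on a reductive space, as
   a Nomizu map, and its curvature at the base point (Kobayashi-Nomizu,
   Chapter X). *)
Definition nomizu x X Y : 'M[R]_n.+1 :=
  2^-1 *: bracket_p X Y + nomizu_U x X Y.

Definition Rm x X Y Z : 'M[R]_n.+1 :=
  nomizu x X (nomizu x Y Z) - nomizu x Y (nomizu x X Z)
  - nomizu x (bracket_p X Y) Z - bracket (bracket_k X Y) Z.

Definition Ric x X Y : R := trace_on pp (fun Z => Rm x Z X Y).

(* By homogeneity |Rm| is constant on G/K: this is also its supremum. *)
Definition Rm_norm x : R :=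
  Num.sqrt (\sum_(a <- metric_onb x) \sum_(b <- metric_onb x)
            \sum_(c <- metric_onb x) \sum_(d <- metric_onb x)
              metric x (Rm x a b c) d ^+ 2).

Definition einstein x : Prop :=
  exists lambda : R, forall X Y, X \in pp -> Y \in pp ->
    Ric x X Y = lambda * metric x X Y.

Definition unique_einstein_up_to_scaling : Prop :=
  exists x, [/\ 0 < x.1, 0 < x.2, einstein x &
    forall z : R * R, 0 < z.1 -> 0 < z.2 -> einstein z ->
      exists2 c : R, 0 < c & z = (c * x.1, c * x.2)].

(* g solves dg/dt = -2 Ric(g) on the interval I; the derivative at a point of
   I is taken within I, hence is one-sided at an end point of I. *)
Definition is_HRF (I : set R) (x : R -> R * R) : Prop :=
  forall t, I t ->
    [/\ 0 < (x t).1, 0 < (x t).2 &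
      forall X Y, X \in pp -> Y \in pp ->
        ((metric (x s) X Y - metric (x t) X Y) / (s - t)
           @[s --> within I t^']) --> - 2 * Ric (x t) X Y].

Definition type_I_singularity (x : R -> R * R) (T : R) : Prop :=
  ereal_sup [set (Rm_norm (x t))%:E | t in [set t | 0 <= t < T]] = +oo%E /\
  (ereal_sup [set ((T - t) * Rm_norm (x t))%:E | t in [set t : R | 0 <= t < T]%R]
     < +oo)%E.

(* [0, T) is the maximal interval of existence, and x is the only solution
   with its initial value: every other solution on some [0, T'), where T' may
   be +oo, is a restriction of x. *)
Definition is_unique_maximal_HRF (x0 : R * R) (T : R) (x : R -> R * R) : Prop :=
  [/\ x 0 = x0, is_HRF [set t | 0 <= t < T] x &
    forall (T' : \bar R) (z : R -> R * R),
      (0 < T')%E -> z 0 = x0 ->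
      is_HRF [set t | 0 <= t /\ (t%:E < T')%E] z ->
      (T' <= T%:E)%E /\ forall t, 0 <= t -> (t%:E < T')%E -> z t = x t].

End HomogeneousGeometry.

(* Main.v *)
Require Import Defs.
From HB Require Import structures.
From mathcomp Require Import all_boot all_order all_algebra.
From mathcomp Require Import all_classical all_reals all_analysis.
From mathcomp Require Import ring lra.
Import Order.TTheory GRing.Theory Num.Theory.
Import numFieldNormedType.Exports.
Local Open Scope classical_set_scope.
Local Open Scope ring_scope.

Set Implicit Arguments.
Unset Strict Implicit.
Unset Printing Implicit Defensive.

(** With y = x1/x2 the flow reads x1' = h1(y) and y' = p(y)/x1, where p is the
    Einstein cubic.  If p has ybar as its only root then p > 0 on [0, ybar), so
    y increases to ybar from below, and exchanging the two summands (y to 1/y)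
    reduces the case y > ybar to this one.  Hence y may serve as time: x1 and t
    are found from d(log x1)/dy = h1/p and dt/dy = x1/p, which gives existence
    and uniqueness.  The traces d_i A_i dominate 2[112] and 2[122], and this
    forces h1(ybar) < 0; near ybar the quantity x1 + c t is then nonincreasing
    in y for some c > 0, whence T < oo and T - t <= C x1, and x1 -> 0.  For an
    ancient solution x1 grows at most linearly backwards in time, so that
    y + (m/M) log(x1(t0) + M(t0 - t)) is nondecreasing, contradicting y > 0.

    The flow equations come from the Levi-Civita connection
    N(X, Y) = sum_k (w_k + w_j - w_i)/(2 w_k) [X, Y]_k for X in p_i and Y in p_j:
    the Ricci form is a combination of Ad(K)-invariant forms which, by Schur's
    lemma, are scalar on each summand and vanish between them, and the part of
    it that involves the Lie algebra of K is eliminated by the Killing form.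
    As |Rm| is homogeneous of degree -1 in (x1, x2) and bounds Ric from above,
    T - t <= C x1 and x1 -> 0 make the singularity of type I. *)

(** * Real analysis *)

(** The obstacle is that y' = p(y)/x1 is not autonomous. Dividing by it leaves two successive
    integrations in y, so the fundamental theorem of calculus and the derivative of an inverse
    function take the place of an existence theorem. Uniqueness then comes from two first integrals:
    if X(y) and tau(y) are x1 and time as functions of the ratio, then u/X(y) and tau(y) - t are
    constant along any solution (u, v). This requires y to stay in [y(0), ybar), which a Gronwall
    estimate at the root ybar provides.

    The strict sign h1(ybar) < 0 says that the Einstein metric has positive Ricci curvature. It
    bounds time, and this forces x1 to vanish: p is at most K(ybar - y), so if x1 stayed above some
    e > 0, the integral of x1/p would diverge logarithmically at ybar. The inequalities behind the
    sign are traces of the Killing form over the summands, with a nonnegative contribution of the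
    Lie algebra of K dropped. *)

Definition deriv_within (R : realType) (I : set R) (f : R -> R) (t l : R) : Prop :=
  ((f s - f t) / (s - t) @[s --> within I t^']) --> l.

Lemma cvg_dnbhs_shift (R : realType) (T : Type) (f : R -> T) (t : R) :
  (f \o shift t) @ 0^' = f @ t^'.
Proof.
apply/funext => A; rewrite /= !near_simpl /dnbhs !near_withinE.
have := near_shift 0 t (fun s => s != t -> A (f s)); rewrite !near_simpl => ->.
have E (s : R) : (s + t != t) = (s != 0) by rewrite -subr_eq0 addrK.
by apply/propext; split; apply: filterS => s /=; rewrite subr0 E.
Qed.

(** Bridge between the difference quotients of [is_HRF], where s tends to t, and the library
    derivative, where an increment tends to 0. *)
Lemma is_derive_quotient (R : realType) (f : R -> R) (t l : R) :
  is_derive t 1 f l <-> ((f s - f t) / (s - t) @[s --> t^']) --> l.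
Proof.
have E : (fun h : R => h^-1 *: ((f \o shift t) (h *: (1 : R)) - f t)) =
         (fun s => (f s - f t) / (s - t)) \o shift t.
  apply/funext => h /=.
  by rewrite addrK [_ *: (1 : R)]mulr1 mulrC.
split.
- case=> d <-; move: d; rewrite /derivable /derive E.
  by rewrite cvg_dnbhs_shift.
- move=> H; have H' : (fun h : R => h^-1 *: ((f \o shift t) (h *: (1 : R)) - f t)) @ 0^' --> l.
    by rewrite E cvg_dnbhs_shift.
  by split; [apply/cvg_ex; exists l | apply: cvg_lim].
Qed.

Lemma deriv_within_sub (R : realType) (I J : set R) (f : R -> R) (t l : R) :
  J `<=` I -> deriv_within I f t l -> deriv_within J f t l.
Proof.
move=> JI; apply: cvg_trans; apply: cvg_fmap2 => A.
by rewrite /= /within /=; apply: filterS => s h /JI.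
Qed.

Lemma is_derive_within (R : realType) (I : set R) (f : R -> R) (t l : R) :
  is_derive t 1 f l -> deriv_within I f t l.
Proof. by move/is_derive_quotient; apply: cvg_within_filter. Qed.

Lemma deriv_within_interior (R : realType) (I : set R) (f : R -> R) (t l : R) :
  nbhs t I -> deriv_within I f t l -> is_derive t 1 f l.
Proof.
move=> tI H; apply/is_derive_quotient; apply: cvg_trans H.
apply: cvg_fmap2 => A; rewrite /= /within /= => H.
have tI' : \forall s \near t^', I s by apply: nbhs_dnbhs.
by apply: filterS2 H tI' => s; apply.
Qed.

Lemma deriv_within_continuous (R : realType) (I : set R) (f df : R -> R) :
  (forall t, I t -> deriv_within I f t (df t)) -> {within I, continuous f}.
Proof.
move=> H; apply/subspace_continuousP => t It.
have := H t It; move/cvgrPdist_lt => /(_ 1 ltr01); rewrite near_withinE => D.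
apply/cvgrPdist_lt => e e0; rewrite near_withinE.
have k0 : 0 < `|df t| + 1 by rewrite ltr_wpDl.
have D' : \forall s \near t, s != t -> I s -> `|df t - (f s - f t) / (s - t)| < 1.
  by move: D; rewrite /dnbhs near_withinE.
near=> s => Is.
have [->|st] := eqVneq s t; first by rewrite subrr normr0.
have st0 : s - t != 0 by rewrite subr_eq0.
have B : `|df t - (f s - f t) / (s - t)| < 1.
  by move: st Is; near: s.
rewrite distrC -[f s - f t](@divfK _ (s - t))// normrM.
have B2 : `|(f s - f t) / (s - t)| <= `|df t| + 1.
  apply: ltW; rewrite -ltrBlDl; apply: le_lt_trans B.
  by rewrite distrC; apply: lerB_dist.
apply: (@le_lt_trans _ _ ((`|df t| + 1) * `|s - t|)).
  by rewrite ler_wpM2r.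
rewrite mulrC -ltr_pdivlMr// distrC.
by near: s; apply: cvgr_dist_lt => //; rewrite divr_gt0.
Unshelve. all: by end_near. Qed.

(** Derivatives within an interval may be one-sided at its ends. On a segment they still supply what
    the mean value theorem asks for: continuity up to the ends and a two-sided derivative inside. *)
Lemma deriv_within_segment (R : realType) (I : set R) (f df : R -> R) (a b : R) :
  `[a, b] `<=` I -> (forall t, I t -> deriv_within I f t (df t)) ->
  {within `[a, b], continuous f} /\
  (forall t, t \in `]a, b[ -> is_derive t 1 f (df t)).
Proof.
move=> abI H; split.
  apply: (continuous_subspaceW abI).
  exact: deriv_within_continuous H.
move=> t tab; apply: (@deriv_within_interior _ `[a, b]).
  by apply: filterS (near_in_itvoo tab) => s; apply: subset_itv_oo_cc.
apply: (deriv_within_sub abI); apply: H; apply: abI.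
exact: subset_itv_oo_cc tab.
Qed.

Lemma derive_ge0_le (R : realType) (f df : R -> R) (a b : R) :
  a <= b -> {within `[a, b], continuous f} ->
  (forall t, t \in `]a, b[ -> is_derive t 1 f (df t)) ->
  (forall t, t \in `]a, b[ -> 0 <= df t) -> f a <= f b.
Proof.
rewrite le_eqVlt => /predU1P[->//|ab] fc fd df0.
have [c cab E] := MVT ab fd fc.
by rewrite -subr_ge0 E mulr_ge0 ?df0// subr_ge0 ltW.
Qed.

Lemma derive_le0_ge (R : realType) (f df : R -> R) (a b : R) :
  a <= b -> {within `[a, b], continuous f} ->
  (forall t, t \in `]a, b[ -> is_derive t 1 f (df t)) ->
  (forall t, t \in `]a, b[ -> df t <= 0) -> f b <= f a.
Proof.
rewrite le_eqVlt => /predU1P[->//|ab] fc fd df0.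
have [c cab E] := MVT ab fd fc.
by rewrite -subr_le0 E mulr_le0_ge0 ?df0// subr_ge0 ltW.
Qed.

Lemma derive_gt0_lt (R : realType) (f df : R -> R) (a b : R) :
  a < b -> {within `[a, b], continuous f} ->
  (forall t, t \in `]a, b[ -> is_derive t 1 f (df t)) ->
  (forall t, t \in `]a, b[ -> 0 < df t) -> f a < f b.
Proof.
move=> ab fc fd df0.
have [c cab E] := MVT ab fd fc.
by rewrite -subr_gt0 E mulr_gt0 ?df0// subr_gt0.
Qed.

Lemma derive_eq0_eq (R : realType) (f df : R -> R) (a b : R) :
  a <= b -> {within `[a, b], continuous f} ->
  (forall t, t \in `]a, b[ -> is_derive t 1 f (df t)) ->
  (forall t, t \in `]a, b[ -> df t = 0) -> f a = f b.
Proof.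
rewrite le_eqVlt => /predU1P[->//|ab] fc fd df0.
have [c cab E] := MVT ab fd fc.
by apply/esym/eqP; rewrite -subr_eq0 E df0// mul0r.
Qed.

Lemma derive_segment_continuous (R : realType) (f df : R -> R) (a b : R) :
  (forall t, t \in `[a, b] -> is_derive t 1 f (df t)) ->
  {within `[a, b], continuous f}.
Proof.
move=> H; apply: continuous_in_subspaceT => t /set_mem tab.
by apply/differentiable_continuous/derivable1_diffP; case: (H t tab).
Qed.

Lemma is_derive_continuous (R : realType) (f : R -> R) (t l : R) :
  is_derive t 1 f l -> {for t, continuous f}.
Proof. by case=> d _; apply/differentiable_continuous/derivable1_diffP. Qed.

(** The right end is left out because the integrands used later have the cubic in the denominator,
    which vanishes there. The fundamental theorem is applied on [[a, (t + b) / 2]], a segment of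
    continuity with t in its interior. *)
Lemma antiderivative (R : realType) (f : R -> R) (a b : R) :
  (forall t, t \in `[a, b[ -> {for t, continuous f}) ->
  exists F : R -> R, forall t, t \in `]a, b[ -> is_derive t 1 F (f t).
Proof.
move=> fc.
exists (fun x => (\int[@lebesgue_measure R]_(t in [set` `[a, x]]) (f t))%R) => t.
rewrite in_itv /= => /andP[at_ tb].
have tu : t < (t + b) / 2 by rewrite midf_lt.
have ub : (t + b) / 2 < b by rewrite midf_lt.
have fi : (@lebesgue_measure R).-integrable `[a, (t + b) / 2] (EFin \o f).
  apply: continuous_compact_integrable; first exact: segment_compact.
  apply: continuous_in_subspaceT => s /set_mem /=; rewrite in_itv /= => /andP[as_ su].
  by apply: fc; rewrite in_itv /= as_ (le_lt_trans su).
have [] := @continuous_FTC1_closed _ f a t _ tu fi at_ _.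
  by apply: fc; rewrite in_itv /= tb ltW.
by rewrite derive1E => d E; exact: DeriveDef d E.
Qed.

(** * The planar flow *)

Lemma within_continuous_div (R : realType) (A : set R) (f g : R -> R) :
  (forall t, A t -> g t != 0) ->
  {within A, continuous f} -> {within A, continuous g} ->
  {within A, continuous (fun t => f t / g t)}.
Proof.
move=> g0 /subspace_continuousP fc /subspace_continuousP gc.
apply/subspace_continuousP => t At.
by apply: cvgM; [exact: fc | apply: cvgV; [exact: g0 | exact: gc]].
Qed.

Lemma within_continuousD (R : realType) (A : set R) (f g : R -> R) :
  {within A, continuous f} -> {within A, continuous g} ->
  {within A, continuous (fun t => f t + g t)}.
Proof. by move=> fc gc t; apply: (continuousD (fc t) (gc t)). Qed.

Lemma within_continuousM (R : realType) (A : set R) (f g : R -> R) :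
  {within A, continuous f} -> {within A, continuous g} ->
  {within A, continuous (fun t => f t * g t)}.
Proof. by move=> fc gc t; apply: (continuousM (fc t) (gc t)). Qed.

Lemma within_continuous_comp (R : realType) (A : set R) (f g : R -> R) :
  {within A, continuous f} -> continuous g ->
  {within A, continuous (fun t => g (f t))}.
Proof. by move=> fc gc t; apply: (continuous_comp (fc t) (gc _)). Qed.

Lemma is_derive_div (R : realType) (f g : R -> R) (t a b : R) :
  g t != 0 -> is_derive t 1 f a -> is_derive t 1 g b ->
  is_derive t 1 (fun s => f s / g s) ((a * g t - f t * b) / g t ^+ 2).
Proof.
move=> g0 fa gb.
apply: (is_derive_eq (is_deriveM fa (is_deriveV g0 gb))).
rewrite /GRing.scale /=; field.
exact: g0.
Qed.

(** * Monotonicity of the ratio and exclusion of ancient solutions *)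

Section TwoSpeeds.
Variables (R : realType) (al1 be1 ga1 al2 be2 ga2 : R).
Hypotheses (be1_gt0 : 0 < be1) (ga1_gt0 : 0 < ga1).
Hypothesis ga2_gt0 : 0 < ga2.

(** The equation for x2 has the same shape as that for x1, with its own constants and the inverse
    ratio, so one formula serves both. *)
Definition speed (al be ga y : R) : R := - al + be / y - ga * y ^+ 2.

Definition cubic (y : R) : R :=
  - (be2 + ga1) * y ^+ 3 + al2 * y ^+ 2 - al1 * y + be1 + ga2.

Definition flow (I : set R) (u v : R -> R) : Prop :=
  forall t, I t -> [/\ 0 < u t, 0 < v t,
    deriv_within I u t (speed al1 be1 ga1 (u t / v t)) &
    deriv_within I v t (speed al2 be2 ga2 (v t / u t))].

Lemma flow_segment (I : set R) (u v : R -> R) (a b : R) :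
  flow I u v -> `[a, b] `<=` I ->
  [/\ {within `[a, b], continuous u}, {within `[a, b], continuous v},
      {within `[a, b], continuous (fun t => u t / v t)},
      (forall t, t \in `[a, b] -> 0 < u t /\ 0 < v t) &
      forall t, t \in `]a, b[ -> is_derive t 1 u (speed al1 be1 ga1 (u t / v t)) /\
        is_derive t 1 (fun t => u t / v t) (cubic (u t / v t) / u t)].
Proof.
move=> F abI.
have pos t : t \in `[a, b] -> 0 < u t /\ 0 < v t by move=> /abI /F[].
have [uc ud] : {within `[a, b], continuous u} /\
    forall t, t \in `]a, b[ -> is_derive t 1 u (speed al1 be1 ga1 (u t / v t)).
  by apply: (deriv_within_segment abI) => t /F[].
have [vc vd] : {within `[a, b], continuous v} /\
    forall t, t \in `]a, b[ -> is_derive t 1 v (speed al2 be2 ga2 (v t / u t)).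
  by apply: (deriv_within_segment abI) => t /F[].
split=> //.
  by apply: within_continuous_div => // t /pos[_ /lt0r_neq0].
move=> t tab; split; first exact: ud.
have [u0 v0] : 0 < u t /\ 0 < v t by apply: pos; apply: subset_itv_oo_cc.
apply: (is_derive_eq (is_derive_div (lt0r_neq0 v0) (ud t tab) (vd t tab))).
rewrite /speed /cubic; field.
by rewrite !lt0r_neq0.
Qed.

Lemma cubic_continuous : continuous cubic.
Proof.
have -> : cubic = horner (- (be2 + ga1) *: 'X^3 + al2 *: 'X^2 - al1 *: 'X + (be1 + ga2)%:P).
  by apply/funext => y; rewrite /cubic !hornerE.
exact: continuous_horner.
Qed.

Variable r : R.
Hypotheses (r_gt0 : 0 < r) (cubic_r : cubic r = 0)
  (r_unique : forall y, cubic y = 0 -> y = r).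

Definition cubic_quot (y : R) : R :=
  (be2 + ga1) * (y ^+ 2 + y * r + r ^+ 2) - al2 * (y + r) + al1.

Lemma cubic_factor (y : R) : cubic y = (r - y) * cubic_quot y.
Proof.
rewrite -[LHS]subr0 -cubic_r /cubic /cubic_quot; ring.
Qed.

Lemma cubic_quot_continuous : continuous cubic_quot.
Proof.
have -> : cubic_quot = horner ((be2 + ga1) *: ('X^2 + r *: 'X + (r ^+ 2)%:P) - al2 *: ('X +
    r%:P) + al1%:P).
  by apply/funext => y; rewrite /cubic_quot !hornerE; ring.
exact: continuous_horner.
Qed.

Lemma cubic_gt0 (y : R) : 0 <= y -> y < r -> 0 < cubic y.
Proof.
move=> y0 yr; rewrite ltNge; apply/negP => py.
have p0 : 0 < cubic 0 by rewrite /cubic !expr0n /= !mulr0 subr0 !add0r addr_gt0.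
have [||c] := @IVT R cubic 0 y 0 y0.
- exact/continuous_subspaceT/cubic_continuous.
- by rewrite ge_min py orbT le_max ltW.
rewrite in_itv /= => /andP[c0 cy] /r_unique cr.
by move: yr; rewrite ltNge -cr cy.
Qed.

(** Gronwall in both time directions. With k = [cubic_quot y / u] one has ((y - r)^2)' = -2k (y -
    r)^2, and |k| is at most K on the segment. Hence (y - r)^2 exp(2Kt) is nondecreasing and (y -
    r)^2 exp(-2Kt) nonincreasing; both are nonnegative and vanish at c, so the first vanishes at a
    and the second at b. *)
Lemma flow_ratio_stationary (I : set R) (u v : R -> R) (a b c : R) :
  flow I u v -> `[a, b] `<=` I -> c \in `[a, b] -> u c / v c = r ->
  u a / v a = r /\ u b / v b = r.
Proof.
move=> F abI cab yc.
have [uc _ yC pos D] := flow_segment F abI.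
set y := fun t => u t / v t in yC D *.
have [ac cb] : a <= c /\ c <= b by move: cab; rewrite in_itv /= => /andP[].
have ab := le_trans ac cb.
pose k (t : R) : R := cubic_quot (y t) / u t.
have kc : {within `[a, b], continuous (fun t => `|k t|)}.
  have kc : {within `[a, b], continuous k}.
    apply: within_continuous_div => //; first by move=> t /pos[/lt0r_neq0].
    exact: (within_continuous_comp yC cubic_quot_continuous).
  by apply: (within_continuous_comp kc) => t; exact: norm_continuous.
have [K0 _ KE] := EVT_max ab kc; set K : R := `|k K0| in KE.
pose G (s t : R) : R := (y t - r) ^+ 2 * expR (s * (K * t)).
have Gc s a' b' : a <= a' -> b' <= b -> {within `[a', b'], continuous (G s)}.
  move=> aa bb; apply: (@continuous_subspaceW _ _ _ `[a, b]).
    by apply: subset_itv; rewrite bnd_simp.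
  apply: within_continuousM.
    apply: (within_continuous_comp (g := fun z => (z - r) ^+ 2)) => // z.
    apply: (@cvgM R R); apply: (@cvgB R R); [exact: cvg_id|exact: cvg_cst|exact: cvg_id|exact:
        cvg_cst].
  apply: continuous_subspaceT => t.
  apply: continuous_comp; last exact: continuous_expR.
  by apply: cvgM; [exact: cvg_cst | apply: cvgM; [exact: cvg_cst | exact: cvg_id]].
have Gd s t : t \in `]a, b[ ->
    is_derive t 1 (G s) ((y t - r) ^+ 2 * expR (s * (K * t)) * (s * K - 2 * k t)).
  move=> tab; have [_ yd] := D t tab.
  have [u0 v0] : 0 < u t /\ 0 < v t by apply: pos; apply: subset_itv_oo_cc.
  have E1 : is_derive t 1 (fun t => (y t - r) ^+ 2) (2 * (y t - r) * (cubic (y t) / u t)).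
    have E0 := is_deriveB yd (is_derive_cst r t 1).
    apply: (is_derive_eq (is_deriveM E0 E0)).
    rewrite /GRing.scale /= subr0 -[(y - cst r) t]/(y t - r) -[u t / v t]/(y t).
    by ring.
  have E2 : is_derive t 1 (fun t => expR (s * (K * t))) (expR (s * (K * t)) * (s * K)).
    apply: (@is_derive1_comp R expR (fun t => s * (K * t))).
    apply: (is_derive_eq (is_deriveZ s (is_deriveZ K (is_derive_id t 1)))).
    by rewrite /GRing.scale /= mulr1.
  apply: (is_derive_eq (is_deriveM E1 E2)).
  rewrite /GRing.scale /= cubic_factor /k; field.
  by rewrite lt0r_neq0.
have w0 s t : G s t = 0 -> y t = r.
  move/eqP; rewrite /G mulf_eq0 expR_eq0 orbF sqrf_eq0 subr_eq0.
  by move/eqP.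
have Gc0 s : G s c = 0 by rewrite /G [y c]yc subrr expr0n mul0r.
have G0 s t : 0 <= G s t by rewrite mulr_ge0 ?sqr_ge0 ?expR_ge0.
clearbody G; split; [apply: (w0 2) | apply: (w0 (- 2))]; apply/eqP; rewrite eq_le G0 andbT.
- have H := derive_ge0_le ac (Gc 2 a c (lexx a) cb).
  have sub t : t \in `]a, c[ -> t \in `]a, b[ by apply: subset_itvl; rewrite bnd_simp.
  rewrite -(Gc0 2); apply: (H _ (fun t tac => Gd 2 t (sub t tac))) => t /sub tac.
  apply: mulr_ge0; first by rewrite mulr_ge0 ?sqr_ge0 ?expR_ge0.
  have : `|k t| <= K.
    by apply: KE; apply: subset_itv_oo_cc.
  by rewrite ler_norml => /andP[_ h]; lra.
- have H := derive_le0_ge cb (Gc (- 2) c b ac (lexx b)).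
  have sub t : t \in `]c, b[ -> t \in `]a, b[ by apply: subset_itvr; rewrite bnd_simp.
  rewrite -(Gc0 (- 2)); apply: (H _ (fun t tcb => Gd (- 2) t (sub t tcb))) => t /sub tcb.
  apply: mulr_ge0_le0; first by rewrite mulr_ge0 ?sqr_ge0 ?expR_ge0.
  have : `|k t| <= K.
    by apply: KE; apply: subset_itv_oo_cc.
  by rewrite ler_norml => /andP[h _]; lra.
Qed.

(** A ratio that changed sides would take the value r in between, and would then equal r at both
    ends. *)
Lemma flow_ratio_lt (I : set R) (u v : R -> R) (a b : R) :
  a <= b -> flow I u v -> `[a, b] `<=` I -> (u a / v a < r) = (u b / v b < r).
Proof.
move=> ab F abI.
have [_ _ yC _ _] := flow_segment F abI.
have stat c : c \in `[a, b] -> u c / v c = r -> u a / v a = r /\ u b / v b = r.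
  by move=> cab; apply: (flow_ratio_stationary F abI cab).
have ivt := @IVT R (fun t => u t / v t) a b r ab yC.
case: (ltP (u a / v a) r) => ya; case: (ltP (u b / v b) r) => yb //.
- have [|c cab /(stat _ cab)[Ea _]] := ivt; first by rewrite ge_min le_max (ltW ya) yb orbT.
  by move: ya; rewrite Ea ltxx.
- have [|c cab /(stat _ cab)[_ Eb]] := ivt; first by rewrite ge_min le_max ya (ltW yb) orbT.
  by move: yb; rewrite Eb ltxx.
Qed.

Lemma flow_ratio_le (I : set R) (u v : R -> R) (a b : R) :
  a <= b -> flow I u v -> `[a, b] `<=` I -> u b / v b < r ->
  u a / v a <= u b / v b.
Proof.
move=> ab F abI yb.
have [_ _ yC pos D] := flow_segment F abI.
have H := derive_ge0_le ab yC.
apply: (H _ (fun t tab => proj2 (D t tab))) => t tab; have tab' := subset_itv_oo_cc tab.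
have [u0 v0] := pos t tab'.
apply: divr_ge0; last exact: ltW.
apply: ltW; apply: cubic_gt0; first by rewrite divr_ge0 ?ltW.
have /andP[at_ tb] : a <= t <= b by move: tab'; rewrite in_itv.
rewrite (@flow_ratio_lt I _ _ t b) //.
by apply: subset_trans abI; apply: subset_itvr; rewrite bnd_simp.
Qed.

Lemma speed_decreasing (al be ga x y : R) :
  0 < be -> 0 < ga -> 0 < x -> x <= y -> speed al be ga y <= speed al be ga x.
Proof.
move=> be0 ga0 x0 xy; have y0 := lt_le_trans x0 xy.
rewrite /speed; apply: lerB; first by rewrite lerD2l ler_pM2l// lef_pV2.
by rewrite ler_pM2l// ler_sqr ?nnegrE// ltW.
Qed.

Lemma flow_not_ancient (T t0 : R) (u v : R -> R) :
  flow [set t | t < T] u v -> t0 < T -> ~ (u t0 / v t0 < r).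
Proof.
move=> F t0T y0r; set y0 : R := u t0 / v t0 in y0r.
have sub t : `[t, t0] `<=` [set t | t < T].
  by move=> s /=; rewrite in_itv /= => /andP[_ /le_lt_trans]; apply.
have pos t : t <= t0 -> 0 < u t /\ 0 < v t.
  by move=> tt0; have [] := F t (le_lt_trans tt0 t0T).
have [u0 v0] := pos t0 (lexx _).
have y00 : 0 < y0 by rewrite divr_gt0.
have yle t : t <= t0 -> u t / v t <= y0.
  by move=> tt0; apply: (flow_ratio_le tt0 F).
(* Before t0 the ratio is at most y0 and [speed] decreases in the ratio, so u' is at least [speed]
   at y0, hence at least -M, at all earlier times. *)
pose M : R := `|speed al1 be1 ga1 y0| + 1.
have M0 : 0 < M by rewrite ltr_wpDl.
have ubnd t : t <= t0 -> u t <= u t0 + M * (t0 - t).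
  move=> tt0; have [uC _ _ _ D] := flow_segment F (@sub t).
  suff : u t + M * t <= u t0 + M * t0 by rewrite mulrBr; lra.
  have gd s : s \in `]t, t0[ ->
      is_derive s 1 (fun t => u t + M * t) (speed al1 be1 ga1 (u s / v s) + M).
    move=> /D[ud _]; apply: (is_derive_eq (is_deriveD ud (is_deriveZ M (is_derive_id s 1)))).
    by rewrite /GRing.scale /= mulr1.
  have gc : {within `[t, t0], continuous (fun t => u t + M * t)}.
    apply: within_continuousD => //.
    by apply: continuous_subspaceT => x; apply: cvgM; [exact: cvg_cst|exact: cvg_id].
  apply: (derive_ge0_le tt0 gc gd).
  - move=> s sab; have st0 : s <= t0 by move: sab; rewrite in_itv /= => /andP[_ /ltW].
    have [us vs] := pos s st0.
    have : speed al1 be1 ga1 y0 <= speed al1 be1 ga1 (u s / v s).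
      by apply: speed_decreasing => //; [rewrite divr_gt0 | exact: yle].
    have := @ler_norm R (- speed al1 be1 ga1 y0); rewrite normrN /M; lra.
(* The minimum is taken on the closed segment from 0, since the ratio may come arbitrarily close to
   0 backwards in time. *)
have [c c0y mE] := EVT_min (ltW y00) (continuous_subspaceT cubic_continuous).
have m0 : 0 < cubic c.
  move: c0y; rewrite in_itv /= => /andP[c0 cy].
  by apply: cubic_gt0 => //; apply: le_lt_trans y0r.
set m : R := cubic c in mE m0.
pose phi (t : R) : R := u t / v t + m / M * ln (u t0 + M * (t0 - t)).
have phile t : t <= t0 -> phi t <= phi t0.
  move=> tt0; have [_ _ yC _ D] := flow_segment F (@sub t).
  have p0 s : s \in `[t, t0] -> 0 < u t0 + M * (t0 - s).
    by rewrite in_itv /= => /andP[_ s0]; rewrite ltr_pwDl// mulr_ge0 ?subr_ge0 // ltW.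
  have lnd s : s \in `[t, t0] -> is_derive s 1 (fun s => ln (u t0 + M * (t0 - s))) ((u t0 + M *
      (t0 - s))^-1 * (- M)).
    move=> ss; apply: (@is_derive1_comp R (@ln R) (fun s => u t0 + M * (t0 - s))).
      exact/is_derive1_ln/p0.
    apply: (is_derive_eq (is_deriveD (is_derive_cst (u t0) s 1) (is_deriveZ M (is_deriveB
        (is_derive_cst t0 s 1) (is_derive_id s 1))))).
    by rewrite /GRing.scale /= sub0r add0r mulrN1.
  have phid s : s \in `]t, t0[ -> is_derive s 1 phi
      (cubic (u s / v s) / u s + m / M * ((u t0 + M * (t0 - s))^-1 * (- M))).
    move=> ss; have [_ yd] := D s ss.
    by apply: (is_derive_eq (is_deriveD yd (is_deriveZ (m / M) (lnd s (subset_itv_oo_cc ss))))).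
  have phic : {within `[t, t0], continuous phi}.
    apply: within_continuousD => //.
    apply: within_continuousM; last exact: (derive_segment_continuous lnd).
    by apply: continuous_subspaceT => x; exact: cvg_cst.
  apply: (derive_ge0_le tt0 phic phid).
  - move=> s ss; have q0 := p0 s (subset_itv_oo_cc ss).
    have st0 : s <= t0 by move: ss; rewrite in_itv /= => /andP[_ /ltW].
    have [us vs] := pos s st0.
    have -> : m / M * ((u t0 + M * (t0 - s))^-1 * - M) = - (m / (u t0 + M * (t0 - s))).
      by field; rewrite !lt0r_neq0.
    rewrite subr_ge0; apply: (@le_trans _ _ (m / u s)).
      by rewrite ler_pM2l// lef_pV2 ?posrE//; exact: ubnd.
    rewrite ler_pM2r ?invr_gt0//; apply: mE.
    by rewrite in_itv /= yle// divr_ge0 ?ltW.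
(* At time t0 - exp(N)/M the logarithm in [phi] is ln(u t0 + exp N) > N, so its term alone exceeds
   [phi t0], although [phi] is nondecreasing and the ratio is positive. *)
pose N : R := phi t0 * M / m.
have eN := expR_gt0 N.
have tt : t0 - expR N / M <= t0 by rewrite gerBl divr_ge0 ?ltW.
have EN : M * (t0 - (t0 - expR N / M)) = expR N by field; rewrite lt0r_neq0.
have := phile _ tt; rewrite {1}/phi EN.
have [us vs] := pos _ tt.
have ypos : 0 < u (t0 - expR N / M) / v (t0 - expR N / M) by rewrite divr_gt0.
move=> H; have {H} : m / M * ln (u t0 + expR N) < phi t0 by lra.
rewrite mulrC -ltr_pdivlMr ?divr_gt0// invf_div mulrA -/N.
rewrite -ltr_expR lnK ?posrE ?addr_gt0//.
by rewrite ltNge lerDr ltW.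
Qed.

End TwoSpeeds.

(** * Solving the flow with the ratio as time *)

Section Quadrature.
Variables (R : realType) (al1 be1 ga1 al2 be2 ga2 r : R).
Hypotheses (be1_gt0 : 0 < be1) (ga2_gt0 : 0 < ga2) (r_gt0 : 0 < r).
Local Notation p := (cubic al1 be1 ga1 al2 be2 ga2).
Local Notation h := (speed al1 be1 ga1).
Hypotheses (p_r : p r = 0) (r_unique : forall y, p y = 0 -> y = r).

Let p_gt0 y : 0 < y -> y < r -> 0 < p y.
Proof. by move=> /ltW; exact: (cubic_gt0 be1_gt0 ga2_gt0 r_unique). Qed.

Lemma speed_continuous (al be ga y : R) :
  0 < y -> {for y, continuous (speed al be ga)}.
Proof.
move=> y0; apply: cvgB.
  by apply: cvgD; [exact: cvg_cst | apply: cvgM; [exact: cvg_cst | apply: cvgV; [exact: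
      lt0r_neq0 | exact: cvg_id]]].
by apply: cvgM; [exact: cvg_cst | exact: exprn_continuous].
Qed.

(** The interval starts strictly below y0, so that [tau] can be inverted on both sides of time 0.
    The antiderivatives live on ]y0/3, r[ and ]y0/2, r[: the second integrand contains the first
    antiderivative and has to be continuous at the left end of its own interval. *)
Lemma quadrature (y0 u0 : R) : 0 < y0 -> y0 < r -> 0 < u0 ->
  exists (al : R) (X tau : R -> R),
    [/\ 0 < al, al < y0, X y0 = u0, tau y0 = 0 &
      forall s, al < s -> s < r ->
        [/\ 0 < X s, is_derive s 1 X (X s * h s / p s) &
            is_derive s 1 tau (X s / p s)]].
Proof.
move=> y00 y0r u00.
have [L Ld] : exists L, forall s, s \in `](y0 / 3), r[ -> is_derive s 1 L (h s / p s).
  apply: antiderivative => s; rewrite in_itv /= => /andP[ys sr].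
  have s0 : 0 < s by apply: lt_le_trans ys; rewrite divr_gt0.
  apply: cvgM; first exact: speed_continuous.
  by apply: cvgV; [exact/lt0r_neq0/p_gt0 | exact: cubic_continuous].
pose X (s : R) : R := expR (L s - L y0 + ln u0).
have X0 s : 0 < X s by exact: expR_gt0.
have Xd s : y0 / 3 < s -> s < r -> is_derive s 1 X (X s * h s / p s).
  move=> ys sr; have Lds : is_derive s 1 L (h s / p s) by apply: Ld; rewrite in_itv /= ys.
  have Ed : is_derive s 1 (fun s => L s - L y0 + ln u0) (h s / p s).
    apply: (is_derive_eq (is_deriveD (is_deriveB Lds (is_derive_cst (L y0) s 1)) (is_derive_cst
        (ln u0) s 1))).
    by rewrite subr0 addr0.
  by rewrite -mulrA; exact: (is_derive1_comp (is_derive_expR _) Ed).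
have [tau td] : exists tau, forall s, s \in `](y0 / 2), r[ -> is_derive s 1 tau (X s / p s).
  apply: antiderivative => s; rewrite in_itv /= => /andP[ys sr].
  have s3 : y0 / 3 < s by apply: lt_le_trans ys; lra.
  have s0 : 0 < s by apply: lt_trans s3; rewrite divr_gt0.
  apply: cvgM; first exact: (is_derive_continuous (Xd _ s3 sr)).
  by apply: cvgV; [exact/lt0r_neq0/p_gt0 | exact: cubic_continuous].
exists (y0 / 2), X, (fun s => tau s - tau y0); split.
- by rewrite divr_gt0.
- lra.
- by rewrite /X subrr add0r lnK.
- by rewrite subrr.
move=> s ys sr; split => //; first by apply: Xd => //; lra.
have tds : is_derive s 1 tau (X s / p s) by apply: td; rewrite in_itv /= ys.
apply: (is_derive_eq (is_deriveB tds (is_derive_cst (tau y0) s 1))).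
by rewrite subr0.
Qed.

Variables (al y0 u0 : R) (X tau : R -> R).
Hypotheses (h_r : h r < 0) (al_gt0 : 0 < al) (al_y0 : al < y0) (y0_r : y0 < r).
Hypotheses (X_y0 : X y0 = u0) (tau_y0 : tau y0 = 0).
Hypothesis Xtau : forall s, al < s -> s < r ->
  [/\ 0 < X s, is_derive s 1 X (X s * h s / p s) & is_derive s 1 tau (X s / p s)].

Let p_pos s : al < s -> s < r -> 0 < p s.
Proof. by move=> als; apply: p_gt0; apply: lt_trans als. Qed.

Let seg a b s : al < a -> b < r -> s \in `[a, b] -> al < s /\ s < r.
Proof.
move=> ala br; rewrite in_itv /= => /andP[as_ sb].
by split; [exact: lt_le_trans as_ | exact: le_lt_trans br].
Qed.

Lemma tau_lt (s t : R) : al < s -> s < t -> t < r -> tau s < tau t.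
Proof.
move=> als st tr.
have D x (xst : x \in `[s, t]) : is_derive x 1 tau (X x / p x).
  by have [ax xr] := seg als tr xst; have [] := Xtau ax xr.
apply: (derive_gt0_lt st (derive_segment_continuous D) (fun x xst => D x (subset_itv_oo_cc xst))).
move=> x /subset_itv_oo_cc xst; have [ax xr] := seg als tr xst.
by rewrite divr_gt0 ?p_pos//; have [] := Xtau ax xr.
Qed.

Lemma tau_le (s t : R) : al < s -> s <= t -> t < r -> tau s <= tau t.
Proof.
move=> als; rewrite le_eqVlt => /predU1P[->//|st] tr.
exact/ltW/tau_lt.
Qed.

Lemma speed_neg_near : exists c y2 : R,
  [/\ 0 < c, y0 < y2, y2 < r & forall s, y2 <= s -> s < r -> h s <= - c].
Proof.
have H : \forall s \near r, h s < h r / 2.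
  have hc := @speed_continuous al1 be1 ga1 r r_gt0.
  have E : h r < h r / 2 by move: h_r => q0; lra.
  by apply: (cvgr_lt _ hc).
have [d /= d0 dH] := H.
exists (- (h r / 2)), (Num.max ((y0 + r) / 2) (r - d / 2)); split.
- by move: h_r => q0; lra.
- by rewrite lt_max midf_lt.
- by rewrite gt_max midf_lt //= gtrBl divr_gt0.
move=> s; rewrite ge_max => /andP[_ ds] sr; rewrite opprK; apply/ltW/dH => /=.
by rewrite ger0_norm ?subr_ge0 ?(ltW sr)//; lra.
Qed.

(** The source of all estimates at the end of the flow: for fixed s it bounds [tau t] from above,
    and the supremum over t compares the remaining time with X s. *)
Lemma tau_X_le : exists c y2 : R, [/\ 0 < c, y0 < y2, y2 < r &
  forall s t, y2 <= s -> s <= t -> t < r -> c * (tau t - tau s) <= X s - X t].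
Proof.
have [c [y2 [c0 yy2 y2r H]]] := speed_neg_near.
exists c, y2; split => // s t y2s st tr.
have als : al < s by rewrite (lt_le_trans _ y2s)// (lt_trans al_y0).
pose g (x : R) : R := c * tau x + X x.
have D x (xst : x \in `[s, t]) : is_derive x 1 g (c * (X x / p x) + X x * h x / p x).
  have [ax xr] := seg als tr xst; have [_ Xd td] := Xtau ax xr.
  exact: (is_deriveD (is_deriveZ c td) Xd).
suff gts : g t <= g s by move: gts; rewrite mulrBr /g => gts; lra.
apply: (derive_le0_ge st (derive_segment_continuous D) (fun x xst => D x (subset_itv_oo_cc xst))).
move=> x /subset_itv_oo_cc xst; have [ax xr] := seg als tr xst.
have [X0 _ _] := Xtau ax xr.
have -> : c * (X x / p x) + X x * h x / p x = (X x / p x) * (c + h x) by ring.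
rewrite mulr_ge0_le0 ?divr_ge0 ?(ltW (p_pos _ _)) ?(ltW X0)//.
have := H x; rewrite xr; move: xst; rewrite in_itv /= => /andP[sx _].
by move=> /(_ (le_trans y2s sx) isT); lra.
Qed.

Lemma tau_bounded : exists M : R, forall s, al < s -> s < r -> tau s <= M.
Proof.
have [c [y2 [c0 yy2 y2r H]]] := tau_X_le.
have aly2 : al < y2 by exact: lt_trans yy2.
have bnd s : y2 <= s -> s < r -> tau s <= tau y2 + X y2 / c.
  move=> y2s sr; have Hs := H y2 s (lexx _) y2s sr.
  have [X0 _ _] := Xtau (lt_le_trans aly2 y2s) sr.
  by rewrite -lerBlDl ler_pdivlMr// mulrC; lra.
exists (tau y2 + X y2 / c) => s als sr.
have [/bnd|/ltW sy2] := leP y2 s; first exact.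
by apply: (le_trans (tau_le als sy2 y2r)); exact: bnd.
Qed.

Definition blowup_time : R := sup [set tau s | s in [set s | al < s < r]].
Local Notation T := blowup_time.

Let tau_sup : has_sup [set tau s | s in [set s | al < s < r]].
Proof.
split; first by exists (tau y0), y0 => //=; rewrite al_y0.
by have [M HM] := tau_bounded; exists M => _ [s /= /andP[als sr] <-]; exact: HM.
Qed.

Lemma tau_lt_blowup (s : R) : al < s -> s < r -> tau s < T.
Proof.
move=> als sr.
have [sm mr] : s < (s + r) / 2 /\ (s + r) / 2 < r by rewrite !midf_lt.
apply: (lt_le_trans (tau_lt als sm mr)).
apply: ub_le_sup; first by case: tau_sup.
by exists ((s + r) / 2) => //=; rewrite mr (lt_trans als sm).
Qed.

Lemma blowup_gt0 : 0 < T.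
Proof. by rewrite -tau_y0 tau_lt_blowup. Qed.

Lemma tau_onto (t : R) : 0 <= t -> t < T -> exists s, [/\ y0 <= s, s < r & tau s = t].
Proof.
move=> t0 tT.
have [_ [s /= /andP[als sr] <-] ts] := sup_adherent (ltac:(by rewrite subr_gt0; exact: tT) : 0
    < T - t) tau_sup.
have {}ts : t < tau s by move: ts; rewrite /blowup_time; lra.
have ys : y0 < s.
  by rewrite ltNge; apply/negP => sy; have := tau_le als sy y0_r; rewrite tau_y0; lra.
have D x (xst : x \in `[y0, s]) : is_derive x 1 tau (X x / p x).
  by have [ax xr] := seg al_y0 sr xst; have [] := Xtau ax xr.
have [|c cs <-] := @IVT R tau y0 s t (ltW ys) (derive_segment_continuous D).
  by rewrite tau_y0 ge_min t0 le_max (ltW ts) orbT.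
exists c; move: cs; rewrite in_itv /= => /andP[yc cs]; split => //.
exact: le_lt_trans sr.
Qed.

(** X is nonincreasing near r, so one value below e suffices. If there is none, tau' = X/p is at
    least e/(K(r - y)), because p contains the factor r - y; then [tau] grows at least like -(e/K)
    ln(r - y), against [tau_bounded]. *)
Lemma X_vanish (e : R) : 0 < e ->
  exists s0, [/\ y0 < s0, s0 < r & forall s, s0 <= s -> s < r -> X s < e].
Proof.
move=> e0.
have [c [y2 [c0 yy2 y2r H]]] := tau_X_le.
have aly2 : al < y2 by exact: lt_trans yy2.
have X_decr s t : y2 <= s -> s <= t -> t < r -> X t <= X s.
  move=> ys st tr; have := H s t ys st tr.
  have := tau_le (lt_le_trans aly2 ys) st tr; nra.
have [[s0 [ys0 s0r Xs0]]|none] := pselect (exists s0, [/\ y2 <= s0, s0 < r & X s0 < e]).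
  exists s0; split => //; first exact: lt_le_trans ys0.
  by move=> s s0s sr; apply: le_lt_trans Xs0; apply: X_decr.
have Xe s : y2 <= s -> s < r -> e <= X s.
  by move=> ys sr; rewrite leNgt; apply/negP => Xs; apply: none; exists s.
have [M HM] := tau_bounded.
have [k0 _ kE] := EVT_max (ltW r_gt0) (continuous_subspaceT (@cubic_quot_continuous R al1 ga1
    al2 be2 r)).
pose K : R := `|cubic_quot al1 ga1 al2 be2 r k0| + 1.
have K0 : 0 < K by rewrite ltr_wpDl.
have pK s : 0 <= s -> s < r -> p s <= K * (r - s).
  move=> s0 sr; rewrite (cubic_factor p_r) mulrC ler_pM2r ?subr_gt0//.
  apply: (@le_trans _ _ (cubic_quot al1 ga1 al2 be2 r k0)).
    by apply: kE; rewrite in_itv /= s0 ltW.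
  by rewrite /K ler_wpDr// ler_norm.
(* N is chosen so that the logarithmic growth from y2 to the point s defined below is (e/K) N = M -
   tau y2 + 1, which pushes [tau s] beyond its bound M. *)
pose N : R := K / e * (M - tau y2 + 1).
have N0 : 0 <= N.
  rewrite mulr_ge0 ?divr_ge0 ?(ltW K0) ?(ltW e0)//.
  by have := HM y2 aly2 y2r; lra.
pose s : R := r - (r - y2) * expR (- N).
have ry2 : 0 < r - y2 by rewrite subr_gt0.
have sr : s < r by rewrite gtrBl mulr_gt0 ?expR_gt0.
have y2s : y2 <= s.
  have : expR (- N) <= 1 by rewrite expR_le1 oppr_le0.
  by rewrite /s; nra.
pose g (x : R) : R := tau x + e / K * ln (r - x).
have D x (xst : x \in `[y2, s]) : is_derive x 1 g (X x / p x + e / K * ((r - x)^-1 * (- 1))).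
  have [ax xr] := seg aly2 sr xst; have [_ Xd td] := Xtau ax xr.
  have Dr : is_derive x 1 (fun x : R => r - x) (- 1 : R).
    by apply: (is_derive_eq (is_deriveB (is_derive_cst r x 1) (is_derive_id x 1))); rewrite sub0r.
  have Dl : is_derive x 1 (fun x : R => ln (r - x)) ((r - x)^-1 * (- 1 : R)).
    have rx0 : 0 < r - x by rewrite subr_gt0.
    exact: (@is_derive1_comp R (@ln R) (fun x => r - x) x _ _ (is_derive1_ln rx0) Dr).
  exact: (is_deriveD td (is_deriveZ (e / K) Dl)).
have : g y2 <= g s.
  apply: (derive_ge0_le y2s (derive_segment_continuous D) (fun x xst => D x (subset_itv_oo_cc
      xst))).
  move=> x /subset_itv_oo_cc xst; have [ax xr] := seg aly2 sr xst.
  have x0 : 0 < x by exact: lt_trans ax.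
  have rx0 : 0 < r - x by rewrite subr_gt0.
  have p0 := p_pos ax xr.
  have -> : e / K * ((r - x)^-1 * -1) = - (e / (K * (r - x))).
    by field; rewrite !lt0r_neq0.
  rewrite subr_ge0; apply: (@le_trans _ _ (e / p x)).
    by rewrite ler_pM2l// lef_pV2 ?posrE ?mulr_gt0//; apply: pK => //; exact: ltW.
  rewrite ler_pM2r ?invr_gt0//; apply: Xe => //.
  by move: xst; rewrite in_itv /= => /andP[].
have rs : r - s = (r - y2) * expR (- N) by rewrite /s; ring.
rewrite /g rs lnM ?posrE ?expR_gt0// expRK.
have := HM s (lt_le_trans aly2 y2s) sr.
have : e / K * N = M - tau y2 + 1 by rewrite /N; field; rewrite !lt0r_neq0.
rewrite mulrDr mulrN; lra.
Qed.

(** Two regimes. On [y2, r) [tau_X_le] gives the factor 1/c; on the segment [y0, y2] X has a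
    positive minimum while the remaining time is at most T. The constant adds the two factors. *)
Lemma blowup_sub_tau_le : exists C : R, 0 < C /\
  forall s, y0 <= s -> s < r -> T - tau s <= C * X s.
Proof.
have [c [y2 [c0 yy2 y2r H]]] := tau_X_le.
have aly2 : al < y2 by exact: lt_trans yy2.
have near s : y2 <= s -> s < r -> T - tau s <= X s / c.
  move=> ys sr; rewrite lerBlDl; apply: ge_sup; first by case: tau_sup.
  move=> _ [t /= /andP[alt tr] <-].
  have als := lt_le_trans aly2 ys.
  have [st|/ltW ts] := leP s t.
    have Ht := H s t ys st tr; have [Xt _ _] := Xtau alt tr.
    by rewrite -lerBlDl ler_pdivlMr// mulrC; lra.
  have [Xs _ _] := Xtau als sr.
  by apply: (le_trans (tau_le alt ts sr)); rewrite lerDl divr_ge0 ?ltW.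
have D x (xst : x \in `[y0, y2]) : is_derive x 1 X (X x * h x / p x).
  by have [ax xr] := seg al_y0 y2r xst; have [] := Xtau ax xr.
have [m my mE] := EVT_min (ltW yy2) (derive_segment_continuous D).
have Xm : 0 < X m by have [am mr] := seg al_y0 y2r my; have [] := Xtau am mr.
have T0 := blowup_gt0.
exists (c^-1 + T / X m); split; first by rewrite addr_gt0 ?invr_gt0 ?divr_gt0.
move=> s ys sr; have als := lt_le_trans al_y0 ys.
have [Xs _ _] := Xtau als sr.
rewrite mulrDl; have [y2s|/ltW sy2] := leP y2 s.
  apply: (le_trans (near s y2s sr)); rewrite mulrC lerDl.
  by rewrite mulr_ge0 ?divr_ge0 ?ltW.
apply: (@le_trans _ _ (T / X m * X s)); last by rewrite lerDr mulr_ge0 ?invr_ge0 ?ltW.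
apply: (@le_trans _ _ T).
  by rewrite gerBl -tau_y0; apply: tau_le.
rewrite mulrAC ler_pdivlMr// ler_pM2l//; apply: mE.
by rewrite in_itv /= ys.
Qed.

(** The default [y0] only occurs at times that [tau] does not take on ]al, r[; every time in [0, T)
    is taken. *)
Definition tau_inv (t : R) : R := xget y0 [set s | al < s < r /\ tau s = t].

Lemma tau_invK (s : R) : al < s -> s < r -> tau_inv (tau s) = s.
Proof.
move=> als sr; rewrite /tau_inv.
case: xgetP => [x _ [/andP[ax xr] E]|/(_ s)]; last by rewrite /= als sr; case.
have [xs|sx|//] := ltgtP x s.
- by have := tau_lt ax xs sr; rewrite E ltxx.
- by have := tau_lt als sx xr; rewrite E ltxx.
Qed.

Lemma is_derive_tau_inv (s : R) : al < s -> s < r ->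
  is_derive (tau s) 1 tau_inv (p s / X s).
Proof.
move=> als sr; have [X0 _ td] := Xtau als sr; have p0 := p_pos als sr.
rewrite -invf_div; apply: is_derive_inverse td _.
- near=> x; apply: tau_invK.
    by near: x; exact: lt_nbhsr.
  by near: x; exact: lt_nbhsl.
- near=> x.
  have ax : al < x by near: x; exact: lt_nbhsr.
  have xr : x < r by near: x; exact: lt_nbhsl.
  by have [_ _ /is_derive_continuous] := Xtau ax xr.
- by rewrite lt0r_neq0 ?divr_gt0.
Unshelve. all: by end_near. Qed.

Definition sol1 (t : R) : R := X (tau_inv t).
Definition sol2 (t : R) : R := X (tau_inv t) / tau_inv t.

Lemma sol_at (t : R) : 0 <= t -> t < T ->
  exists s, [/\ y0 <= s, s < r, tau s = t, tau_inv t = s & 0 < X s].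
Proof.
move=> t0 tT; have [s [ys sr st]] := tau_onto t0 tT.
have als := lt_le_trans al_y0 ys.
exists s; split=> //; first by rewrite -st tau_invK.
by have [] := Xtau als sr.
Qed.

Lemma sol_flow : flow al1 be1 ga1 al2 be2 ga2 [set t | 0 <= t < T] sol1 sol2.
Proof.
move=> t /andP[t0 tT]; have [s [ys sr st Es X0]] := sol_at t0 tT.
have als := lt_le_trans al_y0 ys.
have s0 : 0 < s by exact: lt_trans als.
have p0 := p_pos als sr; have [_ Xd _] := Xtau als sr.
have Yd := is_derive_tau_inv als sr; rewrite st in Yd.
have d1 : is_derive t 1 sol1 (h s).
  have Xd' : is_derive (tau_inv t) 1 X (X s * h s / p s) by rewrite Es.
  apply: (is_derive_eq (is_derive1_comp Xd' Yd)).
  by field; rewrite !lt0r_neq0.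
have d2 : is_derive t 1 sol2 (speed al2 be2 ga2 s^-1).
  have Y0 : tau_inv t != 0 by rewrite Es lt0r_neq0.
  apply: (is_derive_eq (is_derive_div Y0 d1 Yd)).
  rewrite /sol1 Es /speed /cubic; field.
  by rewrite !lt0r_neq0.
have E : sol1 t / sol2 t = s by rewrite /sol1 /sol2 Es invf_div mulrC divfK// lt0r_neq0.
have E' : sol2 t / sol1 t = s^-1 by rewrite -E invf_div.
rewrite E E'; split.
- by rewrite /sol1 Es.
- by rewrite /sol2 Es divr_gt0.
- exact: is_derive_within.
- exact: is_derive_within.
Qed.

(** The ratio y of the given solution stays in [y0, r), where X and [tau] are available. By the
    chain rule u/X(y) and tau(y) - t have zero derivative; their values at 0 give u = X(y) and
    tau(y(t)) = t, so y(t) = [tau_inv t] and t lies below the supremum T. *)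
Lemma sol_unique (J : set R) (u v : R -> R) (t : R) :
  flow al1 be1 ga1 al2 be2 ga2 J u v -> 0 <= t -> `[0, t] `<=` J ->
  u 0 = u0 -> u 0 / v 0 = y0 -> [/\ t < T, u t = sol1 t & v t = sol2 t].
Proof.
move=> F t0 sub uE yE.
pose y (s : R) : R := u s / v s.
have sub1 s : 0 <= s -> s <= t -> `[0, s] `<=` J /\ `[s, t] `<=` J.
  by move=> s0 st; split; apply: subset_trans sub; [apply: subset_itvl | apply: subset_itvr];
      rewrite bnd_simp.
have inn s : s \in `[0, t] -> [/\ y0 <= y s, y s < r, al < y s & 0 < u s /\ 0 < v s].
  move=> st; have [_ _ _ pos _] := flow_segment F sub.
  move: (st); rewrite in_itv /= => /andP[s0 s1].
  have [subl _] := sub1 s s0 s1.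
  have yr : y s < r by rewrite -(flow_ratio_lt p_r s0 F subl) yE.
  have yl : y0 <= y s.
    by rewrite -yE; exact: (flow_ratio_le be1_gt0 ga2_gt0 p_r r_unique s0 F subl yr).
  by split => //; [exact: lt_le_trans yl | exact: pos].
have [uc _ yc pos D] := flow_segment F sub.
have comp (f : R -> R) (df : R -> R) (fd : forall s, al < s -> s < r -> is_derive s 1 f (df s)) :
    {within `[0, t], continuous (fun s => f (y s))} /\
    forall s, s \in `]0, t[ -> is_derive s 1 (fun s => f (y s)) (df (y s) * (p (y s) / u s)).
  split.
    apply/subspace_continuousP => s st; have [_ yr ay _] := inn s st.
    move/subspace_continuousP : yc => /(_ s st) ycs.
    by apply: continuous_cvg ycs; exact: is_derive_continuous (fd _ ay yr).
  move=> s sst; have [_ yr ay _] := inn s (subset_itv_oo_cc sst).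
  exact: (is_derive1_comp (fd _ ay yr) (proj2 (D s sst))).
have Xd0 s (als : al < s) (sr : s < r) : is_derive s 1 X (X s * h s / p s).
  by have [] := Xtau als sr.
have td0 s (als : al < s) (sr : s < r) : is_derive s 1 tau (X s / p s).
  by have [] := Xtau als sr.
have [Xc Xd] := comp X _ Xd0.
have [tc td] := comp tau _ td0.
have ne0 s : s \in `[0, t] -> [/\ X (y s) != 0, p (y s) != 0 & u s != 0].
  move=> /inn[_ yr ay [us _]]; have [X0 _ _] := Xtau ay yr.
  by rewrite !lt0r_neq0 ?p_pos.
have uX s : s \in `[0, t] -> u s = X (y s).
  move=> st; move: (st); rewrite in_itv /= => /andP[s0 s1].
  have sub0 x : x \in `[0, s] -> x \in `[0, t] by apply: subset_itvl; rewrite bnd_simp.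
  have sub2 x : x \in `]0, s[ -> x \in `]0, t[ by apply: subset_itvl; rewrite bnd_simp.
  have qc : {within `[0, s], continuous (fun s => u s / X (y s))}.
    apply: (continuous_subspaceW sub0).
    by apply: within_continuous_div => // x /ne0[].
  have Xne x (xs : x \in `]0, s[) : X (y x) != 0.
    by have [] := ne0 x (sub0 x (subset_itv_oo_cc xs)).
  have qd x (xs : x \in `]0, s[) := is_derive_div (Xne x xs) (proj1 (D x (sub2 x xs))) (Xd x
      (sub2 x xs)).
  have E : u 0 / X (y 0) = u s / X (y s).
    apply: (derive_eq0_eq s0 qc qd) => x xs.
    have [X0 p0 x0] := ne0 x (sub0 x (subset_itv_oo_cc xs)).
    rewrite -[u x / v x]/(y x); field.
    by rewrite X0 p0 x0.
  have [Xs _ _] := ne0 s st.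
  have zt : 0 \in `[0, t] by rewrite in_itv /= lexx.
  have [_ _ u00] := ne0 0 zt.
  by rewrite -[LHS](divfK Xs) -E {1}/y yE X_y0 -uE divff// mul1r.
have tauE : tau (y t) = t.
  pose g (s : R) : R := tau (y s) - s.
  have gc : {within `[0, t], continuous g}.
    apply: (within_continuousD (g := fun s => - s)) => //.
    by apply: continuous_subspaceT => x; exact: opp_continuous.
  have gd s (st : s \in `]0, t[) := is_deriveB (td s st) (is_derive_id s 1).
  have E : g 0 = g t.
    apply: (derive_eq0_eq t0 gc gd) => s st.
    have st' := subset_itv_oo_cc st; have [X0 p0 us0] := ne0 s st'.
    by rewrite (uX s st'); field; rewrite X0.
  by move: E; rewrite /g {1}/y yE tau_y0 subrr => /esym/eqP; rewrite subr_eq0 => /eqP.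
have tt : t \in `[0, t] by rewrite in_itv /= lexx t0.
have [yl yr ay [ut vt]] := inn t tt.
have Yt : tau_inv t = y t by rewrite -{1}tauE tau_invK.
split; first by rewrite -tauE tau_lt_blowup.
- by rewrite /sol1 Yt uX.
- by rewrite /sol2 Yt -uX// /y invf_div mulrC divfK// lt0r_neq0.
Qed.

Lemma sol_at0 : sol1 0 = u0 /\ sol2 0 = u0 / y0.
Proof. by rewrite /sol1 /sol2 -tau_y0 tau_invK ?X_y0. Qed.

Lemma tau_inv_ge (s t : R) : y0 <= s -> s < r -> tau s <= t -> t < T -> s <= tau_inv t.
Proof.
move=> ys sr st tT.
have t0 : 0 <= t.
  by apply: le_trans st; rewrite -tau_y0; apply: tau_le.
have [x [yx xr xt -> _]] := sol_at t0 tT.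
rewrite leNgt; apply/negP => xs.
by have := tau_lt (lt_le_trans al_y0 yx) xs sr; rewrite xt ltNge st.
Qed.

Lemma sol_limits :
  [/\ sol1 t @[t --> T^'-] --> (0 : R), sol2 t @[t --> T^'-] --> (0 : R) &
     (sol1 t / sol2 t) @[t --> T^'-] --> r].
Proof.
have T0 := blowup_gt0.
have ev s : y0 <= s -> s < r ->
    \forall t \near T^'-, [/\ s <= tau_inv t, tau_inv t < r, 0 < X (tau_inv t) & 0 < t < T].
  move=> ys sr; near=> t.
  have tT : t < T by near: t; exact: nbhs_left_lt.
  have t0 : 0 < t by near: t; exact: nbhs_left_gt.
  have st : tau s <= t.
    near: t; apply: nbhs_left_ge; apply: tau_lt_blowup => //.
    exact: lt_le_trans ys.
  have [x [yx xr xt Ex X0]] := sol_at (ltW t0) tT.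
  by split; rewrite ?t0 ?tT ?Ex//; rewrite -Ex; exact: tau_inv_ge.
have l1 : sol1 t @[t --> T^'-] --> (0 : R).
  apply/cvgrPdist_lt => e e0; have [s [ys sr Xs]] := X_vanish e0.
  apply: filterS (ev s (ltW ys) sr) => t [st tr X0 _].
  by rewrite sub0r normrN /sol1 gtr0_norm//; exact: Xs.
have lY : tau_inv t @[t --> T^'-] --> r.
  apply/cvgrPdist_lt => e e0.
  have [] := ev (Num.max y0 (r - e / 2)).
  - by rewrite le_max lexx.
  - by rewrite gt_max y0_r /= gtrBl divr_gt0.
  move=> d /= d0 dH; exists d => //= t td tT; have [st tr _ _] := dH t td tT.
  rewrite gtr0_norm ?subr_gt0//; move: st; rewrite ge_max => /andP[_]; lra.
split => //.
- rewrite -(mul0r r^-1); apply: cvgM => //.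
  by apply: cvgV => //; exact: lt0r_neq0.
- apply: cvg_trans lY; apply: near_eq_cvg.
  apply: filterS (ev y0 (lexx _) y0_r) => t [yt tr X0 _].
  rewrite /sol1 /sol2 invf_div mulrC divfK// lt0r_neq0//.
Unshelve. all: by end_near. Qed.

Lemma sol_bounds : exists C : R, 0 < C /\ forall t, 0 <= t -> t < T ->
  [/\ T - t <= C * sol1 t, T - t <= C * sol2 t,
      sol1 t <= C * sol2 t & sol2 t <= C * sol1 t].
Proof.
have [C [C0 H]] := blowup_sub_tau_le.
have y00 : 0 < y0 by exact: lt_trans al_y0.
(* The ratio x1/x2 lies in [y0, r), hence x1 <= r x2 and x2 <= x1/y0. The constant adds what the
   four estimates need separately. *)
exists (C + C * r + r + y0^-1); split; first by rewrite !addr_gt0 ?mulr_gt0 ?invr_gt0.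
move=> t t0 tT; have [s [ys sr st Es X0]] := sol_at t0 tT.
have s0 : 0 < s by exact: lt_le_trans ys.
have E2 : sol1 t = s * sol2 t.
  by rewrite /sol1 /sol2 Es mulrCA divff ?mulr1// lt0r_neq0.
have p1 : 0 < sol1 t by rewrite /sol1 Es.
have p2 : 0 < sol2 t by rewrite /sol2 Es divr_gt0.
have HH : T - t <= C * sol1 t by rewrite /sol1 Es -[in leLHS]st; exact: H.
have h21 : sol2 t <= y0^-1 * sol1 t.
  by rewrite ler_pdivlMl// E2 ler_pM2r.
have h12 : sol1 t <= r * sol2 t by rewrite E2 ler_pM2r// ltW.
have q1 : 0 <= C * sol1 t by rewrite mulr_ge0 ?ltW.
have q2 : 0 <= C * sol2 t by rewrite mulr_ge0 ?ltW.
have q3 : 0 <= r * sol1 t by rewrite mulr_ge0 ?ltW.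
have q4 : 0 <= r * sol2 t by rewrite mulr_ge0 ?ltW.
have q5 : 0 <= y0^-1 * sol1 t by rewrite mulr_ge0 ?invr_ge0 ?ltW.
have q6 : 0 <= y0^-1 * sol2 t by rewrite mulr_ge0 ?invr_ge0 ?ltW.
have q7 : 0 <= C * r * sol1 t by rewrite !mulr_ge0 ?ltW.
have q8 : C * sol1 t <= C * r * sol2 t by rewrite -mulrA ler_pM2l.
by rewrite !mulrDl; split; lra.
Qed.

End Quadrature.

(** * Exchange of the summands and summary of the planar flow *)

Section Swap.
Variables (R : realType) (al1 be1 ga1 al2 be2 ga2 r : R).
Hypotheses (be1_gt0 : 0 < be1) (ga1_gt0 : 0 < ga1).
Hypotheses (be2_gt0 : 0 < be2) (ga2_gt0 : 0 < ga2) (r_gt0 : 0 < r).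
Local Notation p := (cubic al1 be1 ga1 al2 be2 ga2).
Local Notation q := (cubic al2 be2 ga2 al1 be1 ga1).
Hypotheses (p_r : p r = 0) (r_unique : forall y, p y = 0 -> y = r).

Lemma flow_swap (I : set R) (u v : R -> R) :
  flow al1 be1 ga1 al2 be2 ga2 I u v -> flow al2 be2 ga2 al1 be1 ga1 I v u.
Proof. by move=> F t /F[]. Qed.

Lemma cubic_swap (y : R) : y != 0 -> q y = - y ^+ 3 * p y^-1.
Proof. by move=> y0; rewrite /cubic; field. Qed.

Lemma cubic_swap_root : q r^-1 = 0.
Proof. by rewrite cubic_swap ?invr_eq0 ?lt0r_neq0// invrK p_r mulr0. Qed.

Lemma cubic_swap_unique (y : R) : q y = 0 -> y = r^-1.
Proof.
have [->|y0] := eqVneq y 0.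
  rewrite /cubic !expr0n /= !mulr0 subr0 !add0r => E.
  by have := addr_gt0 be2_gt0 ga1_gt0; rewrite E ltxx.
rewrite cubic_swap// => /eqP; rewrite mulf_eq0 oppr_eq0 expf_eq0 /= (negPf y0) /=.
by move=> /eqP/r_unique <-; rewrite invrK.
Qed.

Lemma ratio_swap (u v : R) : 0 < u -> 0 < v -> r < u / v -> v / u < r^-1.
Proof.
move=> u0 v0 ruv; rewrite -[v / u]invf_div ltf_pV2 ?posrE// divr_gt0//.
Qed.

End Swap.

Lemma flow_ancient_ratio (R : realType) (al1 be1 ga1 al2 be2 ga2 r T t : R) (u v : R -> R) :
  0 < be1 -> 0 < ga1 -> 0 < be2 -> 0 < ga2 -> 0 < r ->
  cubic al1 be1 ga1 al2 be2 ga2 r = 0 ->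
  (forall y, cubic al1 be1 ga1 al2 be2 ga2 y = 0 -> y = r) ->
  flow al1 be1 ga1 al2 be2 ga2 [set t | t < T] u v -> t < T -> u t / v t = r.
Proof.
move=> be1_gt0 ga1_gt0 be2_gt0 ga2_gt0 r_gt0 p_r r_unique F tT.
have [ltr|gtr|//] := ltgtP (u t / v t) r.
  by case: (flow_not_ancient be1_gt0 ga1_gt0 ga2_gt0 p_r r_unique F tT).
have [u0 v0 _ _] := F t tT.
have qr := cubic_swap_root r_gt0 p_r.
have qu := cubic_swap_unique ga1_gt0 be2_gt0 r_unique.
case: (flow_not_ancient be2_gt0 ga2_gt0 ga1_gt0 qr qu (flow_swap F) tT).
exact: ratio_swap.
Qed.

(** Symmetric in u and v up to replacing r by its inverse, so that the case above r follows from the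
    case below it. Uniqueness is localised to segments [0, t], which covers competing solutions on
    bounded and unbounded intervals alike and shows that none of them reaches T. *)
Definition flow_conclusion (R : realType) (al1 be1 ga1 al2 be2 ga2 r u0 v0 T : R)
    (u v : R -> R) : Prop :=
  [/\ [/\ 0 < T, u 0 = u0, v 0 = v0 &
        flow al1 be1 ga1 al2 be2 ga2 [set t | 0 <= t < T] u v],
      (forall (J : set R) (z w : R -> R) (t : R),
        flow al1 be1 ga1 al2 be2 ga2 J z w -> 0 <= t -> `[0, t] `<=` J ->
        z 0 = u0 -> w 0 = v0 -> [/\ t < T, z t = u t & w t = v t]),
      [/\ u t @[t --> T^'-] --> (0 : R), v t @[t --> T^'-] --> (0 : R) &
          (u t / v t) @[t --> T^'-] --> r] &
      exists C : R, 0 < C /\ forall t, 0 <= t -> t < T ->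
        [/\ T - t <= C * u t, T - t <= C * v t, u t <= C * v t & v t <= C * u t]].

Lemma flow_solution_below (R : realType) (al1 be1 ga1 al2 be2 ga2 r u0 v0 : R) :
  0 < be1 -> 0 < ga2 -> 0 < r ->
  cubic al1 be1 ga1 al2 be2 ga2 r = 0 ->
  (forall y, cubic al1 be1 ga1 al2 be2 ga2 y = 0 -> y = r) ->
  speed al1 be1 ga1 r < 0 -> 0 < u0 -> 0 < v0 -> u0 / v0 < r ->
  exists (T : R) (u v : R -> R),
    flow_conclusion al1 be1 ga1 al2 be2 ga2 r u0 v0 T u v.
Proof.
move=> be1_gt0 ga2_gt0 r_gt0 p_r r_unique h_r u00 v00 y0r.
have y00 : 0 < u0 / v0 by rewrite divr_gt0.
have [al [X [tau [al0 aly X0 tau0 Xtau]]]] := quadrature be1_gt0 ga2_gt0 r_unique y00 y0r u00.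
have uv0 : u0 / (u0 / v0) = v0 by rewrite invf_div mulrC divfK// lt0r_neq0.
have [E1 E2] := sol_at0 be1_gt0 ga2_gt0 r_unique al0 aly y0r X0 tau0 Xtau.
exists (blowup_time r al tau), (sol1 r al (u0 / v0) X tau), (sol2 r al (u0 / v0) X tau).
split.
- split.
  + exact: (blowup_gt0 be1_gt0 ga2_gt0 r_gt0 r_unique h_r al0 aly y0r tau0 Xtau).
  + exact: E1.
  + by rewrite E2.
  + exact: (sol_flow be1_gt0 ga2_gt0 r_gt0 r_unique h_r al0 aly y0r tau0 Xtau).
- move=> J z w t F t0 sub z0 w0.
  apply: (sol_unique be1_gt0 ga2_gt0 r_gt0 p_r r_unique h_r al0 aly y0r X0 tau0 Xtau F t0 sub z0).
  by rewrite z0 w0.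
- exact: (sol_limits be1_gt0 ga2_gt0 r_gt0 p_r r_unique h_r al0 aly y0r tau0 Xtau).
- exact: (sol_bounds be1_gt0 ga2_gt0 r_gt0 r_unique h_r al0 aly y0r tau0 Xtau).
Qed.

Lemma flow_solution (R : realType) (al1 be1 ga1 al2 be2 ga2 r u0 v0 : R) :
  0 < be1 -> 0 < ga1 -> 0 < be2 -> 0 < ga2 -> 0 < r ->
  cubic al1 be1 ga1 al2 be2 ga2 r = 0 ->
  (forall y, cubic al1 be1 ga1 al2 be2 ga2 y = 0 -> y = r) ->
  speed al1 be1 ga1 r < 0 -> speed al2 be2 ga2 r^-1 < 0 ->
  0 < u0 -> 0 < v0 -> u0 / v0 <> r ->
  exists (T : R) (u v : R -> R),
    flow_conclusion al1 be1 ga1 al2 be2 ga2 r u0 v0 T u v.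
Proof.
move=> be1_gt0 ga1_gt0 be2_gt0 ga2_gt0 r_gt0 p_r r_unique h1 h2 u00 v00 y0r.
have [ltr|gtr|//] := ltgtP (u0 / v0) r.
  exact: flow_solution_below.
have qr := cubic_swap_root r_gt0 p_r.
have qu := cubic_swap_unique ga1_gt0 be2_gt0 r_unique.
have ri0 : 0 < r^-1 by rewrite invr_gt0.
have [T [v [u [[T0 Ev Eu F] uniq [lv lu lr] [C [C0 HC]]]]]] :=
  flow_solution_below be2_gt0 ga1_gt0 ri0 qr qu h2 v00 u00 (ratio_swap r_gt0 u00 v00 gtr).
exists T, u, v; split.
- by split => //; exact: flow_swap.
- move=> J z w t Fz t0 sub z0 w0.
  by have [] := uniq J w z t (flow_swap Fz) t0 sub w0 z0.
- split => //.
  have -> : (fun t => u t / v t) = (fun t => (v t / u t)^-1).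
    by apply/funext => t; rewrite invf_div.
  by rewrite -[r]invrK; apply: cvgV => //; exact: lt0r_neq0.
- exists C; split => // t t0 tT.
  by have [] := HC t t0 tT.
Qed.

(** * Curves in compact matrix groups *)

Lemma linear_mx_continuous (R : realType) (m n : nat) (V : normedModType R)
    (f : {linear 'M[R]_(m, n) -> V}) : continuous f.
Proof.
move=> M.
have E : (f : 'M[R]_(m, n) -> V) = fun N => \sum_i \sum_j N i j *: f (delta_mx i j).
  apply/funext => N; rewrite {1}(matrix_sum_delta N) linear_sum; apply: eq_bigr => i _.
  by rewrite linear_sum; apply: eq_bigr => j _; rewrite linearZ.
rewrite E; apply: (@cvg_big _ _ _ _ _ _ _ (nbhs M) _ (fun i (N : 'M[R]_(m, n)) => \sum_j N i j
    *: f (delta_mx i j))).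
  by move=> x; apply: add_continuous.
move=> i _; apply: (@cvg_big _ _ _ _ _ _ _ (nbhs M) _ (fun j (N : 'M[R]_(m, n)) => N i j *: f
    (delta_mx i j))).
  by move=> x; apply: add_continuous.
by move=> j _; apply: cvgZr_tmp; exact: coord_continuous.
Qed.

Lemma cvg_sum (R : realType) (V : normedModType R) (T I : Type) (F : set_system T)
    (FF : Filter F) (r : seq I) (f : I -> T -> V) (a : I -> V) :
  (forall i, f i x @[x --> F] --> a i) ->
  \sum_(i <- r) f i x @[x --> F] --> \sum_(i <- r) a i.
Proof. by move=> H; apply: cvg_big => //; exact: add_continuous. Qed.

Lemma cvg_mulmx (R : realType) (m n p : nat) (T : Type) (F : set_system T) (FF : Filter F)
    (A : T -> 'M[R]_(m, n)) (B : T -> 'M[R]_(n, p)) (A0 : 'M[R]_(m, n)) (B0 : 'M[R]_(n, p)) :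
  A x @[x --> F] --> A0 -> B x @[x --> F] --> B0 ->
  A x *m B x @[x --> F] --> A0 *m B0.
Proof.
move=> HA HB.
have E (M : 'M[R]_(m, n)) (N : 'M[R]_(n, p)) :
    M *m N = \sum_i \sum_j M i j *: (delta_mx i j *m N).
  rewrite {1}(matrix_sum_delta M) mulmx_suml; apply: eq_bigr => i _.
  by rewrite mulmx_suml; apply: eq_bigr => j _; rewrite scalemxAl.
rewrite E; under eq_cvg do rewrite E.
apply: cvg_sum => i; apply: cvg_sum => j; apply: cvgZ.
  exact: (continuous_cvg _ (@coord_continuous _ _ _ i j A0) HA).
exact: (continuous_cvg _ (@linear_mx_continuous _ _ _ _ (mulmx (delta_mx i j)) B0) HB).
Qed.

Lemma cvg_mx_entries (R : realType) (m n : nat) (T : Type) (F : set_system T)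
    (FF : Filter F) (A : T -> 'M[R]_(m, n)) (A0 : 'M[R]_(m, n)) :
  (forall i j, A x i j @[x --> F] --> A0 i j) -> A x @[x --> F] --> A0.
Proof.
move=> H; rewrite (matrix_sum_delta A0).
under eq_cvg do rewrite (matrix_sum_delta (A _)).
by apply: cvg_sum => i; apply: cvg_sum => j; apply: cvgZr_tmp.
Qed.

Lemma compact_entries_bounded (R : realType) (m n : nat) (G : set 'M[R]_(m, n)) :
  compact G -> exists B : R, forall a i j, G a -> `|a i j| <= B.
Proof.
move=> cG.
have H i j : exists B : R, forall a, G a -> `|a i j| <= B.
  have : compact ((fun a : 'M[R]_(m, n) => a i j) @` G).
    apply: continuous_compact => //; apply: continuous_subspaceT.
    exact: coord_continuous.
  move=> /compact_bounded [M [_ /(_ (M + 1))]].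
  by rewrite ltrDl ltr01 => /(_ isT) HM; exists (M + 1) => a Ga; apply: HM; exists a.
pose B i j : R := xget 0 [set B : R | forall a, G a -> `|a i j| <= B].
have BP i j a : G a -> `|a i j| <= B i j.
  rewrite /B; case: xgetP => [x _ /(_ a)|/[swap] _] //.
  by have [x Hx] := H i j => /(_ x).
exists (\sum_i \sum_j `|B i j|) => a i j Ga.
apply: (le_trans (BP i j a Ga)); apply: (le_trans (ler_norm _)).
rewrite (bigD1 i)//= (bigD1 j)//= -addrA lerDl addr_ge0//.
  by apply: sumr_ge0.
by apply: sumr_ge0 => k _; apply: sumr_ge0.
Qed.

Section GroupCurve.
Variables (R : realType) (n : nat) (H : set 'M[R]_n.+1).
Hypotheses (H_group : matrix_group H) (H_compact : compact H).
Variables (c : R -> 'M[R]_n.+1) (C : 'M[R]_n.+1).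
Hypotheses (c0 : c 0 = 1%:M) (cH : forall t, H (c t)).
Hypothesis c_derive : is_derive (0 : R) (1 : R) c C.

Let cV t : c t \in unitmx.
Proof. by have [_ _ /(_ _ (cH t))[]] := H_group. Qed.

Let quotient_cvg : t^-1 *: (c t - 1%:M) @[t --> 0^'] --> C.
Proof.
have [d <-] := c_derive; move: d; rewrite /derivable /derive.
apply: cvg_trans; apply: near_eq_cvg; apply: nearW => t /=.
by rewrite c0 addr0 [t *: 1]mulr1.
Qed.

Let c_cvg : c t @[t --> 0^'] --> (1%:M : 'M[R]_n.+1).
Proof.
have E : (t *: (t^-1 *: (c t - 1%:M)) + 1%:M) @[t --> 0^'] --> (1%:M : 'M[R]_n.+1).
  rewrite -[X in _ --> X]add0r -(scale0r C); apply: cvgD; last exact: cvg_cst.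
  by apply: cvgZ => //; apply: cvg_within.
apply: cvg_trans E; apply: near_eq_cvg; near=> t.
have t0 : t != 0 by near: t; exact: nbhs_dnbhs_neq.
by rewrite scalerA divff// scale1r subrK.
Unshelve. all: by end_near. Qed.

(** The inverses stay in the compact group, so their entries are bounded; the identity c^-1 - 1 =
    c^-1 (1 - c) then gives convergence. *)
Let invc_cvg : invmx (c t) @[t --> 0^'] --> (1%:M : 'M[R]_n.+1).
Proof.
have [B HB] := compact_entries_bounded H_compact.
have inv_bnd t i j : `|invmx (c t) i j| <= B.
  by apply: HB; have [_ _ /(_ _ (cH t))[]] := H_group.
apply: cvg_mx_entries => i j.
have S0 : (\sum_k `|(1%:M - c t) k j|) @[t --> 0^'] --> \sum_(k < n.+1) (0 : R).
  apply: (@cvg_sum R R) => k.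
  have D : 1%:M - c t @[t --> 0^'] --> (1%:M - 1%:M : 'M[R]_n.+1).
    by apply: cvgB => //; exact: cvg_cst.
  have Dk := continuous_cvg _ (@coord_continuous _ _ _ k j _) D.
  have E0 : (1%:M - 1%:M : 'M[R]_n.+1) k j = 0 by rewrite subrr mxE.
  by have L := cvg_norm (Dk _); rewrite E0 normr0 in L; exact: L.
rewrite big1// in S0.
have L : B * (\sum_k `|(1%:M - c t) k j|) @[t --> 0^'] --> (0 : R).
  have L := @cvgM R R _ _ (fun=> B) _ B 0 (cvg_cst B) S0.
  by rewrite mulr0 in L; exact: L.
apply/cvgrPdist_le => e e0.
have := cvgr_norm_le _ L; rewrite normr0 => /(_ _ e e0).
apply: filterS => t; apply: le_trans.
rewrite distrC.
have -> : invmx (c t) i j - (1%:M : 'M[R]_n.+1) i j = \sum_k invmx (c t) i k * (1%:M - c t) k j.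
  have -> : invmx (c t) i j - (1%:M : 'M[R]_n.+1) i j = (invmx (c t) *m (1%:M - c t)) i j.
    by rewrite mulmxBr mulmx1 mulVmx// !mxE.
  by rewrite mxE.
apply: (le_trans (ler_norm_sum _ _ _)).
rewrite mulr_sumr (ger0_norm (sumr_ge0 _ _)).
  by apply: ler_sum => k _; rewrite normrM ler_wpM2r.
move=> k _; rewrite mulr_ge0//; exact: le_trans (inv_bnd 0 ord0 ord0).
Qed.

Lemma Ad_curve_derivative (X : 'M[R]_n.+1) :
  t^-1 *: (Ad (c t) X - X) @[t --> 0^'] --> bracket C X.
Proof.
(* Since c X c^-1 - X = [c - 1, X] c^-1, the inverse only has to converge and need not be
   differentiated. *)
have E t : t^-1 *: (Ad (c t) X - X) =
    ((t^-1 *: (c t - 1%:M)) *m X - X *m (t^-1 *: (c t - 1%:M))) *m invmx (c t).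
  rewrite -!scalemxAl -!scalemxAr -scalerBr -scalemxAl; congr (_ *: _).
  have -> : (c t - 1%:M) *m X - X *m (c t - 1%:M) = c t *m X - X *m c t.
    by rewrite mulmxBl mulmxBr mul1mx mulmx1 opprB addrA subrK.
  by rewrite mulmxBl -[X *m c t *m _]mulmxA mulmxV// mulmx1.
under eq_cvg do rewrite E.
rewrite -[bracket C X]mulmx1; apply: cvg_mulmx => //.
by apply: cvgB; apply: cvg_mulmx => //; exact: cvg_cst.
Qed.

Lemma Ad_curve_cvg (X : 'M[R]_n.+1) : Ad (c t) X @[t --> 0^'] --> X.
Proof.
have L := cvg_mulmx _ (cvg_mulmx _ c_cvg (cvg_cst X)) invc_cvg.
by have := L _ _; rewrite mul1mx mulmx1; apply.
Qed.

Lemma bracket_curve_mem (V : {vspace 'M[R]_n.+1}) (X : 'M[R]_n.+1) :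
  (forall t, Ad (c t) X \in V) -> X \in V -> bracket C X \in V.
Proof.
move=> AV XV.
(* The continuous map f vanishes exactly on V, so the limit of difference quotients in V stays in
   V. *)
pose f : 'End('M[R]_n.+1) := (\1 - projv V)%VF.
have fc : continuous f by exact: linear_mx_continuous.
have f0 Y : Y \in V -> f Y = 0.
  by move=> YV; rewrite /f add_lfunE opp_lfunE id_lfunE projv_id// subrr.
have L := continuous_cvg _ (fc (bracket C X)) (@Ad_curve_derivative X).
have L0 : f (t^-1 *: (Ad (c t) X - X)) @[t --> 0^'] --> (0 : 'M[R]_n.+1).
  have -> : (fun t => f (t^-1 *: (Ad (c t) X - X))) = fun=> 0.
    by apply/funext => t; apply: f0; rewrite memvZ// memvB.
  exact: cvg_cst.
have : f (bracket C X) = 0 by apply: (cvg_unique _ (L _) L0).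
rewrite /f add_lfunE opp_lfunE id_lfunE => /eqP; rewrite subr_eq0 => /eqP ->.
exact: memv_proj.
Qed.

End GroupCurve.

(** * The invariant scalar product *)

Lemma is_derive_linear_mx (R : realType) (m n : nat) (f : {linear 'M[R]_(m.+1, n.+1) ->
    'M[R]_(m.+1, n.+1)})
    (c : R -> 'M[R]_(m.+1, n.+1)) (X : 'M[R]_(m.+1, n.+1)) :
  is_derive (0 : R) (1 : R) c X -> is_derive (0 : R) (1 : R) (f \o c) (f X).
Proof.
case=> d <-; move: d; rewrite /derivable /derive => d.
have E : (fun h : R => h^-1 *: (((f \o c) \o shift 0) (h *: (1 : R)) - (f \o c) 0)) =
    f \o (fun h : R => h^-1 *: ((c \o shift 0) (h *: (1 : R)) - c 0)).
  by apply/funext => h; rewrite /comp linearZ [f (_ - _)]linearB.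
have L : (fun h : R => h^-1 *: (((f \o c) \o shift 0) (h *: (1 : R)) - (f \o c) 0)) @ 0^' -->
    f (lim ((fun h : R => h^-1 *: ((c \o shift 0) (h *: (1 : R)) - c 0)) @ 0^')).
  by rewrite E; apply: continuous_cvg d; exact: linear_mx_continuous.
by split; [apply/cvg_ex; eexists; exact: L | apply: cvg_lim].
Qed.

Lemma bracketC (R : realType) (n : nat) (X Y : 'M[R]_n.+1) : bracket X Y = - bracket Y X.
Proof. by rewrite /bracket opprB. Qed.

Lemma bracketPl (R : realType) (n : nat) (a : R) (X Y Z : 'M[R]_n.+1) :
  bracket (a *: X + Y) Z = a *: bracket X Z + bracket Y Z.
Proof.
by rewrite /bracket mulmxDl mulmxDr -scalemxAl -scalemxAr opprD addrACA -scalerBr.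
Qed.

Lemma bracketPr (R : realType) (n : nat) (a : R) (X Y Z : 'M[R]_n.+1) :
  bracket X (a *: Y + Z) = a *: bracket X Y + bracket X Z.
Proof. by rewrite bracketC bracketPl ![bracket _ X]bracketC scalerN -opprD opprK. Qed.

HB.instance Definition _ (R : realType) (n : nat) (X : 'M[R]_n.+1) :=
  @GRing.isLinear.Build R 'M[R]_n.+1 'M[R]_n.+1 _ (bracket X)
    (fun a Y Z => bracketPr a X Y Z).

Lemma bracketZl (R : realType) (n : nat) (a : R) (X Z : 'M[R]_n.+1) :
  bracket (a *: X) Z = a *: bracket X Z.
Proof. by rewrite bracketC linearZ -scalerN -bracketC. Qed.

Lemma bracketZr (R : realType) (n : nat) (a : R) (X Z : 'M[R]_n.+1) :
  bracket X (a *: Z) = a *: bracket X Z.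
Proof. by rewrite linearZ. Qed.

Lemma AdE (R : realType) (n : nat) (a b X : 'M[R]_n.+1) :
  a \in unitmx -> b \in unitmx -> Ad a (Ad b X) = Ad (a *m b) X.
Proof. move=> ua ub; have -> : Ad (a *m b) X = a *m b *m X *m (invmx b *m invmx a).
  by rewrite /Ad; congr (_ *m _); exact: (@invrM _ a b).
by rewrite /Ad !mulmxA. Qed.

Lemma Ad1 (R : realType) (n : nat) (X : 'M[R]_n.+1) : Ad 1%:M X = X.
Proof. by rewrite /Ad invmx1 mul1mx mulmx1. Qed.

Lemma Ad_bracket (R : realType) (n : nat) (a X Y : 'M[R]_n.+1) :
  a \in unitmx -> Ad a (bracket X Y) = bracket (Ad a X) (Ad a Y).
Proof.
move=> ua; rewrite /bracket /Ad mulmxBr mulmxBl.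
have E (Z W : 'M[R]_n.+1) : a *m Z *m invmx a *m (a *m W *m invmx a) = a *m (Z *m W) *m invmx a.
  by rewrite !mulmxA -[a *m Z *m invmx a *m a]mulmxA mulVmx// mulmx1.
by rewrite !E.
Qed.

Lemma Ad_linear (R : realType) (n : nat) (a : 'M[R]_n.+1) : linear (Ad a).
Proof.
by move=> k X Y; rewrite /Ad mulmxDr mulmxDl -scalemxAr -scalemxAl.
Qed.

HB.instance Definition _ (R : realType) (n : nat) (a : 'M[R]_n.+1) :=
  @GRing.isLinear.Build R 'M[R]_n.+1 'M[R]_n.+1 _ (Ad a) (@Ad_linear R n a).

Lemma Ad_lie_algebra (R : realType) (n : nat) (H : set 'M[R]_n.+1) (a X : 'M[R]_n.+1) :
  matrix_group H -> H a -> lie_algebra_of H X -> lie_algebra_of H (Ad a X).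
Proof.
move=> [H1 HM HV] Ha [c [c0 cH cd]].
exists (Ad a \o c); split.
- by rewrite /= c0 /Ad mulmx1 mulmxV//; case: (HV a Ha).
- by move=> t /=; rewrite /Ad; apply: (HM); [exact: HM | case: (HV a Ha)].
- exact: is_derive_linear_mx.
Qed.

Section Structure.
Variables (R : realType) (n : nat) (S : two_summand_space R n).
Implicit Types (X Y Z W : 'M[R]_n.+1).
Local Notation g := (lieG S).
Local Notation k := (lieK S).

(** Precomposing Q with the projection onto the Lie algebra makes it bilinear on all matrices,
    without membership conditions. *)
Definition ip X Y : R := Q S (projv g X) (projv g Y).

Lemma ipE X Y : X \in g -> Y \in g -> ip X Y = Q S X Y.
Proof. by move=> Xg Yg; rewrite /ip !projv_id. Qed.

Lemma ipC X Y : ip X Y = ip Y X.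
Proof. by have [_ H _] := Q_scalar_product S; rewrite /ip H ?memv_proj. Qed.

Lemma ip_linear Z : scalar (ip^~ Z).
Proof.
move=> a X Y; have [H _ _] := Q_scalar_product S.
by rewrite /ip linearP H ?memv_proj.
Qed.

Lemma ip_linear_r X : scalar (ip X).
Proof. by move=> a Y Z; rewrite !(ipC X) ip_linear. Qed.

HB.instance Definition _ X :=
  @GRing.isLinear.Build R 'M[R]_n.+1 R _ (ip X) (@ip_linear_r X).

Lemma ipDl X Y Z : ip (X + Y) Z = ip X Z + ip Y Z.
Proof. by rewrite !(ipC _ Z) linearD. Qed.

Lemma ipZl (a : R) X Z : ip (a *: X) Z = a * ip X Z.
Proof. by rewrite !(ipC _ Z) linearZ. Qed.

Lemma ipZr (a : R) X Z : ip X (a *: Z) = a * ip X Z.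
Proof. by rewrite linearZ. Qed.

Lemma ipNl X Z : ip (- X) Z = - ip X Z.
Proof. by rewrite !(ipC _ Z) linearN. Qed.

Lemma ip_suml (I : Type) (r : seq I) (F : I -> 'M[R]_n.+1) Z :
  ip (\sum_(i <- r) F i) Z = \sum_(i <- r) ip (F i) Z.
Proof. by rewrite ipC linear_sum; apply: eq_bigr => i _; rewrite ipC. Qed.

Lemma ip_gt0 X : X \in g -> X != 0 -> 0 < ip X X.
Proof. by move=> Xg X0; have [_ _ H] := Q_scalar_product S; rewrite ipE// H. Qed.

Lemma ip_eq0 X : X \in g -> ip X X = 0 -> X = 0.
Proof.
move=> Xg X0; apply/eqP; apply/negPn/negP => /(ip_gt0 Xg).
by rewrite X0 ltxx.
Qed.

Lemma grpG_unit a : grpG S a -> a \in unitmx.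
Proof. by have [_ _ H] := grpG_group S => /H[]. Qed.

Lemma grpG_inv a : grpG S a -> grpG S (invmx a).
Proof. by have [_ _ H] := grpG_group S => /H[]. Qed.

Lemma grpK_inv a : grpK S a -> grpK S (invmx a).
Proof. by have [_ _ H] := grpK_group S => /H[]. Qed.

Lemma AdK a X : grpG S a -> Ad a (Ad (invmx a) X) = X.
Proof.
move=> Ga; have ua := grpG_unit Ga.
by rewrite AdE ?unitmx_inv// mulmxV// Ad1.
Qed.

Lemma Ad_lieG a X : grpG S a -> X \in g -> Ad a X \in g.
Proof.
move=> Ga /lieGP Xg; apply/lieGP.
by apply: Ad_lie_algebra => //; exact: grpG_group.
Qed.

Lemma Ad_lieK a X : grpK S a -> X \in k -> Ad a X \in k.
Proof.
move=> Ga /lieKP Xg; apply/lieKP.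
by apply: Ad_lie_algebra => //; exact: grpK_group.
Qed.

Lemma ip_Ad a X Y : grpG S a -> X \in g -> Y \in g -> ip (Ad a X) (Ad a Y) = ip X Y.
Proof. by move=> Ga Xg Yg; rewrite !ipE ?Ad_lieG// Q_invariant. Qed.

(** [lieG] is known only as a set of velocities: [X, Y] is the derivative of Ad(c(t)) Y, a curve in
    [lieG], for a curve c in the group with velocity X. *)
Lemma bracket_lieG X Y : X \in g -> Y \in g -> bracket X Y \in g.
Proof.
move=> /lieGP[c [c0 cG cd]] Yg.
apply: (bracket_curve_mem (grpG_group S) (@grpG_compact _ _ S) c0 cG cd) => // t.
exact: Ad_lieG.
Qed.

Lemma grpK_compact : compact (grpK S).
Proof.
by apply: subclosed_compact (@grpK_closed _ _ S) (@grpG_compact _ _ S) (@grpK_sub _ _ S).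
Qed.

Lemma bracket_lieK_mem (V : {vspace 'M[R]_n.+1}) X Y :
  Ad_invariant (grpK S) V -> X \in k -> Y \in V -> bracket X Y \in V.
Proof.
move=> VK /lieKP[c [c0 cK cd]] YV.
apply: (bracket_curve_mem (grpK_group S) grpK_compact c0 cK cd) => // t.
exact: VK.
Qed.

Lemma ip_cvg (T : Type) (F : set_system T) (FF : Filter F) (u v : T -> 'M[R]_n.+1) X Y :
  u x @[x --> F] --> X -> v x @[x --> F] --> Y -> ip (u x) (v x) @[x --> F] --> ip X Y.
Proof.
move=> uX vY.
have E Z W : ip Z W = \sum_i \sum_j Z i j * ip (delta_mx i j) W.
  rewrite {1}(matrix_sum_delta Z) ip_suml; apply: eq_bigr => i _.
  by rewrite ip_suml; apply: eq_bigr => j _; rewrite ipZl.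
rewrite E; under eq_cvg do rewrite E.
apply: (@cvg_sum R R) => i; apply: (@cvg_sum R R) => j; apply: cvgM.
  by apply: (continuous_cvg _ (@coord_continuous _ _ _ i j X)).
have fc : continuous (ip (delta_mx i j)) by exact: (@linear_mx_continuous R _ _ R).
exact: (continuous_cvg _ (fc Y)).
Qed.

(** Derivative at 0 of the constant function Q(Ad(c(t)) Y, Ad(c(t)) Z), by the product rule. Most
    later identities rest on this skew-symmetry of ad. *)
Lemma ip_bracket X Y Z : X \in g -> Y \in g -> Z \in g ->
  ip (bracket X Y) Z = - ip Y (bracket X Z).
Proof.
move=> Xg Yg Zg; move/lieGP: (Xg) => [c [c0 cG cd]].
have dY := @Ad_curve_derivative _ _ _ (grpG_group S) (@grpG_compact _ _ S) c X c0 cG cd Y.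
have dZ := @Ad_curve_derivative _ _ _ (grpG_group S) (@grpG_compact _ _ S) c X c0 cG cd Z.
have cZ := @Ad_curve_cvg _ _ _ (grpG_group S) (@grpG_compact _ _ S) c X c0 cG cd Z.
have L : ip (t^-1 *: (Ad (c t) Y - Y)) (Ad (c t) Z) + ip Y (t^-1 *: (Ad (c t) Z - Z)) @[t -->
    0^'] -->
    ip (bracket X Y) Z + ip Y (bracket X Z).
  by apply: cvgD; apply: ip_cvg => //; exact: cvg_cst.
have L0 : ip (t^-1 *: (Ad (c t) Y - Y)) (Ad (c t) Z) + ip Y (t^-1 *: (Ad (c t) Z - Z)) @[t -->
    0^'] --> (0 : R).
  have -> : (fun t => ip (t^-1 *: (Ad (c t) Y - Y)) (Ad (c t) Z) + ip Y (t^-1 *: (Ad (c t) Z -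
      Z))) = fun=> 0.
    apply/funext => t; rewrite linearZ ipZl -mulrDr linearB ipDl ipNl ip_Ad//.
    by rewrite [X in _ * X](_ : _ = 0) ?mulr0//; ring.
  exact: cvg_cst.
by apply/eqP; rewrite -subr_eq0 opprK; apply/eqP/(cvg_unique _ L L0).
Qed.

End Structure.

(** * Orthogonal decomposition of the Lie algebra, and traces *)

Section Projections.
Variables (R : realType) (n : nat) (S : two_summand_space R n).
Implicit Types (X Y Z W : 'M[R]_n.+1) (i j : bool).
Local Notation g := (lieG S).
Local Notation k := (lieK S).
Local Notation ip := (ip S).

(* The two summands are indexed by booleans: [false] is p1 and [true] is p2. *)
Definition pj i : {vspace 'M[R]_n.+1} := if i then p2 S else p1 S.
Definition ej i : seq 'M[R]_n.+1 := if i then e2 S else e1 S.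
Definition pr i : 'End('M[R]_n.+1) := daddv_pi (pj i) (k + pj (~~ i)).
Definition prk : 'End('M[R]_n.+1) := daddv_pi k (pp S).

Lemma lieK_sub X : X \in k -> X \in g.
Proof. by apply/subvP; rewrite lieG_sum addvSl. Qed.

Lemma pp_sub X : X \in pp S -> X \in g.
Proof. by apply/subvP; rewrite lieG_sum addvSr. Qed.

Lemma pj_pp i X : X \in pj i -> X \in pp S.
Proof. by apply/subvP; case: i; [exact: addvSr | exact: addvSl]. Qed.

Lemma pj_sub i X : X \in pj i -> X \in g.
Proof. by move=> /pj_pp; exact: pp_sub. Qed.

Lemma ip_k_pp X Y : X \in k -> Y \in pp S -> ip X Y = 0.
Proof. by move=> Xk Yp; rewrite ipE ?(lieK_sub Xk) ?(pp_sub Yp)// Q_lieK_p. Qed.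

Lemma ip_pj i X Y : X \in pj i -> Y \in pj (~~ i) -> ip X Y = 0.
Proof.
move=> Xi Yi; rewrite ipE ?(pj_sub Xi) ?(pj_sub Yi)//; case: i Xi Yi => /= Xi Yi.
  have [_ C _] := Q_scalar_product S.
  by rewrite C ?(pj_sub (i := true) Xi) ?(pj_sub (i := false) Yi)// Q_p1_p2.
exact: Q_p1_p2.
Qed.

Lemma capv_orthogonal (U V : {vspace 'M[R]_n.+1}) :
  (U <= g)%VS -> (forall X Y, X \in U -> Y \in V -> ip X Y = 0) -> (U :&: V = 0)%VS.
Proof.
move=> Ug H; apply/eqP; rewrite -subv0; apply/subvP => X.
rewrite memv_cap => /andP[XU XV]; rewrite memv0; apply/eqP/(@ip_eq0 _ _ S).
  exact: (subvP Ug).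
exact: H.
Qed.

Lemma cap_pj i : (pj i :&: (k + pj (~~ i)) = 0)%VS.
Proof.
apply: capv_orthogonal; first by apply/subvP => X; exact: pj_sub.
move=> X _ Xi /memv_addP[u uk [v vi ->]].
by rewrite linearD /= (ip_pj Xi vi) ipC (ip_k_pp uk (pj_pp Xi)) addr0.
Qed.

Lemma cap_k : (k :&: pp S = 0)%VS.
Proof.
apply: capv_orthogonal; first by apply/subvP => X; exact: lieK_sub.
exact: ip_k_pp.
Qed.

Lemma daddv_pi_0 (U V : {vspace 'M[R]_n.+1}) X :
  (U :&: V = 0)%VS -> X \in V -> daddv_pi U V X = 0.
Proof.
move=> UV XV; have XUV : X \in (U + V)%VS by rewrite (subvP (addvSr _ _)).
have := daddv_pi_add UV XUV.
rewrite (@daddv_pi_id _ _ V U X) 1?capvC// => /eqP.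
by rewrite -subr_eq0 addrK => /eqP.
Qed.

Lemma pr_mem i X : pr i X \in pj i. Proof. exact: memv_pi. Qed.
Lemma prk_mem X : prk X \in k. Proof. exact: memv_pi. Qed.

Lemma pr_id i X : X \in pj i -> pr i X = X.
Proof. by move=> Xi; rewrite /pr daddv_pi_id// cap_pj. Qed.

Lemma pr_k i X : X \in k -> pr i X = 0.
Proof.
by move=> Xk; rewrite /pr daddv_pi_0 ?cap_pj// (subvP (addvSl _ _)).
Qed.

Lemma pr_neq i X : X \in pj (~~ i) -> pr i X = 0.
Proof.
by move=> Xk; rewrite /pr daddv_pi_0 ?cap_pj// (subvP (addvSr _ _)).
Qed.

Lemma lieG_decomp X : X \in g ->
  exists u v w, [/\ X = u + (v + w), u \in k, v \in pj false & w \in pj true].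
Proof.
rewrite lieG_sum => /memv_addP[u uk [_ /memv_addP[v v1 [w w1 ->]] ->]].
by exists u, v, w.
Qed.

Lemma pr_decomp u v w : u \in k -> v \in pj false -> w \in pj true ->
  [/\ prk (u + (v + w)) = u, pr false (u + (v + w)) = v, pr true (u + (v + w)) = w &
      proj_p S (u + (v + w)) = v + w].
Proof.
move=> uk v1 w1.
have vwp : v + w \in pp S by rewrite memvD// ?(pj_pp v1) ?(pj_pp w1).
rewrite /proj_p !linearD /=; split.
- by rewrite -linearD /= /prk daddv_pi_id ?cap_k// (daddv_pi_0 cap_k vwp) addr0.
- by rewrite pr_k// pr_id// (@pr_neq false w)// add0r addr0.
- by rewrite pr_k// (@pr_neq true v)// (pr_id w1) !add0r.
- by rewrite -linearD /= daddv_pi_0 1?capvC ?cap_k// daddv_pi_id 1?capvC ?cap_k// add0r.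
Qed.

Lemma pr_sum X : X \in g -> X = prk X + (pr false X + pr true X).
Proof.
move=> /lieG_decomp[u [v [w [-> uk v1 w1]]]].
by have [-> -> -> _] := pr_decomp uk v1 w1.
Qed.

Lemma proj_pE X : X \in g -> proj_p S X = pr false X + pr true X.
Proof.
move=> /lieG_decomp[u [v [w [-> uk v1 w1]]]].
by have [_ -> -> ->] := pr_decomp uk v1 w1.
Qed.

Lemma proj_p_pp X : proj_p S X \in pp S. Proof. exact: memv_pi. Qed.

Lemma ip_pr i X Y : X \in g -> Y \in pj i -> ip (pr i X) Y = ip X Y.
Proof.
move=> Xg Yi; rewrite {2}(pr_sum Xg) !ipDl (ip_k_pp (prk_mem X) (pj_pp Yi)) add0r.
have N j : j != i -> ip (pr j X) Y = 0.
  move=> ji; apply: (@ip_pj j) (pr_mem j X) _.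
  by have -> : ~~ j = i by case: j i ji {Yi} => [] [].
by case: i Yi N => _ N; [rewrite (N false)// add0r | rewrite (N true)// addr0].
Qed.

Lemma ip_prk X Y : X \in g -> Y \in k -> ip (prk X) Y = ip X Y.
Proof.
move=> Xg Yk; rewrite {2}(pr_sum Xg) !ipDl.
have N j : ip (pr j X) Y = 0 by rewrite ipC (ip_k_pp Yk (pj_pp (pr_mem j X))).
by rewrite (N false) (N true) addr0 addr0.
Qed.

Lemma pj_invariant i : Ad_invariant (grpK S) (pj i).
Proof. by case: i; [have [] := p2_irreducible S | have [] := p1_irreducible S]. Qed.

Lemma Ad_pr i a X : grpK S a -> X \in g -> pr i (Ad a X) = Ad a (pr i X).
Proof.
move=> Ka /lieG_decomp[u [v [w [-> uk v1 w1]]]].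
have [_ E1 E2 _] := pr_decomp uk v1 w1.
have [_ F1 F2 _] := pr_decomp (Ad_lieK Ka uk) (pj_invariant Ka v1) (pj_invariant Ka w1).
have EA : Ad a (u + (v + w)) = Ad a u + (Ad a v + Ad a w) by rewrite 2!linearD.
by case: i; rewrite EA; [rewrite F2 E2 | rewrite F1 E1].
Qed.

Lemma Ad_prk a X : grpK S a -> X \in g -> prk (Ad a X) = Ad a (prk X).
Proof.
move=> Ka /lieG_decomp[u [v [w [-> uk v1 w1]]]].
have [E1 _ _ _] := pr_decomp uk v1 w1.
have [F1 _ _ _] := pr_decomp (Ad_lieK Ka uk) (pj_invariant Ka v1) (pj_invariant Ka w1).
have EA : Ad a (u + (v + w)) = Ad a u + (Ad a v + Ad a w) by rewrite 2!linearD.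
by rewrite EA F1 E1.
Qed.

Lemma bracket_k_pj i X Y : X \in k -> Y \in pj i -> bracket X Y \in pj i.
Proof. by apply: bracket_lieK_mem; exact: pj_invariant. Qed.

Lemma ej_basis i : orthonormal_basis (pj i) (Q S) (ej i).
Proof. by case: i; [exact: e2_basis | exact: e1_basis]. Qed.

Lemma ej_mem i X : X \in ej i -> X \in pj i.
Proof.
by have [/andP[/eqP sp _] _] := ej_basis i; rewrite -[pj i]sp; exact: memv_span.
Qed.

Lemma ej_size i : size (ej i) = \dim (pj i).
Proof.
by have [/andP[/eqP sp fr] _] := ej_basis i; rewrite -[pj i]sp; apply/esym/eqP.
Qed.

Lemma ip_ej i (a b : nat) : (a < size (ej i))%N -> (b < size (ej i))%N ->
  ip (ej i)`_a (ej i)`_b = (a == b)%:R.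
Proof.
move=> ai bi; case: (ej_basis i) => _ H.
by rewrite ipE ?H// (@pj_sub i)// ej_mem// mem_nth.
Qed.

Lemma ej_norm i X : X \in ej i -> ip X X = 1.
Proof. by move=> /(nthP 0)[a ai <-]; rewrite ip_ej// eqxx. Qed.

Lemma ej_expand i X : X \in pj i -> X = \sum_(a <- ej i) ip X a *: a.
Proof.
move=> Xi; have [/andP[/eqP sp _] _] := ej_basis i.
have Xs : X \in <<in_tuple (ej i)>>%VS by rewrite /= sp.
rewrite {1}(coord_span Xs) (big_nth 0) big_mkord; apply: eq_bigr => a _.
congr (_ *: _); rewrite {2}(coord_span Xs) ip_suml (bigD1 a)//= ipZl.
rewrite ip_ej// eqxx mulr1 big1 ?addr0// => c ca.
by rewrite ipZl ip_ej// val_eqE (negPf ca) mulr0.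
Qed.

(** The bases [ej i] and Ad(h) applied to [ej i] are both orthonormal in p_i and give the same
    trace. This makes forms defined by sums over [ej i] invariant under Ad(K). *)
Lemma ej_trace_Ad i (F : {linear 'M[R]_n.+1 -> 'M[R]_n.+1}) h : grpK S h ->
  \sum_(a <- ej i) ip (F (Ad h a)) (Ad h a) = \sum_(a <- ej i) ip (F a) a.
Proof.
move=> Kh; have Gh := grpK_sub Kh; have Gh' := grpG_inv Gh.
transitivity (\sum_(a <- ej i) \sum_(b <- ej i) ip (Ad h a) b * ip (F b) (Ad h a)).
  apply: eq_big_seq => a /ej_mem ai.
  rewrite {1}(ej_expand (pj_invariant Kh ai)) linear_sum ip_suml.
  by apply: eq_bigr => b _; rewrite linearZ ipZl.
rewrite exchange_big; apply: eq_big_seq => b /ej_mem bi.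
have E : b = \sum_(a <- ej i) ip (Ad h a) b *: Ad h a.
  rewrite -{1}(AdK b Gh) {1}(ej_expand (pj_invariant (grpK_inv Kh) bi)) linear_sum.
  rewrite [LHS]big_seq [RHS]big_seq; apply: eq_bigr => a /ej_mem ai.
  rewrite linearZ; congr (_ *: _).
  by rewrite -(ip_Ad Gh) ?(pj_sub ai) ?(Ad_lieG Gh') ?(pj_sub bi)// (AdK _ Gh) ipC.
rewrite [X in _ = ip _ X]E linear_sum; apply: eq_bigr => a _.
by rewrite linearZ.
Qed.

(** Cyclicity: the trace of AB over V is that of BA over W, computed in the family e. It replaces
    the arbitrary basis in [trace_on] by a Q-orthonormal one and moves the trace in the Killing form
    from [lieG] to p. *)
Lemma trace_comp (V W : {vspace 'M[R]_n.+1}) (e : seq 'M[R]_n.+1)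
    (A B : {linear 'M[R]_n.+1 -> 'M[R]_n.+1}) :
  (forall X, X \in W -> X = \sum_(a <- e) ip X a *: a) ->
  (forall X, X \in V -> B X \in W) -> (forall a, a \in e -> A a \in V) ->
  trace_on V (fun Z => A (B Z)) = \sum_(a <- e) ip (B (A a)) a.
Proof.
move=> exp BW AV; rewrite /trace_on.
transitivity (\sum_(i < \dim V) \sum_(a <- e)
    coord (vbasis V) i (A a) * ip (B (vbasis V)`_i) a).
  apply: eq_bigr => i _; have vi : (vbasis V)`_i \in V.
    by rewrite vbasis_mem// mem_nth// size_tuple.
  rewrite {1}(exp _ (BW _ vi)) !linear_sum; apply: eq_bigr => a _.
  by rewrite !linearZ /= mulrC.
rewrite exchange_big; apply: eq_big_seq => a ae.
rewrite {2}(coord_vbasis (AV a ae)) linear_sum ip_suml.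
by apply: eq_bigr => i _; rewrite linearZ ipZl.
Qed.

Lemma pp_expand X : X \in pp S ->
  X = \sum_(a <- ej false ++ ej true) ip X a *: a.
Proof.
move=> /memv_addP[v v1 [w w1 ->]]; rewrite big_cat /=.
have v0 := ej_expand (i := false) v1; have w0 := ej_expand (i := true) w1.
rewrite {1}v0 {1}w0; congr (_ + _); apply: eq_big_seq => a /ej_mem ai.
  by rewrite ipDl (ipC _ w) (@ip_pj false a w)// addr0.
by rewrite ipDl (@ip_pj false v a)// add0r.
Qed.

End Projections.

(** * Schur's lemma *)

Lemma nonneg_quadratic_linear0 (R : realType) (b f : R) :
  0 <= f -> (forall t, 0 <= 2 * t * b + t ^+ 2 * f) -> b = 0.
Proof.
(* Minimising over t would suggest -b/f; the denominator f + 1 also covers f = 0. *)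
move=> f0 H; have := H (- (b / (f + 1))).
have f1 : 0 < f + 1 by rewrite ltr_wpDl.
have -> : 2 * - (b / (f + 1)) * b + (- (b / (f + 1))) ^+ 2 * f =
    - (b ^+ 2 * ((f + 2) / (f + 1) ^+ 2)).
  by field; rewrite lt0r_neq0.
rewrite oppr_ge0 pmulr_lle0 ?divr_gt0 ?exprn_gt0 ?ltr_wpDl// => b2.
by apply/eqP; rewrite -sqrf_eq0 eq_le b2 sqr_ge0.
Qed.

(** Variational proof: a maximum point of the quadratic form on the unit sphere is an eigenvector,
    and the maximum its eigenvalue. *)
Lemma symmetric_eigenvector (R : realType) (d : nat) (M : 'M[R]_d.+1) :
  M^T = M -> exists (mu : R) (v : 'rV[R]_d.+1), v != 0 /\ v *m M = mu *: v.
Proof.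
move=> MT.
pose B (N : 'M[R]_d.+1) (v w : 'rV[R]_d.+1) : R := (v *m N *m w^T) 0 0.
have Bc N : continuous (fun v => B N v v).
  move=> v; have trc : continuous (@trmx R 1 d.+1) by exact: (@linear_mx_continuous R 1 d.+1 _
      trmx).
  have L : w *m N *m w^T @[w --> v] --> v *m N *m v^T.
    by apply: cvg_mulmx (trc v); apply: cvg_mulmx; [exact: cvg_id | exact: cvg_cst].
  exact: (continuous_cvg _ (@coord_continuous _ _ _ 0 0 _) L).
have BDl N u v w a : B N (u + a *: v) w = B N u w + a * B N v w.
  by rewrite /B !mulmxDl -!scalemxAl !mxE.
have BDr N u v w a : B N w (u + a *: v) = B N w u + a * B N w v.
  by rewrite /B linearD linearZ /= mulmxDr -scalemxAr !mxE.
have BC N u v : N^T = N -> B N u v = B N v u.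
  move=> NT; rewrite /B; have -> : u *m N *m v^T = (v *m N *m u^T)^T.
    by rewrite !trmx_mul trmxK NT mulmxA.
  by rewrite mxE.
have B1 v : B 1%:M v v = \sum_i v 0 i ^+ 2.
  by rewrite /B mulmx1 mxE; apply: eq_bigr => i _; rewrite mxE expr2.
have B1_ge0 v : 0 <= B 1%:M v v by rewrite B1 sumr_ge0// => i _; exact: sqr_ge0.
have B1_gt0 v : v != 0 -> 0 < B 1%:M v v.
  move=> v0; rewrite lt_neqAle B1_ge0 andbT eq_sym; apply: contra_neq v0 => /eqP.
  rewrite B1 psumr_eq0 => [/allP H|i _]; last exact: sqr_ge0.
  apply/rowP => i; rewrite mxE; apply/eqP; rewrite -sqrf_eq0; exact: H (mem_index_enum i).
pose A := [set v : 'rV[R]_d.+1 | B 1%:M v v = 1].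
have A0 : A !=set0.
  exists (delta_mx 0 0); rewrite /A /= B1 (bigD1 0)//= big1 => [|i i0].
    by rewrite mxE !eqxx expr1n addr0.
  by rewrite mxE (negPf i0) expr0n.
have Acl : closed A.
  have -> : A = (fun v => B 1%:M v v) @^-1` [set 1] by [].
  by apply: (closed_comp (fun v _ => Bc 1%:M v)); exact: closed_eq.
have Abd : bounded_set A.
  exists 1; split => // x x1 v Av; apply/(le_trans _ (ltW x1)).
  rewrite /Num.norm /= mx_normrE; apply: bigmax_le => // -[i j] _ /=.
  rewrite ord1 -(@expr_le1 _ 2)// -normrX ger0_norm ?sqr_ge0//.
  have <- : B 1%:M v v = 1 by exact: Av.
  by rewrite B1 (bigD1 j)//= lerDl sumr_ge0// => k _; exact: sqr_ge0.
have Ak : compact A by exact: bounded_closed_compact.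
have [v0 Av0 vmax] := EVT_max_rV A0 Ak (continuous_subspaceT (Bc M)).
move/set_mem : Av0 => /= Av0; set mu := B M v0 v0 in vmax.
(* By homogeneity, maximality on the sphere becomes nonnegativity of mu |v|^2 - v M v^T for all v,
   with equality at v0. *)
have F0 v : 0 <= mu * B 1%:M v v - B M v v.
  have [->|vn0] := eqVneq v 0; first by rewrite /B !mul0mx !mxE mulr0 subrr.
  have Nv := B1_gt0 v vn0; set N := B 1%:M v v in Nv *.
  have sN : Num.sqrt N != 0 by rewrite sqrtr_eq0 -ltNge.
  have Z K : B K (0 + (Num.sqrt N)^-1 *: v) (0 + (Num.sqrt N)^-1 *: v) = B K v v / N.
    have B0l w : B K 0 w = 0 by rewrite /B !mul0mx mxE.
    have B0r w : B K w 0 = 0 by rewrite /B trmx0 mulmx0 mxE.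
    rewrite BDl B0l BDr B0r !add0r mulrA -invfM -expr2 sqr_sqrtr ?(ltW Nv)//.
    by rewrite mulrC.
  have := vmax ((0 + (Num.sqrt N)^-1 *: v)).
  rewrite inE /A /= !Z divff ?lt0r_neq0// => /(_ erefl).
  by rewrite ler_pdivrMr// subr_ge0.
exists mu, v0; split.
  by apply/negP => /eqP v00; move: Av0; rewrite /A /= v00 B1 big1 => [/esym/eqP|i _]; rewrite
      ?oner_eq0// mxE expr0n.
(* Along v0 + t w this nonnegative quadratic polynomial in t vanishes at t = 0, so its linear term
   vanishes. *)
have crit w : mu * B 1%:M v0 w - B M v0 w = 0.
  apply: (nonneg_quadratic_linear0 (F0 w)) => t.
  have := F0 (v0 + t *: w); rewrite !BDl !BDr.
  rewrite (BC 1%:M w v0) ?trmx1// (BC M w v0)// Av0 -/mu => H.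
  by apply: le_trans H _; rewrite le_eqVlt; apply/orP; left; apply/eqP; ring.
apply/rowP => j.
have := crit (delta_mx 0 j).
have E (w : 'rV[R]_d.+1) : (w *m (delta_mx 0 j)^T) 0 0 = w 0 j.
  rewrite mxE (bigD1 j)//= big1 => [|i ij]; first by rewrite !mxE !eqxx mulr1 addr0.
  by rewrite !mxE (negPf ij) andbF mulr0.
rewrite /B !E mulmx1 => /eqP; rewrite subr_eq0 => /eqP <-.
by rewrite mxE.
Qed.

Section Schur.
Variables (R : realType) (n : nat) (S : two_summand_space R n).
Implicit Types (X Y Z W : 'M[R]_n.+1) (i j : bool).
Local Notation ip := (ip S).
Local Notation pj := (pj S).
Local Notation ej := (ej S).

Lemma pj_irreducible i : Ad_irreducible (grpK S) (pj i).
Proof. by case: i; [exact: p2_irreducible | exact: p1_irreducible]. Qed.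

Lemma ip_pj_inj i X Y : X \in pj i -> Y \in pj i ->
  (forall Z, Z \in pj i -> ip X Z = ip Y Z) -> X = Y.
Proof.
move=> Xi Yi H; apply/eqP; rewrite -subr_eq0; apply/eqP.
apply: (@ip_eq0 _ _ S); first by rewrite (@pj_sub _ _ _ i)// memvB.
by rewrite {1}[_ - _]/(X - Y) ipDl ipNl H ?memvB// subrr.
Qed.

Variable s : 'M[R]_n.+1 -> 'M[R]_n.+1 -> R.
Hypotheses (s_linear_l : forall Y, scalar (s^~ Y)) (s_linear_r : forall X, scalar (s X)).
Hypothesis s_invariant : forall a X Y, grpK S a -> X \in pp S -> Y \in pp S ->
  s (Ad a X) (Ad a Y) = s X Y.

HB.instance Definition _ X :=
  @GRing.isLinear.Build R 'M[R]_n.+1 R _ (s X) (s_linear_r X).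

(** The vector of p_j that represents the functional s(X, .) on p_j; invariance of s makes the map
    commute with Ad(K). *)
Definition form_map j X : 'M[R]_n.+1 := \sum_(c <- ej j) s X c *: c.

Lemma form_map_linear j : linear (form_map j).
Proof.
move=> a X Y; rewrite /form_map scaler_sumr -big_split; apply: eq_bigr => c _ /=.
by rewrite s_linear_l scalerDl scalerA.
Qed.

HB.instance Definition _ j :=
  @GRing.isLinear.Build R 'M[R]_n.+1 'M[R]_n.+1 _ (form_map j) (@form_map_linear j).

Lemma form_map_mem j X : form_map j X \in pj j.
Proof. by rewrite /form_map big_seq memv_suml// => c /ej_mem ci; rewrite memvZ. Qed.

Lemma form_mapP j X Y : Y \in pj j -> ip (form_map j X) Y = s X Y.
Proof.
move=> Yj; rewrite [in RHS](ej_expand Yj) linear_sum ip_suml.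
by apply: eq_bigr => c _; rewrite ipZl linearZ /= mulrC ipC.
Qed.

Lemma form_map_Ad j a X : grpK S a -> X \in pp S ->
  form_map j (Ad a X) = Ad a (form_map j X).
Proof.
move=> Ka Xp; have Ga := grpK_sub Ka.
have Fj Y := form_map_mem j Y.
apply: (ip_pj_inj (Fj _) (pj_invariant Ka (Fj X))) => Z Zj.
have Z'j : Ad (invmx a) Z \in pj j by exact: pj_invariant (grpK_inv Ka) Zj.
rewrite form_mapP// -[in LHS](AdK Z Ga) s_invariant ?(pj_pp Z'j)//.
by rewrite -(form_mapP X Z'j) -(ip_Ad Ga) ?(pj_sub (Fj X)) ?(pj_sub Z'j)// (AdK _ Ga).
Qed.

(** The map from p1 to p2 representing s is equivariant. If it were nonzero, irreducibility would
    make it injective on p1 with image p2, an equivalence of the two summands. *)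
Lemma schur_cross X Y : X \in pj false -> Y \in pj true -> s X Y = 0.
Proof.
move=> X0 Y1; pose f : 'End('M[R]_n.+1) := linfun (form_map true).
have fE Z : f Z = form_map true Z by rewrite lfunE.
suff fX : f X = 0 by rewrite -(form_mapP X Y1) -fE fX (ipC S 0) linear0.
have [_ _ irr1] := pj_irreducible false; have [_ _ irr2] := pj_irreducible true.
have fAd a Z : grpK S a -> Z \in pj false -> f (Ad a Z) = Ad a (f Z).
  by move=> Ka Z0; rewrite !fE form_map_Ad// (pj_pp Z0).
have kerI : Ad_invariant (grpK S) (pj false :&: lker f)%VS.
  move=> a Z Ka; rewrite !memv_cap !memv_ker => /andP[Z0 /eqP fZ].
  by rewrite pj_invariant// fAd// fZ linear0 eqxx.
have [ker0|kerT] := irr1 _ (capvSl _ _) kerI; last first.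
  by move: X0; rewrite -kerT memv_cap memv_ker => /andP[_ /eqP].
have imI : Ad_invariant (grpK S) (f @: pj false)%VS.
  move=> a Z Ka /memv_imgP[W W0 ->]; rewrite -fAd//.
  by rewrite memv_img// pj_invariant.
have imS : (f @: pj false <= pj true)%VS.
  by apply/subvP => Z /memv_imgP[W W0 ->]; rewrite fE form_map_mem.
have [im0|imT] := irr2 _ imS imI.
  by apply/eqP; rewrite -memv0 -im0 memv_img.
case: (@p1_p2_inequivalent _ _ S); by exists f; split.
Qed.

(** Over the reals an equivariant endomorphism of an irreducible space need not be a scalar.
    Symmetry of s provides a real eigenvector, and its eigenspace is invariant, hence all of p_i.
    The trace identifies the scalar. *)
Lemma schur_scalar i : (forall X Y, s X Y = s Y X) ->
  forall X Y, X \in pj i -> Y \in pj i ->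
  (\dim (pj i))%:R * s X Y = (\sum_(a <- ej i) s a a) * ip X Y.
Proof.
move=> sC.
have [inv nz irr] := pj_irreducible i.
suff [mu Hmu] : exists mu, forall X, X \in pj i -> form_map i X = mu *: X.
  have E X Y : X \in pj i -> Y \in pj i -> s X Y = mu * ip X Y.
    by move=> Xi Yi; rewrite -(form_mapP X Yi) Hmu// ipZl.
  move=> X Y Xi Yi; rewrite E// mulrA; congr (_ * _).
  rewrite big_seq (eq_bigr (fun=> mu)) => [|a ai].
    by rewrite -big_seq big_const_seq count_predT iter_addr_0 ej_size mulr_natl.
  by rewrite E ?(ej_norm ai) ?mulr1// (ej_mem ai).
have size0 : (0 < size (ej i))%N by rewrite ej_size lt0n dimv_eq0.
pose d := (size (ej i)).-1.
have dE : d.+1 = size (ej i) by rewrite /d prednK.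
have ei (a : 'I_d.+1) : (ej i)`_a \in pj i by rewrite (@ej_mem _ _ S i)// mem_nth// -dE.
pose M : 'M[R]_d.+1 := \matrix_(a, b) s (ej i)`_a (ej i)`_b.
have MT : M^T = M by apply/matrixP => a b; rewrite !mxE sC.
have [mu [v [v0 vM]]] := symmetric_eigenvector MT.
pose X0 := \sum_(a < d.+1) v 0 a *: (ej i)`_a.
have X0i : X0 \in pj i by apply: memv_suml => a _; rewrite memvZ.
have ipX0 (b : 'I_d.+1) : ip X0 (ej i)`_b = v 0 b.
  rewrite ip_suml (bigD1 b)//= ipZl ip_ej -?dE// eqxx mulr1 big1 ?addr0// => a ab.
  by rewrite ipZl ip_ej -?dE// val_eqE (negPf ab) mulr0.
have X0n0 : X0 != 0.
  apply: contra_neq v0 => X00; apply/rowP => b.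
  by rewrite mxE -ipX0 X00 ipC linear0.
have sX0 (b : 'I_d.+1) : s X0 (ej i)`_b = mu * v 0 b.
  have <- : (v *m M) 0 b = mu * v 0 b by rewrite vM mxE.
  rewrite mxE sC linear_sum; apply: eq_bigr => a _.
  by rewrite linearZ mxE /= sC.
have FX0 : form_map i X0 = mu *: X0.
  rewrite /form_map (big_nth 0) -dE big_mkord scaler_sumr; apply: eq_bigr => b _.
  by rewrite sX0 scalerA.
exists mu.
pose f : 'End('M[R]_n.+1) := (linfun (form_map i) - mu *: \1)%VF.
have fE Z : f Z = form_map i Z - mu *: Z.
  by rewrite /f add_lfunE opp_lfunE scale_lfunE id_lfunE lfunE.
have kerI : Ad_invariant (grpK S) (pj i :&: lker f)%VS.
  move=> a Z Ka; rewrite !memv_cap !memv_ker !fE !subr_eq0 => /andP[Zi /eqP fZ].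
  by rewrite pj_invariant// form_map_Ad ?(pj_pp Zi)// fZ linearZ eqxx.
have [ker0|kerT] := irr _ (capvSl _ _) kerI.
  have : X0 \in (pj i :&: lker f)%VS by rewrite memv_cap X0i memv_ker fE FX0 subrr eqxx.
  by rewrite ker0 memv0 (negPf X0n0).
move=> X; rewrite -{1}kerT memv_cap memv_ker fE subr_eq0 => /andP[_ /eqP].
by [].
Qed.

End Schur.

(** * The Levi-Civita connection and the Ricci form *)

Section LeviCivita.
Variables (R : realType) (n : nat) (S : two_summand_space R n).
Implicit Types (X Y Z W : 'M[R]_n.+1) (i j k l : bool) (x : R * R).
Local Notation g := (lieG S).
Local Notation ip := (ip S).
Local Notation pj := (pj S).
Local Notation ej := (ej S).
Local Notation pr := (pr S).
Local Notation prk := (prk S).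

Definition wt x i : R := if i then x.2 else x.1.

Lemma wt_gt0 x i : 0 < x.1 -> 0 < x.2 -> 0 < wt x i.
Proof. by case: i. Qed.

Lemma metricE x X Y : metric S x X Y = \sum_i wt x i * ip (pr i X) (pr i Y).
Proof.
rewrite big_bool /= addrC /metric.
have E i Z : pr i Z \in g by exact: pj_sub (pr_mem S i Z).
by rewrite -!ipE ?(E false) ?(E true).
Qed.

Lemma bracket_pE X Y : X \in g -> Y \in g ->
  bracket_p S X Y = pr false (bracket X Y) + pr true (bracket X Y).
Proof. by move=> Xg Yg; rewrite /bracket_p proj_pE// bracket_lieG. Qed.

Lemma pr_expand i X : X \in g -> pr i X = \sum_(a <- ej i) ip X a *: a.
Proof.
move=> Xg; rewrite {1}(ej_expand (pr_mem S i X)); apply: eq_big_seq => a ai.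
by rewrite ip_pr// (ej_mem ai).
Qed.

Lemma pr_pr i j X : pr i (pr j X) = if i == j then pr i X else 0.
Proof.
case: eqP => [<-|/eqP ij]; first by rewrite pr_id// pr_mem.
have E : ~~ i = j by case: i j ij => [] [].
by apply: pr_neq; rewrite E pr_mem.
Qed.

Lemma ip_bracket_cycle X Y Z : X \in g -> Y \in g -> Z \in g ->
  ip (bracket Z X) Y = ip (bracket X Y) Z.
Proof. by move=> Xg Yg Zg; rewrite bracketC ipNl ip_bracket// opprK ipC. Qed.

(** The operator on p that represents the metric with respect to [ip]. *)
Definition rescale x X : 'M[R]_n.+1 := \sum_i wt x i *: pr i X.

Lemma rescale_linear x : linear (rescale x).
Proof.
move=> a X Y; rewrite /rescale scaler_sumr -big_split; apply: eq_bigr => i _ /=.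
by rewrite linearP scalerDr scalerA [_ * a]mulrC -scalerA.
Qed.

HB.instance Definition _ x :=
  @GRing.isLinear.Build R 'M[R]_n.+1 'M[R]_n.+1 _ (rescale x) (rescale_linear x).

Lemma rescale_pj x i X : X \in pj i -> rescale x X = wt x i *: X.
Proof.
move=> Xi; rewrite /rescale (bigD1 i)//= (pr_id Xi) big1 ?addr0// => j ji.
have E : ~~ j = i by case: i j ji {Xi} => [] [].
by rewrite (@pr_neq _ _ _ j) ?scaler0// E.
Qed.

Lemma rescale_pp x X : rescale x X \in pp S.
Proof. by apply: memv_suml => i _; rewrite memvZ// (pj_pp (pr_mem S i X)). Qed.

(* Closed form of the Levi-Civita Nomizu map: for X in p_i and Y in p_j its
   component in p_k is (w_k + w_j - w_i) / (2 w_k) times that of [X, Y]. *)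
Definition lc x X Y : 'M[R]_n.+1 :=
  \sum_k (2 * wt x k)^-1 *:
    pr k (wt x k *: bracket X Y + bracket X (rescale x Y) - bracket (rescale x X) Y).

Lemma lc_linear_r x X : linear (lc x X).
Proof.
move=> a Y Z; rewrite /lc scaler_sumr -big_split; apply: eq_bigr => k _ /=.
set c := (2 * _)^-1; set w := wt x k.
have -> : w *: bracket X (a *: Y + Z) + bracket X (rescale x (a *: Y + Z))
      - bracket (rescale x X) (a *: Y + Z) =
    a *: (w *: bracket X Y + bracket X (rescale x Y) - bracket (rescale x X) Y)
      + (w *: bracket X Z + bracket X (rescale x Z) - bracket (rescale x X) Z).
  rewrite (linearP (rescale x)) !(linearP (bracket X)) (linearP (bracket (rescale x X))) /=.
  move: (bracket X Y) (bracket X Z) (bracket X (rescale x Y)) (bracket X (rescale x Z))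
    (bracket (rescale x X) Y) (bracket (rescale x X) Z) => A B C D E F.
  rewrite opprD !scalerDr scalerN !scalerA [w * a]mulrC.
  by rewrite [X in X + _ = _]addrACA [LHS]addrACA.
by rewrite linearP scalerDr !scalerA [c * a]mulrC.
Qed.

Lemma lc_linear_l x Y : linear (lc x ^~ Y).
Proof.
move=> a X Z; rewrite /lc scaler_sumr -big_split; apply: eq_bigr => k _ /=.
set c := (2 * _)^-1; set w := wt x k.
have -> : w *: bracket (a *: X + Z) Y + bracket (a *: X + Z) (rescale x Y)
      - bracket (rescale x (a *: X + Z)) Y =
    a *: (w *: bracket X Y + bracket X (rescale x Y) - bracket (rescale x X) Y)
      + (w *: bracket Z Y + bracket Z (rescale x Y) - bracket (rescale x Z) Y).
  rewrite (linearP (rescale x)) /= !bracketPl.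
  move: (bracket X Y) (bracket Z Y) (bracket X (rescale x Y)) (bracket Z (rescale x Y))
    (bracket (rescale x X) Y) (bracket (rescale x Z) Y) => A B C D E F.
  rewrite opprD !scalerDr scalerN !scalerA [w * a]mulrC.
  by rewrite [X in X + _ = _]addrACA [LHS]addrACA.
by rewrite linearP scalerDr !scalerA [c * a]mulrC.
Qed.

HB.instance Definition _ x X :=
  @GRing.isLinear.Build R 'M[R]_n.+1 'M[R]_n.+1 _ (lc x X) (@lc_linear_r x X).

Lemma lc_pp x X Y : lc x X Y \in pp S.
Proof. by apply: memv_suml => k _; rewrite memvZ// (pj_pp (pr_mem S k _)). Qed.

Lemma proj_p_pr i X : X \in g -> pr i (proj_p S X) = pr i X.
Proof.
move=> Xg; rewrite proj_pE// linearD /= !pr_pr.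
by case: i; rewrite /= ?add0r ?addr0.
Qed.

(** Isolates Z, so that the sum over an orthonormal basis in [nomizu_U] becomes the expansion of an
    orthogonal projection. *)
Lemma metric_bracket x X Y Z : X \in g -> Z \in g -> Y \in pp S ->
  metric S x (bracket_p S Z X) Y = ip (bracket X (rescale x Y)) Z.
Proof.
move=> Xg Zg Yp; rewrite metricE /rescale linear_sum ip_suml; apply: eq_bigr => i _.
have Yi := pr_mem S i Y; have Yig := pj_sub Yi.
rewrite /bracket_p proj_p_pr ?bracket_lieG// ip_pr ?bracket_lieG//.
by rewrite linearZ /= ipZl ip_bracket_cycle.
Qed.

Lemma metricC x X Y : metric S x X Y = metric S x Y X.
Proof. by rewrite !metricE; apply: eq_bigr => i _; rewrite ipC. Qed.

Lemma nomizu_lc x X Y : 0 < x.1 -> 0 < x.2 -> X \in pp S -> Y \in pp S ->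
  nomizu S x X Y = lc x X Y.
Proof.
move=> x1 x2 Xp Yp; have [Xg Yg] := (pp_sub Xp, pp_sub Yp).
(* Each basis vector f = a / sqrt(w_k) enters twice, once in the coefficient and once as the vector,
   which produces 1/w_k. *)
have part k (F := fun f => (2^-1 * (metric S x (bracket_p S f X) Y + metric S x X (bracket_p S
    f Y))) *: f) :
    \sum_(f <- [seq (Num.sqrt (wt x k))^-1 *: a | a <- ej k]) F f =
    (2 * wt x k)^-1 *: pr k (bracket X (rescale x Y) - bracket (rescale x X) Y).
  have rXY : bracket X (rescale x Y) - bracket (rescale x X) Y \in g.
    by rewrite memvB// bracket_lieG// (pp_sub (rescale_pp x _)).
  rewrite (pr_expand k rXY) scaler_sumr big_map; apply: eq_big_seq => a /ej_mem ak.
  have ag := pj_sub ak; have w0 := wt_gt0 k x1 x2.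
  have cag : (Num.sqrt (wt x k))^-1 *: a \in g by rewrite memvZ.
  rewrite /F [metric _ _ X _]metricC (metric_bracket x Xg cag Yp) (metric_bracket x Yg cag Xp).
  rewrite (bracketC Y) -ipDl.
  move: (bracket X (rescale x Y) - bracket (rescale x X) Y) => U.
  rewrite !ipZr !scalerA; congr (_ *: _).
  have -> : (2 * wt x k)^-1 = 2^-1 * ((Num.sqrt (wt x k))^-1 * (Num.sqrt (wt x k))^-1).
    by rewrite -invfM -expr2 sqr_sqrtr ?(ltW w0)// invfM.
  ring.
have E k : (2 * wt x k)^-1 *: pr k (wt x k *: bracket X Y + bracket X (rescale x Y) - bracket
    (rescale x X) Y)
   = 2^-1 *: pr k (bracket X Y) + (2 * wt x k)^-1 *: pr k (bracket X (rescale x Y) - bracket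
       (rescale x X) Y).
  rewrite -addrA; move: (bracket X Y) (_ - _) => B U.
  rewrite linearP scalerDr scalerA; congr (_ *: _ + _).
  by have w0 := wt_gt0 k x1 x2; field; rewrite lt0r_neq0.
rewrite /nomizu /nomizu_U /metric_onb big_cat /= (part false) (part true).
rewrite bracket_pE// /lc big_bool /= (E false) (E true).
by rewrite scalerDr addrACA addrC.
Qed.

End LeviCivita.

Lemma linear_sub4 (R : pzRingType) (V : lmodType R) (a : R) (E F G H C D A B : V) :
  (a *: E + F) - (a *: G + H) - (a *: C + D) - (a *: A + B) =
  a *: (E - G - C - A) + (F - H - D - B).
Proof.
rewrite !scalerBr !opprD.
by rewrite [X in X + _ + _ = _]addrACA [X in X + _ = _]addrACA [LHS]addrACA.
Qed.

(** * The Ricci form as a combination of Ad(K)-invariant forms *)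

Section Ricci.
Variables (R : realType) (n : nat) (S : two_summand_space R n).
Implicit Types (X Y Z W : 'M[R]_n.+1) (i j k l : bool) (x : R * R).
Local Notation g := (lieG S).
Local Notation ip := (ip S).
Local Notation pj := (pj S).
Local Notation ej := (ej S).
Local Notation pr := (pr S).
Local Notation prk := (prk S).
Local Notation lc := (lc S).

Definition gam x i j k : R := (wt x k + wt x j - wt x i) / (2 * wt x k).

Lemma pr_pp_sum X : X \in pp S -> X = \sum_k pr k X.
Proof.
move=> Xp; rewrite {1}(pr_sum (pp_sub Xp)) big_bool /= [pr true X + _]addrC.
have -> : prk X = 0 by apply: daddv_pi_0 => //; exact: cap_k.
by rewrite add0r.
Qed.

Lemma bracket_k_pp X Y : X \in lieK S -> Y \in pp S -> bracket X Y \in pp S.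
Proof.
move=> Xk Yp; rewrite (pr_pp_sum Yp) linear_sum memv_suml// => k _.
by rewrite (@pj_pp _ _ _ k)// bracket_k_pj// pr_mem.
Qed.

Lemma lc_pj x i j X Y : 0 < x.1 -> 0 < x.2 -> X \in pj i -> Y \in pj j ->
  lc x X Y = \sum_k gam x i j k *: pr k (bracket X Y).
Proof.
move=> x1 x2 Xi Yj; apply: eq_bigr => k _.
rewrite (rescale_pj x Xi) (rescale_pj x Yj) bracketZr bracketZl.
rewrite -scalerDl -scalerBl linearZ /= scalerA; congr (_ *: _).
by rewrite /gam mulrC.
Qed.

Lemma ip_pr_pr k X Y : X \in g -> Y \in g -> ip (pr k X) Y = ip (pr k X) (pr k Y).
Proof. by move=> Xg Yg; rewrite [RHS]ipC (ip_pr Yg (pr_mem S k X)) ipC. Qed.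

Lemma ip_prk_prk X Y : X \in g -> Y \in g -> ip (prk X) Y = ip (prk X) (prk Y).
Proof. by move=> Xg Yg; rewrite [RHS]ipC (ip_prk Yg (prk_mem S X)) ipC. Qed.

Lemma pr_g k X : pr k X \in g. Proof. exact: pj_sub (pr_mem S k X). Qed.
Lemma prk_g X : prk X \in g. Proof. exact: lieK_sub (prk_mem S X). Qed.

Lemma ip_lc_pj x i k j X Y Z : 0 < x.1 -> 0 < x.2 ->
  X \in pj i -> Y \in pj k -> Z \in pj j ->
  ip (lc x X Y) Z = gam x i k j * ip (bracket X Y) Z.
Proof.
move=> x1 x2 Xi Yk Zj; have XYg := bracket_lieG (pj_sub Xi) (pj_sub Yk).
rewrite (lc_pj x1 x2 Xi Yk) ip_suml (bigD1 j)//= ipZl (ip_pr XYg Zj).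
rewrite big1 ?addr0// => m mj; rewrite ipZl (@ip_pj _ _ _ m) ?mulr0 ?pr_mem//.
by have -> : ~~ m = j by case: m j mj {Zj} => [] [].
Qed.

Lemma ip_lc x i j X Y Z : 0 < x.1 -> 0 < x.2 ->
  X \in pj i -> Y \in pp S -> Z \in pj j ->
  ip (lc x X Y) Z = \sum_k gam x i k j * ip (bracket X (pr k Y)) Z.
Proof.
move=> x1 x2 Xi Yp Zj; rewrite {1}(pr_pp_sum Yp) linear_sum ip_suml.
by apply: eq_bigr => k _; rewrite (ip_lc_pj x1 x2 Xi (pr_mem S k Y) Zj).
Qed.

(** The curvature with [lc] in place of [nomizu]. It is multilinear on all matrices and agrees with
    [Rm] on p when both weights are positive. *)
Definition lcRm x Z X Y : 'M[R]_n.+1 :=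
  lc x Z (lc x X Y) - lc x X (lc x Z Y) - lc x (proj_p S (bracket Z X)) Y
  - bracket (prk (bracket Z X)) Y.

Lemma Rm_lcRm x X Y Z : 0 < x.1 -> 0 < x.2 ->
  X \in pp S -> Y \in pp S -> Z \in pp S -> Rm S x X Y Z = lcRm x X Y Z.
Proof.
move=> x1 x2 Xp Yp Zp; rewrite /Rm /lcRm /bracket_p /bracket_k.
rewrite (nomizu_lc x1 x2 Yp Zp) (nomizu_lc x1 x2 Xp Zp).
by rewrite !nomizu_lc ?lc_pp ?proj_p_pp.
Qed.

Lemma lcRm_pp x X Y Z : X \in pp S -> Y \in pp S -> Z \in pp S -> lcRm x X Y Z \in pp S.
Proof.
move=> Xp Yp Zp; rewrite /lcRm.
have B : bracket (prk (bracket X Y)) Z \in pp S by rewrite bracket_k_pp// prk_mem.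
by apply: memvB B; apply: memvB; [apply: memvB|]; exact: lc_pp.
Qed.

Lemma lcDl x X Y Z : lc x (X + Y) Z = lc x X Z + lc x Y Z.
Proof. by have := lc_linear_l S x Z 1 X Y; rewrite !scale1r. Qed.

Lemma lcZl x (a : R) X Z : lc x (a *: X) Z = a *: lc x X Z.
Proof.
have lc0 : lc x 0 Z = 0.
  by have := lcDl x 0 0 Z; rewrite addr0 => /eqP; rewrite -subr_eq0 opprD addrA subrr sub0r
      oppr_eq0 => /eqP.
by have := lc_linear_l S x Z a X 0; rewrite !addr0 lc0 addr0.
Qed.

Lemma lc_suml x (I : Type) (r : seq I) (F : I -> 'M[R]_n.+1) Z :
  lc x (\sum_(i <- r) F i) Z = \sum_(i <- r) lc x (F i) Z.
Proof.
apply: (big_morph (lc x ^~ Z)) => [X Y|]; first exact: lcDl.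
by have := lcZl x 0 0 Z; rewrite !scale0r.
Qed.

Lemma lcRm_linear x X Y : linear (fun Z => lcRm x Z X Y).
Proof.
move=> a Z W; rewrite /lcRm bracketPl /proj_p !linearP /= !bracketPl.
rewrite !lcDl !lcZl linearP /=.
exact: linear_sub4.
Qed.

Definition curvature_op x X Y Z : 'M[R]_n.+1 := lcRm x Z X Y.

HB.instance Definition _ x X Y :=
  @GRing.isLinear.Build R 'M[R]_n.+1 'M[R]_n.+1 _ (curvature_op x X Y) (@lcRm_linear x X Y).

(** A trace does not depend on the metric, so the fixed Q-orthonormal bases serve for every x;
    [trace_comp] is used with the identity as second map. *)
Lemma Ric_trace x X Y : 0 < x.1 -> 0 < x.2 -> X \in pp S -> Y \in pp S ->
  Ric S x X Y = \sum_j \sum_(z <- ej j) ip (lcRm x z X Y) z.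
Proof.
move=> x1 x2 Xp Yp.
have epp a : a \in ej false ++ ej true -> a \in pp S.
  by rewrite mem_cat => /orP[] /ej_mem/pj_pp.
have := @trace_comp _ _ S (pp S) (pp S) (ej false ++ ej true)
  (curvature_op x X Y) idfun (@pp_expand _ _ S) (fun Z Zp => Zp)
  (fun a ae => lcRm_pp x (epp a ae) Xp Yp).
rewrite big_cat big_bool /= addrC => <-.
rewrite /Ric /trace_on; apply: eq_bigr => i _; congr (coord _ _ _).
by rewrite Rm_lcRm// vbasis_mem// mem_nth// size_tuple.
Qed.

Lemma ip_bracket_self X Y : X \in g -> Y \in g -> ip (bracket X Y) X = 0.
Proof.
move=> Xg Yg; rewrite ip_bracket//.
have -> : bracket X X = 0 by rewrite /bracket subrr.
by rewrite linear0 oppr0.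
Qed.

(** Skew-symmetry of ad turns the terms of the curvature into pairings of components of [X, z] and
    [Y, z]. The term N(z, N(X, Y)) drops out because [z, U] is orthogonal to z. *)
Lemma ip_lcRm x i j l X Y z : 0 < x.1 -> 0 < x.2 ->
  X \in pj i -> Y \in pj l -> z \in pj j ->
  ip (lcRm x z X Y) z =
    \sum_k (gam x k l j - gam x i k j * gam x j l k) *
      ip (pr k (bracket X z)) (pr k (bracket Y z))
    + ip (prk (bracket X z)) (prk (bracket Y z)).
Proof.
move=> x1 x2 Xi Yl zj.
have [Xg Yg zg] : [/\ X \in g, Y \in g & z \in g].
  by rewrite (pj_sub Xi) (pj_sub Yl) (pj_sub zj).
have Xzg := bracket_lieG Xg zg; have Yzg := bracket_lieG Yg zg.
rewrite /lcRm !ipDl !ipNl.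
have -> : ip (lc x z (lc x X Y)) z = 0.
  rewrite (ip_lc x1 x2 zj (lc_pp S x X Y) zj) big1// => k _.
  by rewrite ip_bracket_self ?mulr0// pr_g.
have -> : ip (lc x X (lc x z Y)) z =
    \sum_k gam x i k j * gam x j l k * ip (pr k (bracket X z)) (pr k (bracket Y z)).
  rewrite (ip_lc x1 x2 Xi (lc_pp S x z Y) zj); apply: eq_bigr => k _.
  rewrite -mulrA; congr (_ * _); rewrite (lc_pj x1 x2 zj Yl) linear_sum (bigD1 k)//=.
  rewrite big1 ?addr0 => [|m mk]; last by rewrite linearZ /= pr_pr eq_sym (negPf mk) scaler0.
  rewrite linearZ /= pr_pr eqxx bracketZr ipZl; congr (_ * _).
  rewrite ip_bracket ?pr_g// (bracketC z Y) linearN /= ipNl opprK.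
  by rewrite (ip_pr_pr k Yzg Xzg) ipC.
have -> : ip (lc x (proj_p S (bracket z X)) Y) z =
    - \sum_k gam x k l j * ip (pr k (bracket X z)) (pr k (bracket Y z)).
  rewrite (bracketC z X) /proj_p linearN /= -/(proj_p S _).
  rewrite -scaleN1r lcZl scaleN1r ipNl; congr (- _).
  rewrite (pr_pp_sum (proj_p_pp S _)) lc_suml ip_suml; apply: eq_bigr => k _.
  rewrite (ip_lc_pj x1 x2 (pr_mem S k _) Yl zj); congr (_ * _).
  rewrite (proj_p_pr k Xzg) bracketC ipNl ip_bracket ?pr_g// opprK.
  by rewrite (ip_pr_pr k Xzg Yzg).
have -> : ip (bracket (prk (bracket z X)) Y) z = - ip (prk (bracket X z)) (prk (bracket Y z)).
  rewrite bracketC ipNl ip_bracket ?prk_g// opprK (bracketC z X) linearN /= ipNl.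
  by rewrite (ip_prk_prk Xzg Yzg).
rewrite sub0r !opprK -sumrN -big_split /= ; congr (_ + _).
by apply: eq_bigr => k _; rewrite mulrBl addrC.
Qed.

Definition qform (P : 'End('M[R]_n.+1)) j X Y : R :=
  \sum_(z <- ej j) ip (P (bracket X z)) (P (bracket Y z)).

Lemma Ric_qform x i l X Y : 0 < x.1 -> 0 < x.2 -> X \in pj i -> Y \in pj l ->
  Ric S x X Y = \sum_j (\sum_k (gam x k l j - gam x i k j * gam x j l k) *
    qform (pr k) j X Y + qform prk j X Y).
Proof.
move=> x1 x2 Xi Yl; rewrite (Ric_trace x1 x2 (pj_pp Xi) (pj_pp Yl)).
apply: eq_bigr => j _; rewrite (eq_big_seq _ (fun z zj => ip_lcRm x1 x2 Xi Yl (ej_mem zj))).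
rewrite big_split /=; congr (_ + _); rewrite exchange_big; apply: eq_bigr => k _.
by rewrite mulr_sumr.
Qed.

Lemma qformC (P : 'End('M[R]_n.+1)) j X Y : qform P j X Y = qform P j Y X.
Proof. by apply: eq_bigr => z _; rewrite ipC. Qed.

Lemma qform_linear_l (P : 'End('M[R]_n.+1)) j Y : scalar (qform P j ^~ Y).
Proof.
move=> a X Z; rewrite /qform mulr_sumr -big_split; apply: eq_bigr => z _ /=.
by rewrite bracketPl linearP ipDl ipZl.
Qed.

Lemma qform_linear_r (P : 'End('M[R]_n.+1)) j X : scalar (qform P j X).
Proof. by move=> a Y Z; rewrite !(qformC P j X) qform_linear_l. Qed.

Lemma qform_ge0 (P : 'End('M[R]_n.+1)) j X : (forall Z, P Z \in g) -> 0 <= qform P j X X.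
Proof.
move=> Pg; apply: sumr_ge0 => z _.
have [->|nz] := eqVneq (P (bracket X z)) 0; first by rewrite linear0.
exact: ltW (ip_gt0 (Pg _) nz).
Qed.

(** The hypotheses say that P behaves as an orthogonal projection commuting with Ad(K). The form is
    then the trace over p_j of -ad(Y) P ad(X), and conjugation by Ad(a) only rotates the orthonormal
    basis. *)
Lemma qform_invariant (P : 'End('M[R]_n.+1)) j a X Y :
  (forall Z, P Z \in g) ->
  (forall Z W, Z \in g -> W \in g -> ip (P Z) W = ip (P Z) (P W)) ->
  (forall b Z, grpK S b -> Z \in g -> P (Ad b Z) = Ad b (P Z)) ->
  grpK S a -> X \in pp S -> Y \in pp S ->
  qform P j (Ad a X) (Ad a Y) = qform P j X Y.
Proof.
move=> Pg Psym PAd Ka Xp Yp; have Ga := grpK_sub Ka; have ua := grpG_unit Ga.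
have [Xg Yg] := (pp_sub Xp, pp_sub Yp).
have E U V : U \in g -> V \in g ->
    qform P j U V = \sum_(z <- ej j) ip (bracket (- V) (P (bracket U z))) z.
  move=> Ug Vg; apply: eq_big_seq => z /ej_mem zj; have zg := pj_sub zj.
  rewrite -Psym ?bracket_lieG// -(scaleN1r V) bracketZl scaleN1r ipNl.
  by rewrite ip_bracket ?opprK.
rewrite !E ?Ad_lieG//.
have := @ej_trace_Ad _ _ S j (bracket (- Ad a Y) \o P \o bracket (Ad a X)) a Ka.
move=> /= <-; apply: eq_big_seq => z /ej_mem zj; have zg := pj_sub zj.
rewrite -(Ad_bracket X z ua) PAd ?bracket_lieG//.
rewrite -(linearN (Ad a)) /= -(Ad_bracket _ _ ua) ip_Ad// bracket_lieG ?Pg//.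
by rewrite memvN.
Qed.

Lemma qform_pr_invariant k j a X Y : grpK S a -> X \in pp S -> Y \in pp S ->
  qform (pr k) j (Ad a X) (Ad a Y) = qform (pr k) j X Y.
Proof.
apply: qform_invariant; [exact: pr_g | exact: ip_pr_pr |].
by move=> b Z Kb Zg; exact: Ad_pr.
Qed.

Lemma qform_prk_invariant j a X Y : grpK S a -> X \in pp S -> Y \in pp S ->
  qform prk j (Ad a X) (Ad a Y) = qform prk j X Y.
Proof.
apply: qform_invariant; [exact: prk_g | exact: ip_prk_prk |].
by move=> b Z Kb Zg; exact: Ad_prk.
Qed.

End Ricci.

(** * Structure constants, Ricci eigenvalues and the Killing form *)

Section RicciScalar.
Variables (R : realType) (n : nat) (S : two_summand_space R n).
Implicit Types (X Y Z W : 'M[R]_n.+1) (i j k l : bool) (x : R * R).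
Local Notation g := (lieG S).
Local Notation ip := (ip S).
Local Notation pj := (pj S).
Local Notation ej := (ej S).
Local Notation pr := (pr S).
Local Notation prk := (prk S).
Local Notation gam := (@gam R).

(** The constant [ijk] without the projection to p, which pairing with p_k makes redundant. In this
    form skew-symmetry of ad gives full symmetry in the indices. *)
Definition tr3 i j k : R := \sum_(a <- ej i) \sum_(b <- ej j) \sum_(c <- ej k) ip (bracket a b)
    c ^+ 2.

Lemma tr3E i j k : triple S (ej i) (ej j) (ej k) = tr3 i j k.
Proof.
rewrite /triple /tr3; apply: eq_big_seq => a /ej_mem ai; apply: eq_big_seq => b /ej_mem bj.
apply: eq_big_seq => c /ej_mem ck; have abg := bracket_lieG (pj_sub ai) (pj_sub bj).
congr (_ ^+ 2); rewrite -ipE ?(pp_sub (proj_p_pp S _)) ?(pj_sub ck)//.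
by rewrite -(ip_pr (pp_sub (proj_p_pp S _)) ck) (proj_p_pr k abg) (ip_pr abg ck).
Qed.

Lemma tr3_swap12 i j k : tr3 i j k = tr3 j i k.
Proof.
rewrite /tr3 exchange_big; apply: eq_bigr => b _; apply: eq_bigr => a _.
by apply: eq_bigr => c _; rewrite bracketC ipNl sqrrN.
Qed.

Lemma tr3_swap23 i j k : tr3 i j k = tr3 i k j.
Proof.
rewrite /tr3; apply: eq_big_seq => a /ej_mem ai; rewrite exchange_big.
apply: eq_big_seq => c /ej_mem ck; apply: eq_big_seq => b /ej_mem bj.
by rewrite (ip_bracket (pj_sub ai) (pj_sub bj) (pj_sub ck)) sqrrN ipC.
Qed.

Lemma tr3_ge0 i j k : 0 <= tr3 i j k.
Proof.
by do 3![apply: sumr_ge0 => ? _]; exact: sqr_ge0.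
Qed.

Lemma c112E : c112 S = tr3 false false true. Proof. by rewrite -tr3E. Qed.
Lemma c122E : c122 S = tr3 false true true. Proof. by rewrite -tr3E. Qed.
Lemma c111E : c111 S = tr3 false false false. Proof. by rewrite -tr3E. Qed.
Lemma c222E : c222 S = tr3 true true true. Proof. by rewrite -tr3E. Qed.

Lemma sum_qform i j k : \sum_(a <- ej i) qform S (pr k) j a a = tr3 i j k.
Proof.
apply: eq_big_seq => a /ej_mem ai; apply: eq_big_seq => b /ej_mem bj.
have abg := bracket_lieG (pj_sub ai) (pj_sub bj).
rewrite {2}(pr_expand k abg) linear_sum /=; apply: eq_big_seq => c /ej_mem ck.
by rewrite ipZr (ip_pr abg ck) expr2.
Qed.

Definition dm i : R := (\dim (pj i))%:R.

Lemma dm_gt0 i : 0 < dm i.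
Proof. by rewrite ltr0n lt0n dimv_eq0; have [] := pj_irreducible S i. Qed.

Lemma qform_scalar i j k X Y : X \in pj i -> Y \in pj i ->
  qform S (pr k) j X Y = tr3 i j k / dm i * ip X Y.
Proof.
move=> Xi Yi.
have := @schur_scalar _ _ S _ (@qform_linear_l _ _ S (pr k) j)
  (@qform_linear_r _ _ S (pr k) j) (@qform_pr_invariant _ _ S k j) i (@qformC _ _ S _ _) X Y Xi Yi.
rewrite sum_qform -/(dm i) => E.
have d0 := lt0r_neq0 (dm_gt0 i).
by rewrite mulrAC -E [dm i * _]mulrC mulfK.
Qed.

Lemma qform_pr_cross k j i X Y : X \in pj i -> Y \in pj (~~ i) -> qform S (pr k) j X Y = 0.
Proof.
have H := @schur_cross _ _ S _ (@qform_linear_l _ _ S (pr k) j)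
  (@qform_linear_r _ _ S (pr k) j) (@qform_pr_invariant _ _ S k j).
by case: i => Xi Yi; [rewrite qformC|]; exact: H.
Qed.

Lemma qform_prk_cross j i X Y : X \in pj i -> Y \in pj (~~ i) -> qform S prk j X Y = 0.
Proof.
have H := @schur_cross _ _ S _ (@qform_linear_l _ _ S prk j)
  (@qform_linear_r _ _ S prk j) (@qform_prk_invariant _ _ S j).
by case: i => Xi Yi; [rewrite qformC|]; exact: H.
Qed.

Lemma Ric_cross x i X Y : 0 < x.1 -> 0 < x.2 ->
  X \in pj i -> Y \in pj (~~ i) -> Ric S x X Y = 0.
Proof.
move=> x1 x2 Xi Yi; rewrite (Ric_qform x1 x2 Xi Yi) big1// => j _.
rewrite (qform_prk_cross j Xi Yi) addr0 big1// => k _.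
by rewrite (qform_pr_cross k j Xi Yi) mulr0.
Qed.

Lemma ip_decomp X Y : X \in g -> Y \in g ->
  ip X Y = ip (prk X) (prk Y) + \sum_k ip (pr k X) (pr k Y).
Proof.
move=> Xg Yg; rewrite {1}(pr_sum Xg) !ipDl big_bool /= [ip (pr true X) _ + _]addrC.
by rewrite (ip_prk_prk Xg Yg) (ip_pr_pr true Xg Yg) (ip_pr_pr false Xg Yg).
Qed.

Definition prp : 'End('M[R]_n.+1) := daddv_pi (pp S) (lieK S).

Lemma prk_prp X : X \in g -> X = prk X + prp X.
Proof. by move=> Xg; rewrite {1}(pr_sum Xg) -(proj_pE Xg). Qed.

Lemma bracket_pp_k X Y : X \in pp S -> Y \in lieK S -> bracket X Y \in pp S.
Proof. by move=> Xp Yk; rewrite bracketC memvN bracket_k_pp. Qed.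

(** Split the identity of [lieG] into [prk + prp]. As ad(Y) maps [lieK] into p, cyclicity moves the
    first trace to p, where it gives a [prk] form. The second gives the pairing of the full brackets
    [X, a] and [Y, a], with another [prk] form; hence the factor 2. *)
Lemma killing_qform X Y : X \in pp S -> Y \in pp S ->
  - killing_form g X Y =
  \sum_j ((\sum_k qform S (pr k) j X Y) + 2 * qform S prk j X Y).
Proof.
move=> Xp Yp; have [Xg Yg] := (pp_sub Xp, pp_sub Yp).
have epp a : a \in ej false ++ ej true -> a \in pp S.
  by rewrite mem_cat => /orP[] /ej_mem/pj_pp.
have E1 := @trace_comp _ _ S g (pp S) (ej false ++ ej true) (bracket X)
  (bracket Y \o prk) (@pp_expand _ _ S) (fun Z _ => bracket_pp_k Yp (prk_mem S Z))
  (fun a ae => bracket_lieG Xg (pp_sub (epp a ae))).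
have E2 := @trace_comp _ _ S g (pp S) (ej false ++ ej true) (bracket X \o bracket Y)
  prp (@pp_expand _ _ S) (fun Z _ => proj_p_pp S Z)
  (fun a ae => bracket_lieG Xg (bracket_lieG Yg (pp_sub (epp a ae)))).
have -> : killing_form g X Y = trace_on g (fun Z => bracket X (bracket Y (prk Z)))
    + trace_on g (fun Z => bracket X (bracket Y (prp Z))).
  rewrite /killing_form /trace_on -big_split; apply: eq_bigr => i _ /=.
  have vg : (vbasis g)`_i \in g by rewrite vbasis_mem// mem_nth// size_tuple.
  move: (vbasis g)`_i vg => v vg; rewrite -linearD; congr (coord _ _ _).
  by rewrite -[bracket X _ + _]linearD -[bracket Y _ + _]linearD -prk_prp.
rewrite [X in X + _]E1 [X in _ + X]E2 -big_split /= -sumrN big_cat big_bool /= addrC.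
have P j : \sum_(a <- ej j) - (ip (bracket Y (prk (bracket X a))) a +
      ip (prp (bracket X (bracket Y a))) a) =
    (\sum_k qform S (pr k) j X Y) + 2 * qform S prk j X Y.
  rewrite /qform exchange_big mulr_sumr -big_split; apply: eq_big_seq => a /ej_mem aj /=.
  have ag := pj_sub aj; have Xag := bracket_lieG Xg ag; have Yag := bracket_lieG Yg ag.
  have XYag := bracket_lieG Xg Yag.
  rewrite -(ip_pr (pp_sub (proj_p_pp S _)) aj) (proj_p_pr j XYag) (ip_pr XYag aj).
  rewrite (ip_bracket Yg (prk_g S _) ag) (ip_bracket Xg Yag ag) (ip_prk_prk Xag Yag).
  by rewrite [ip (bracket Y a) _]ipC (ip_decomp Xag Yag); ring.
by rewrite (P true) (P false).
Qed.

Definition bc i : R := if i then b2 S else b1 S.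

Lemma killing_pj i X Y : X \in pj i -> Y \in pj i -> - killing_form g X Y = bc i * ip X Y.
Proof.
move=> Xi Yi; rewrite ipE ?(pj_sub Xi) ?(pj_sub Yi)//.
by case: i Xi Yi; [exact: killing_p2 | exact: killing_p1].
Qed.

Lemma Ric_scalar x i X Y : 0 < x.1 -> 0 < x.2 -> X \in pj i -> Y \in pj i ->
  Ric S x X Y = (bc i / 2 + \sum_j \sum_k
    (gam x k i j - gam x i k j * gam x j i k - 2^-1) * (tr3 i j k / dm i)) * ip X Y.
Proof.
move=> x1 x2 Xi Yi; rewrite (Ric_qform x1 x2 Xi Yi).
have := killing_qform (pj_pp Xi) (pj_pp Yi); rewrite (killing_pj Xi Yi).
under [in RHS]eq_bigr do under eq_bigr do rewrite (qform_scalar _ _ Xi Yi).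
under [in X in _ -> X]eq_bigr do under eq_bigr do rewrite (qform_scalar _ _ Xi Yi).
rewrite !big_bool /=.
move: (qform S prk true X Y) (qform S prk false X Y) (ip X Y) => Kt Kf P.
set gtt := gam x true i true - _; set gft := gam x false i true - _.
set gtf := gam x true i false - _; set gff := gam x false i false - _.
move: gtt gft gtf gff => gtt gft gtf gff.
move: (tr3 i true true / dm i) (tr3 i true false / dm i) (tr3 i false true / dm i)
  (tr3 i false false / dm i) => t1 t2 t3 t4 H.
(* The two [prk] forms enter the Ricci form only through their sum, which the Killing form
   determines; this is the origin of [bc i / 2] and of the term -1/2 in the statement. *)
have -> : Kt = (bc i * P - (t1 * P + t2 * P) - (t3 * P + t4 * P)) / 2 - Kf.
  by rewrite H; field.
by field.
Qed.

Lemma Ric_p1 x X Y : 0 < x.1 -> 0 < x.2 -> X \in pj false -> Y \in pj false ->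
  Ric S x X Y = - speed (A1 S) (B1 S) (C1 S) (x.1 / x.2) / 2 * ip X Y.
Proof.
move=> x1 x2 Xi Yi; rewrite (Ric_scalar x1 x2 Xi Yi) !big_bool /=.
have d0 := lt0r_neq0 (dm_gt0 false).
rewrite (tr3_swap23 false true false) /speed /A1 /B1 /C1 /gam /wt c111E c112E c122E.
rewrite -[d1 S]/(dm false) /bc; congr (_ * _); field.
by rewrite d0 !lt0r_neq0.
Qed.

Lemma Ric_p2 x X Y : 0 < x.1 -> 0 < x.2 -> X \in pj true -> Y \in pj true ->
  Ric S x X Y = - speed (A2 S) (B2 S) (C2 S) (x.2 / x.1) / 2 * ip X Y.
Proof.
move=> x1 x2 Xi Yi; rewrite (Ric_scalar x1 x2 Xi Yi) !big_bool /=.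
have d0 := lt0r_neq0 (dm_gt0 true).
rewrite (tr3_swap23 true true false) (tr3_swap12 true false true).
rewrite (tr3_swap12 true false false) (tr3_swap23 false true false).
rewrite /speed /A2 /B2 /C2 /gam /wt c222E c112E c122E.
rewrite -[d2 S]/(dm true) /bc; congr (_ * _); field.
by rewrite d0 !lt0r_neq0.
Qed.

(** Trace of [killing_qform] over p_i, with the nonnegative [prk] forms dropped. *)
Lemma bc_trace i : \sum_j \sum_k tr3 i j k <= dm i * bc i.
Proof.
have <- : \sum_(a <- ej i) (- killing_form g a a) = dm i * bc i.
  rewrite (eq_big_seq (fun=> bc i)) => [|a ai].
    by rewrite big_const_seq count_predT iter_addr_0 ej_size mulr_natl.
  by rewrite (killing_pj (ej_mem ai) (ej_mem ai)) (ej_norm ai) mulr1.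
rewrite (eq_big_seq _ (fun a ai => killing_qform (pj_pp (ej_mem ai)) (pj_pp (ej_mem ai)))).
rewrite [leRHS]exchange_big; apply: ler_sum => j _; rewrite [leRHS]big_split /=.
rewrite [X in _ <= X + _]exchange_big /=.
rewrite [X in _ <= X + _](eq_bigr _ (fun k _ => sum_qform i j k)) lerDl; apply: sumr_ge0 => a _.
by rewrite mulr_ge0 ?ler0n// qform_ge0// => Z; exact: prk_g.
Qed.

(** The trace bound reads d1 b1 >= [111] + 2[112] + [122], so d1 A1 = d1 b1 - [111]/2 - [122] is at
    least [111]/2 + 2[112]. *)
Lemma A1_ge : 2 * c112 S <= d1 S * A1 S.
Proof.
have := bc_trace false; rewrite !big_bool /= (tr3_swap23 false true false) -c111E -c112E -c122E.
have d0 := lt0r_neq0 (dm_gt0 false); have := tr3_ge0 false false false; rewrite -c111E.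
have -> : d1 S * A1 S = dm false * b1 S - c111 S / 2 - c122 S.
  by rewrite /A1 -[d1 S]/(dm false); field.
rewrite /bc; lra.
Qed.

Lemma A2_ge : 2 * c122 S <= d2 S * A2 S.
Proof.
have := bc_trace true; rewrite !big_bool /=.
rewrite (tr3_swap23 true true false) (tr3_swap12 true false true).
rewrite (tr3_swap12 true false false) (tr3_swap23 false true false).
rewrite -c222E -c112E -c122E.
have d0 := lt0r_neq0 (dm_gt0 true); have := tr3_ge0 true true true; rewrite -c222E.
have -> : d2 S * A2 S = dm true * b2 S - c222 S / 2 - c112 S.
  by rewrite /A2 -[d2 S]/(dm true); field.
rewrite /bc; lra.
Qed.

End RicciScalar.

(** * Bounds on the norm of the curvature *)

Lemma le_sum_seq (R : realType) (T : eqType) (r : seq T) (F : T -> R) (a : T) :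
  a \in r -> (forall i, 0 <= F i) -> F a <= \sum_(i <- r) F i.
Proof.
by move=> ar F0; rewrite (big_rem a)//= lerDl sumr_ge0.
Qed.

Lemma mx_entry_le_norm (R : realType) (m n : nat) (X : 'M[R]_(m, n)) i j : `|X i j| <= `|X|.
Proof.
rewrite {2}/Num.norm /= mx_normrE.
exact: (le_bigmax _ (fun ij : 'I_m * 'I_n => `|X ij.1 ij.2|) (i, j)).
Qed.

Lemma linear_mx_bound (R : realType) (m n : nat) (V : normedModType R)
    (f : {linear 'M[R]_(m, n) -> V}) :
  exists B : R, 0 <= B /\ forall X, `|f X| <= B * `|X|.
Proof.
exists (\sum_i \sum_j `|f (delta_mx i j)|); split.
  by apply: sumr_ge0 => i _; apply: sumr_ge0.
move=> X; rewrite {1}(matrix_sum_delta X) linear_sum mulr_suml.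
apply: (le_trans (ler_norm_sum _ _ _)); apply: ler_sum => i _.
rewrite linear_sum mulr_suml; apply: (le_trans (ler_norm_sum _ _ _)); apply: ler_sum => j _.
by rewrite linearZ normrZ mulrC ler_wpM2l// mx_entry_le_norm.
Qed.

Lemma bilinear_mx_bound (R : realType) (m n p q : nat) (V : normedModType R)
    (f : 'M[R]_(m, n) -> {linear 'M[R]_(p, q) -> V}) :
  (forall Y, linear (fun X => f X Y)) ->
  exists B : R, 0 <= B /\ forall X Y, `|f X Y| <= B * `|X| * `|Y|.
Proof.
move=> lin.
have [B HB] : exists B : 'I_m -> 'I_n -> R, forall i j,
    0 <= B i j /\ forall Y, `|f (delta_mx i j) Y| <= B i j * `|Y|.
  have H ij : exists b : R, 0 <= b /\ forall Y, `|f (delta_mx ij.1 ij.2) Y| <= b * `|Y|.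
    exact: linear_mx_bound.
  have [B HB] := boolp.choice H.
  by exists (fun i j => B (i, j)) => i j; exact: (HB (i, j)).
exists (\sum_i \sum_j B i j); split.
  by apply: sumr_ge0 => i _; apply: sumr_ge0 => j _; case: (HB i j).
move=> X Y.
pose g : {linear 'M[R]_(m, n) -> V} := HB.pack (fun X => f X Y)
  (GRing.isLinear.Build R 'M[R]_(m, n) V _ (fun X => f X Y) (lin Y)).
rewrite -[f X Y]/(g X) {1}(matrix_sum_delta X) linear_sum !mulr_suml.
apply: (le_trans (ler_norm_sum _ _ _)); apply: ler_sum => i _.
rewrite linear_sum !mulr_suml; apply: (le_trans (ler_norm_sum _ _ _)); apply: ler_sum => j _.
have [B0 BY] := HB i j.
rewrite linearZ normrZ [B i j * _]mulrC -mulrA.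
by apply: ler_pM => //; [exact: mx_entry_le_norm | exact: BY].
Qed.

Section CurvatureNorm.
Variables (R : realType) (n : nat) (S : two_summand_space R n).
Implicit Types (X Y Z W : 'M[R]_n.+1) (i j k l : bool) (x : R * R).
Local Notation ip := (ip S).
Local Notation pj := (pj S).
Local Notation ej := (ej S).
Local Notation pr := (pr S).
Local Notation prk := (prk S).
Local Notation lc := (lc S).
Local Notation lcRm := (lcRm S).

Lemma bracket_bound : exists B : R, 0 <= B /\
  forall X Y, `|bracket X Y| <= B * `|X| * `|Y|.
Proof.
apply: (@bilinear_mx_bound R n.+1 n.+1 n.+1 n.+1 'M[R]_n.+1 (fun X => bracket X)).
by move=> Y a X Z; exact: bracketPl.
Qed.

Lemma ip_bound : exists B : R, 0 <= B /\ forall X Y, `|ip X Y| <= B * `|X| * `|Y|.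
Proof.
apply: (@bilinear_mx_bound R n.+1 n.+1 n.+1 n.+1 R (fun X => ip X)).
by move=> Y; exact: ip_linear.
Qed.

Lemma pr_bound : exists B : R, 0 <= B /\ forall k X, `|pr k X| <= B * `|X|.
Proof.
have [p [p0 Hp]] := linear_mx_bound (pr false : {linear _ -> _}).
have [q [q0 Hq]] := linear_mx_bound (pr true : {linear _ -> _}).
exists (p + q); split=> [|k X]; first exact: addr_ge0.
rewrite mulrDl; case: k; [apply: (le_trans (Hq X)) | apply: (le_trans (Hp X))].
  by rewrite lerDr mulr_ge0.
by rewrite lerDl mulr_ge0.
Qed.

(** A condition invariant under scaling of the metric; along the flow it holds with one constant, as
    the ratio stays in a compact subset of the positive axis. *)
Definition comparable_wt (C : R) x : Prop :=
  [/\ 0 < x.1, 0 < x.2, x.1 <= C * x.2 & x.2 <= C * x.1].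

Lemma wt_le C x i j : 1 <= C -> comparable_wt C x -> wt x i <= C * wt x j.
Proof.
move=> C1 [x1 x2 h12 h21].
by case: i j => [] [] //=; rewrite ler_peMl// ltW.
Qed.

(** The connection is unchanged when the metric is scaled, so the bound depends on C alone:
    comparability measures every [rescale] against w_k, and this weight cancels the factor 1/(2
    w_k). *)
Lemma lc_bound C : 1 <= C -> exists B : R, 0 <= B /\
  forall x X Y, comparable_wt C x -> `|lc x X Y| <= B * `|X| * `|Y|.
Proof.
move=> C1; have C0 : 0 <= C := le_trans ler01 C1.
have [b [b0 Hb]] := bracket_bound.
have [p [p0 Hp]] := pr_bound.
pose rs := C * p + C * p.
have rs0 : 0 <= rs by rewrite addr_ge0 ?mulr_ge0.
exists (p * (b + b * rs + b * rs) + p * (b + b * rs + b * rs)); split.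
  by rewrite addr_ge0 ?mulr_ge0 ?addr_ge0 ?mulr_ge0.
move=> x X Y Dx; have [x1 x2 _ _] := Dx.
have resc k Z : `|rescale S x Z| <= wt x k * (rs * `|Z|).
  rewrite /rescale big_bool /=; apply: (le_trans (ler_normD _ _)).
  have T j : `|wt x j *: pr j Z| <= wt x k * (C * p * `|Z|).
    rewrite normrZ gtr0_norm ?wt_gt0//.
    have -> : wt x k * (C * p * `|Z|) = (C * wt x k) * (p * `|Z|) by ring.
    by apply: ler_pM => //; [rewrite ltW// wt_gt0 | exact: wt_le].
  apply: (le_trans (lerD (T true) (T false))).
  by rewrite le_eqVlt; apply/orP; left; apply/eqP; rewrite /rs; ring.
have X0 := normr_ge0 X; have Y0 := normr_ge0 Y.
have term k : `|(2 * wt x k)^-1 *: pr k (wt x k *: bracket X Y + bracket X (rescale S x Y)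
      - bracket (rescale S x X) Y)| <= p * (b + b * rs + b * rs) * `|X| * `|Y|.
  have w0 := wt_gt0 k x1 x2.
  rewrite normrZ gtr0_norm ?invr_gt0 ?mulr_gt0//.
  rewrite ler_pdivrMl ?mulr_gt0//.
  apply: (le_trans (Hp _ _)).
  have -> : 2 * wt x k * (p * (b + b * rs + b * rs) * `|X| * `|Y|) =
    p * (2 * (wt x k * ((b + b * rs + b * rs) * `|X| * `|Y|))) by ring.
  apply: ler_wpM2l => //.
  apply: (@le_trans _ _ (wt x k * ((b + b * rs + b * rs) * `|X| * `|Y|))); last first.
    by rewrite ler_peMl ?ler1n// !mulr_ge0 ?addr_ge0 ?mulr_ge0// ltW.
  have h1 : `|wt x k *: bracket X Y| <= wt x k * (b * `|X| * `|Y|).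
    by rewrite normrZ gtr0_norm// ler_pM2l.
  have h2 : `|bracket X (rescale S x Y)| <= wt x k * (b * rs * `|X| * `|Y|).
    apply: (le_trans (Hb _ _)).
    have -> : wt x k * (b * rs * `|X| * `|Y|) = b * `|X| * (wt x k * (rs * `|Y|)) by ring.
    by apply: ler_wpM2l => //; rewrite mulr_ge0.
  have h3 : `|bracket (rescale S x X) Y| <= wt x k * (b * rs * `|X| * `|Y|).
    apply: (le_trans (Hb _ _)).
    have -> : wt x k * (b * rs * `|X| * `|Y|) = b * (wt x k * (rs * `|X|)) * `|Y| by ring.
    by apply: ler_wpM2r => //; apply: ler_wpM2l.
  apply: (le_trans (ler_normB _ _)); apply: (le_trans (lerD (ler_normD _ _) (lexx _))).
  apply: (le_trans (lerD (lerD h1 h2) h3)).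
  by rewrite le_eqVlt; apply/orP; left; apply/eqP; ring.
rewrite /lc big_bool /=; apply: (le_trans (ler_normD _ _)).
by rewrite !mulrDl; apply: lerD; have := term; [move=> /(_ true) | move=> /(_ false)];
  rewrite !mulrDl.
Qed.

Lemma lcRm_bound C : 1 <= C -> exists B : R, 0 <= B /\
  forall x X Y Z, comparable_wt C x -> `|lcRm x X Y Z| <= B * `|X| * `|Y| * `|Z|.
Proof.
move=> C1; have [B [B0 HB]] := lc_bound C1; have [b [b0 Hb]] := bracket_bound.
have [p [p0 Hp]] := linear_mx_bound (daddv_pi (pp S) (lieK S) : {linear _ -> _}).
have [q [q0 Hq]] := linear_mx_bound (prk : {linear _ -> _}).
exists (B * B + B * B + B * (p * b) + b * (q * b)); split.
  by rewrite !addr_ge0 ?mulr_ge0.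
move=> x X Y Z Dx; have X0 := normr_ge0 X; have Y0 := normr_ge0 Y; have Z0 := normr_ge0 Z.
have h1 : `|lc x X (lc x Y Z)| <= B * B * (`|X| * `|Y| * `|Z|).
  apply: (le_trans (HB _ _ _ Dx)).
  have -> : B * B * (`|X| * `|Y| * `|Z|) = B * `|X| * (B * `|Y| * `|Z|) by ring.
  by apply: ler_wpM2l; [rewrite mulr_ge0 | exact: HB].
have h2 : `|lc x Y (lc x X Z)| <= B * B * (`|X| * `|Y| * `|Z|).
  apply: (le_trans (HB _ _ _ Dx)).
  have -> : B * B * (`|X| * `|Y| * `|Z|) = B * `|Y| * (B * `|X| * `|Z|) by ring.
  by apply: ler_wpM2l; [rewrite mulr_ge0 | exact: HB].
have h3 : `|lc x (proj_p S (bracket X Y)) Z| <= B * (p * b) * (`|X| * `|Y| * `|Z|).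
  apply: (le_trans (HB _ _ _ Dx)).
  have -> : B * (p * b) * (`|X| * `|Y| * `|Z|) = B * (p * (b * `|X| * `|Y|)) * `|Z| by ring.
  apply: ler_wpM2r => //; apply: ler_wpM2l => //; apply: (le_trans (Hp _)).
  exact: ler_wpM2l.
have h4 : `|bracket (prk (bracket X Y)) Z| <= b * (q * b) * (`|X| * `|Y| * `|Z|).
  apply: (le_trans (Hb _ _)).
  have -> : b * (q * b) * (`|X| * `|Y| * `|Z|) = b * (q * (b * `|X| * `|Y|)) * `|Z| by ring.
  apply: ler_wpM2r => //; apply: ler_wpM2l => //; apply: (le_trans (Hq _)).
  exact: ler_wpM2l.
rewrite /lcRm -!mulrA [`|X| * _]mulrA !mulrDl.
apply: (le_trans (ler_normB _ _)); apply: lerD h4.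
apply: (le_trans (ler_normB _ _)); apply: lerD h3.
exact: (le_trans (ler_normB _ _) (lerD h1 h2)).
Qed.

Lemma metric_onb_mem x a : 0 < x.1 -> 0 < x.2 -> a \in metric_onb S x ->
  exists i e, [/\ e \in ej i & a = (Num.sqrt (wt x i))^-1 *: e].
Proof.
move=> x1 x2; rewrite mem_cat => /orP[] /mapP[e ee ->].
  by exists false, e.
by exists true, e.
Qed.

Lemma metric_onb_pp x a : 0 < x.1 -> 0 < x.2 -> a \in metric_onb S x -> a \in pp S.
Proof.
move=> x1 x2 /(metric_onb_mem x1 x2)[i [e [/ej_mem ee ->]]].
by rewrite memvZ// (pj_pp ee).
Qed.

(** Scaling count: each of the four basis vectors has squared length at most C E^2 / x1 and the
    metric contributes one factor x1, so every component of the curvature is at most D / x1. There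
    are N^4 components. *)
Lemma Rm_norm_upper C : 1 <= C -> exists B : R, 0 <= B /\
  forall x, comparable_wt C x -> Rm_norm S x <= B / x.1.
Proof.
move=> C1; have C0 : 0 < C := lt_le_trans ltr01 C1.
have [B [B0 HB]] := lcRm_bound C1; have [m [m0 Hm]] := ip_bound.
have [p [p0 Hp]] := pr_bound.
pose E := \sum_(e <- ej false ++ ej true) `|e|.
have E0 : 0 <= E by apply: sumr_ge0.
pose N := (size (ej false) + size (ej true))%N.
pose D := (1 + C) * (m * p ^+ 2) * (B * (C * E ^+ 2) ^+ 2).
have D0 : 0 <= D.
  by rewrite !mulr_ge0 ?exprn_ge0 ?addr_ge0 ?mulr_ge0 ?exprn_ge0// ?(ltW C0).
exists (Num.sqrt ((N ^ 4)%:R * D ^+ 2)); split; first exact: sqrtr_ge0.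
move=> x Dx; have [x1 x2 h12 h21] := Dx.
have onbE a : a \in metric_onb S x -> `|a| ^+ 2 <= C * E ^+ 2 / x.1.
  move=> /(metric_onb_mem x1 x2)[i [e [ee ->]]]; have w0 := wt_gt0 i x1 x2.
  rewrite normrZ exprMn -normrX exprVn sqr_sqrtr ?(ltW w0)// gtr0_norm ?invr_gt0//.
  have eE : `|e| <= E.
    apply: (@le_sum_seq R _ _ (fun e : 'M[R]_n.+1 => `|e|)) => //.
    by rewrite mem_cat; case: i ee {w0} => -> //; rewrite orbT.
  have -> : C * E ^+ 2 / x.1 = (C / x.1) * E ^+ 2 by ring.
  apply: ler_pM; rewrite ?invr_ge0 ?exprn_ge0 ?(ltW w0)//.
    rewrite ler_pdivlMr// mulrC ler_pdivrMr//.
    exact: (@wt_le C x false i).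
  by rewrite ler_sqr ?nnegrE.
have size_onb : size (metric_onb S x) = N by rewrite size_cat !size_map.
have metric_le U V : `|metric S x U V| <= (1 + C) * x.1 * (m * p ^+ 2) * `|U| * `|V|.
  rewrite metricE big_bool /=; apply: (le_trans (ler_normD _ _)).
  have T k : `|wt x k * ip (pr k U) (pr k V)| <= wt x k * ((m * p ^+ 2) * `|U| * `|V|).
    rewrite normrM gtr0_norm ?wt_gt0// ler_pM2l ?wt_gt0//; apply: (le_trans (Hm _ _)).
    have -> : m * p ^+ 2 * `|U| * `|V| = m * (p * `|U|) * (p * `|V|) by ring.
    by apply: ler_pM; rewrite ?mulr_ge0//; apply: ler_wpM2l.
  apply: (le_trans (lerD (T true) (T false))); rewrite -mulrDl /=.
  have -> : (1 + C) * x.1 * (m * p ^+ 2) * `|U| * `|V| =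
    ((1 + C) * x.1) * (m * p ^+ 2 * `|U| * `|V|) by ring.
  apply: ler_wpM2r; first by rewrite !mulr_ge0 ?exprn_ge0.
  by rewrite mulrDl mul1r addrC lerD2l.
have term a b c d : a \in metric_onb S x -> b \in metric_onb S x ->
    c \in metric_onb S x -> d \in metric_onb S x ->
    metric S x (Rm S x a b c) d ^+ 2 <= (D / x.1) ^+ 2.
  move=> aO bO cO dO; have mp := @metric_onb_pp x.
  rewrite Rm_lcRm ?mp//.
  have H : `|metric S x (lcRm x a b c) d| <=
      (1 + C) * x.1 * (m * p ^+ 2) * (B * `|a| * `|b| * `|c|) * `|d|.
    apply: (le_trans (metric_le _ _)); apply: ler_wpM2r => //; apply: ler_wpM2l.
      by rewrite !mulr_ge0 ?exprn_ge0 ?addr_ge0 ?(ltW C0) ?(ltW x1).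
    exact: HB.
  rewrite -[leLHS]real_normK ?num_real//; apply: (@le_trans _ _
      (((1 + C) * x.1 * (m * p ^+ 2) * (B * `|a| * `|b| * `|c|) * `|d|) ^+ 2)).
    by rewrite ler_sqr ?nnegrE// (le_trans _ H).
  have -> : ((1 + C) * x.1 * (m * p ^+ 2) * (B * `|a| * `|b| * `|c|) * `|d|) ^+ 2 =
    ((1 + C) * x.1 * (m * p ^+ 2) * B) ^+ 2 * ((`|a| ^+ 2 * `|b| ^+ 2) * (`|c| ^+ 2 * `|d| ^+ 2)).
    by ring.
  have -> : (D / x.1) ^+ 2 = ((1 + C) * x.1 * (m * p ^+ 2) * B) ^+ 2 *
    (((C * E ^+ 2 / x.1) * (C * E ^+ 2 / x.1)) * ((C * E ^+ 2 / x.1) * (C * E ^+ 2 / x.1))).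
    by rewrite /D; field; rewrite lt0r_neq0.
  apply: ler_wpM2l; first exact: sqr_ge0.
  by apply: ler_pM; rewrite ?mulr_ge0 ?exprn_ge0//; apply: ler_pM; rewrite ?exprn_ge0// onbE.
have -> : Num.sqrt ((N ^ 4)%:R * D ^+ 2) / x.1 = Num.sqrt ((N ^ 4)%:R * (D / x.1) ^+ 2).
  have P : 0 <= (N ^ 4)%:R * D ^+ 2 by apply: mulr_ge0; [exact: ler0n | exact: sqr_ge0].
  have -> : (N ^ 4)%:R * (D / x.1) ^+ 2 = ((N ^ 4)%:R * D ^+ 2) * x.1^-1 ^+ 2 by ring.
  by rewrite [RHS]sqrtrM// sqrtr_sqr ger0_norm// invr_ge0 ltW.
rewrite /Rm_norm ler_wsqrtr//.
have sum_const (T : eqType) (r : seq T) (F : T -> R) (K : R) :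
    (forall a, a \in r -> F a <= K) -> \sum_(a <- r) F a <= (size r)%:R * K.
  move=> H; rewrite big_seq; apply: (le_trans (ler_sum _ H)).
  by rewrite -big_seq big_const_seq count_predT iter_addr_0 mulr_natl.
have -> : (N ^ 4)%:R * (D / x.1) ^+ 2 = N%:R * (N%:R * (N%:R * (N%:R * (D / x.1) ^+ 2))).
  by rewrite natrX; ring.
rewrite -size_onb; do 4![apply: (sum_const) => ? ?]; exact: term.
Qed.

Lemma lcZr x (a : R) X Y : lc x X (a *: Y) = a *: lc x X Y.
Proof. by rewrite linearZ. Qed.

Lemma lcRmZ x (r s t : R) X Y Z :
  lcRm x (r *: X) (s *: Y) (t *: Z) = (r * s * t) *: lcRm x X Y Z.
Proof.
rewrite /lcRm.
have -> : bracket (r *: X) (s *: Y) = (r * s) *: bracket X Y.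
  by rewrite bracketZl bracketZr scalerA.
rewrite /proj_p [daddv_pi _ _ (_ *: _)]linearZ [prk (_ *: _)]linearZ /=.
rewrite !lcZl !lcZr bracketZl bracketZr !scalerA.
have -> : s * r * t = r * s * t by ring.
by rewrite -!scalerBr.
Qed.

Lemma metric_Rm_le_norm x a b c d :
  a \in metric_onb S x -> b \in metric_onb S x ->
  c \in metric_onb S x -> d \in metric_onb S x ->
  `|metric S x (Rm S x a b c) d| <= Rm_norm S x.
Proof.
move=> aO bO cO dO; rewrite -sqrtr_sqr; apply: ler_wsqrtr.
pose F a b c d : R := metric S x (Rm S x a b c) d ^+ 2.
have F0 : forall a b c d, 0 <= F a b c d by move=> *; exact: sqr_ge0.
rewrite -[leLHS]/(F a b c d).
apply: (le_trans (le_sum_seq dO (F0 a b c))).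
have F1 c' : 0 <= \sum_(d <- metric_onb S x) F a b c' d by apply: sumr_ge0.
apply: (le_trans (le_sum_seq cO F1)).
have F2 b' : 0 <= \sum_(c <- metric_onb S x) \sum_(d <- metric_onb S x) F a b' c d.
  by apply: sumr_ge0 => ? _; apply: sumr_ge0.
apply: (le_trans (le_sum_seq bO F2)).
have F3 a' : 0 <= \sum_(b <- metric_onb S x) \sum_(c <- metric_onb S x) \sum_(d <- metric_onb S
    x) F a' b c d.
  by apply: sumr_ge0 => ? _; apply: sumr_ge0 => ? _; apply: sumr_ge0.
exact: (le_sum_seq aO F3).
Qed.

Lemma ej_metric_onb x i e : e \in ej i -> (Num.sqrt (wt x i))^-1 *: e \in metric_onb S x.
Proof.
by rewrite mem_cat; case: i => ei; apply/orP; [right | left]; apply/mapP; exists e.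
Qed.

Lemma metric_pj x i X Y : X \in pp S -> Y \in pj i -> metric S x X Y = wt x i * ip X Y.
Proof.
move=> Xp Yi; rewrite metricE (bigD1 i)//= (pr_id Yi) (ip_pr (pp_sub Xp) Yi).
rewrite big1 ?addr0// => j ji; rewrite (@pr_neq _ _ _ j Y) ?linear0 ?mulr0//.
by have -> : ~~ j = i by case: i j ji {Yi} => [] [].
Qed.

(** Used in the reverse direction: a lower bound on the Ricci curvature forces the norm of the
    curvature to blow up as x1 tends to 0. *)
Lemma Ric_le_Rm_norm x X : 0 < x.1 -> 0 < x.2 -> X \in ej false ->
  `|Ric S x X X| <= (size (ej false) + size (ej true))%:R * (x.1 * Rm_norm S x).
Proof.
move=> x1 x2 Xe; have Xp := pj_pp (ej_mem Xe).
rewrite (Ric_trace x1 x2 Xp Xp) big_bool /= natrD mulrDl.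
have term j : `|\sum_(z <- ej j) ip (lcRm x z X X) z| <= (size (ej j))%:R * (x.1 * Rm_norm S x).
  apply: (le_trans (ler_norm_sum _ _ _)).
  have -> : (size (ej j))%:R * (x.1 * Rm_norm S x) = \sum_(z <- ej j) (x.1 * Rm_norm S x).
    by rewrite big_const_seq count_predT iter_addr_0 mulr_natl.
  rewrite [leLHS]big_seq [leRHS]big_seq; apply: ler_sum => z ze.
  have wz := wt_gt0 j x1 x2; have zp := pj_pp (ej_mem ze).
  have := metric_Rm_le_norm (ej_metric_onb x ze) (ej_metric_onb x Xe)
    (ej_metric_onb x Xe) (ej_metric_onb x ze).
  rewrite Rm_lcRm ?memvZ// lcRmZ.
  rewrite (@metric_pj x j) ?memvZ ?(ej_mem ze) ?lcRm_pp//.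
  rewrite ipZl ipZr => H.
  (* X and z each occur twice in the component. Undoing their normalisation gives x1 and w_j, and
     w_j is absorbed by the metric, so one factor x1 remains. *)
  have E : ip (lcRm x z X X) z = x.1 * (wt x j * ((Num.sqrt (wt x j))^-1 *
      (Num.sqrt x.1)^-1 * (Num.sqrt x.1)^-1 * ((Num.sqrt (wt x j))^-1 * ip (lcRm x z X X) z))).
    have sq (a : R) : 0 < a -> (Num.sqrt a)^-1 * (Num.sqrt a)^-1 = a^-1.
      by move=> a0; rewrite -invfM -expr2 sqr_sqrtr// ltW.
    move: (ip _ z) => I; set sx := (Num.sqrt x.1)^-1; set sw := (Num.sqrt (wt x j))^-1.
    have -> : x.1 * (wt x j * (sw * sx * sx * (sw * I))) =
      x.1 * (sx * sx) * (wt x j * (sw * sw)) * I by ring.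
    by rewrite !sq// !divff ?lt0r_neq0// !mul1r.
  by rewrite E normrM gtr0_norm// ler_pM2l.
by apply: (le_trans (ler_normD _ _)); rewrite [leRHS]addrC;
  exact: (lerD (term true) (term false)).
Qed.

End CurvatureNorm.

(** * The homogeneous Ricci flow *)

Section Flow.
Variables (R : realType) (n : nat) (S : two_summand_space R n).
Implicit Types (X Y Z W : 'M[R]_n.+1) (i j k l : bool) (x : R * R).
Local Notation ip := (ip S).
Local Notation pj := (pj S).
Local Notation ej := (ej S).
Local Notation pr := (pr S).
Local Notation lcRm := (lcRm S).
Local Notation ricci_flow := (flow (A1 S) (B1 S) (C1 S) (A2 S) (B2 S) (C2 S)).

Definition spd x i : R :=
  if i then speed (A2 S) (B2 S) (C2 S) (x.2 / x.1)
  else speed (A1 S) (B1 S) (C1 S) (x.1 / x.2).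

Lemma Ric_pj x i X Y : 0 < x.1 -> 0 < x.2 -> X \in pj i -> Y \in pj i ->
  Ric S x X Y = - spd x i / 2 * ip X Y.
Proof. by case: i; [exact: Ric_p2 | exact: Ric_p1]. Qed.

Lemma lcPl x (a : R) X Y Z : lc S x (a *: X + Y) Z = a *: lc S x X Z + lc S x Y Z.
Proof. exact: lc_linear_l. Qed.

Lemma lcPr x (a : R) X Y Z : lc S x X (a *: Y + Z) = a *: lc S x X Y + lc S x X Z.
Proof. exact: lc_linear_r. Qed.

Lemma lcRmPm x (a : R) X Y Z W :
  lcRm x X (a *: Y + Z) W = a *: lcRm x X Y W + lcRm x X Z W.
Proof.
rewrite /lcRm bracketPr /proj_p [daddv_pi _ _ (_ + _)]linearP [prk S (_ + _)]linearP /=.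
rewrite bracketPl !lcPl lcPr.
exact: linear_sub4.
Qed.

Lemma lcRmPr x (a : R) X Y Z W :
  lcRm x X Y (a *: Z + W) = a *: lcRm x X Y Z + lcRm x X Y W.
Proof.
rewrite /lcRm bracketPr !lcPr.
exact: linear_sub4.
Qed.

Lemma RicDl x X Y Z : 0 < x.1 -> 0 < x.2 ->
  X \in pp S -> Y \in pp S -> Z \in pp S -> Ric S x (X + Y) Z = Ric S x X Z + Ric S x Y Z.
Proof.
move=> x1 x2 Xp Yp Zp; rewrite !Ric_trace ?memvD// -big_split; apply: eq_bigr => j _ /=.
by rewrite -big_split; apply: eq_bigr => z _ /=; rewrite -[X]scale1r lcRmPm !scale1r ipDl.
Qed.

Lemma RicDr x X Y Z : 0 < x.1 -> 0 < x.2 ->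
  X \in pp S -> Y \in pp S -> Z \in pp S -> Ric S x X (Y + Z) = Ric S x X Y + Ric S x X Z.
Proof.
move=> x1 x2 Xp Yp Zp; rewrite !Ric_trace ?memvD// -big_split; apply: eq_bigr => j _ /=.
by rewrite -big_split; apply: eq_bigr => z _ /=; rewrite -[Y]scale1r lcRmPr !scale1r ipDl.
Qed.

Lemma Ric_pp x X Y : 0 < x.1 -> 0 < x.2 -> X \in pp S -> Y \in pp S ->
  - 2 * Ric S x X Y = \sum_i spd x i * ip (pr i X) (pr i Y).
Proof.
move=> x1 x2 Xp Yp.
have P i Z : pr i Z \in pp S by exact: pj_pp (pr_mem S i Z).
have -> : Ric S x X Y = \sum_i Ric S x (pr i X) (pr i Y).
  rewrite {1}(pr_pp_sum Xp) {1}(pr_pp_sum Yp) !big_bool /=.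
  rewrite RicDl ?memvD ?P// !RicDr ?P//.
  rewrite (Ric_cross (i := true) x1 x2 (pr_mem S true X) (pr_mem S false Y)).
  rewrite (Ric_cross (i := false) x1 x2 (pr_mem S false X) (pr_mem S true Y)).
  by rewrite addr0 add0r.
rewrite mulr_sumr; apply: eq_bigr => i _.
by rewrite (Ric_pj x1 x2 (pr_mem S i X) (pr_mem S i Y)); field.
Qed.

Lemma ej_nonempty i : exists e, e \in ej i.
Proof.
have : (0 < size (ej i))%N by rewrite ej_size lt0n dimv_eq0; have [] := pj_irreducible S i.
by case: (ej i) => // e s _; exists e; rewrite mem_head.
Qed.

(** Evaluating the tensor equation on a Q-unit vector of p_i isolates the equation for x_i.
    Conversely both sides are combinations of the same two forms, since the Ricci form has no mixed
    part. *)
Lemma HRF_flow (I : set R) (x : R -> R * R) :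
  is_HRF S I x <-> ricci_flow I (fun t => (x t).1) (fun t => (x t).2).
Proof.
split=> H t It.
- have [x1 x2 Q] := H t It.
  have D i : deriv_within I (fun t => wt (x t) i) t (spd (x t) i).
    have [e ei] := ej_nonempty i; have eij := ej_mem ei.
    have ep := pj_pp eij.
    have := Q e e ep ep; rewrite (Ric_pj x1 x2 eij eij) (ej_norm ei).
    have -> : - 2 * (- spd (x t) i / 2 * 1) = spd (x t) i by field.
    rewrite /deriv_within.
    by under eq_cvg do rewrite !(metric_pj _ ep eij) (ej_norm ei) !mulr1.
  by split => //; [exact: (D false) | exact: (D true)].
- have [x1 x2 D1 D2] := H t It; split => // X Y Xp Yp.
  have D i : deriv_within I (fun t => wt (x t) i) t (spd (x t) i) by case: i.
  rewrite (Ric_pp x1 x2 Xp Yp).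
  have E s : (metric S (x s) X Y - metric S (x t) X Y) / (s - t) =
      \sum_i (wt (x s) i - wt (x t) i) / (s - t) * ip (pr i X) (pr i Y).
    by rewrite !metricE -sumrB mulr_suml; apply: eq_bigr => i _; ring.
  under eq_cvg do rewrite E.
  apply: (@cvg_sum R R) => i; apply: cvgM; last exact: cvg_cst.
  exact: D.
Qed.

Hypotheses (h112 : c112 S <> 0) (h122 : c122 S <> 0).

Lemma c112_gt0 : 0 < c112 S.
Proof. by rewrite lt_neqAle eq_sym; apply/andP; split; [exact/eqP | rewrite c112E tr3_ge0]. Qed.

Lemma c122_gt0 : 0 < c122 S.
Proof. by rewrite lt_neqAle eq_sym; apply/andP; split; [exact/eqP | rewrite c122E tr3_ge0]. Qed.

Lemma d1_gt0 : 0 < d1 S. Proof. exact: (dm_gt0 S false). Qed.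
Lemma d2_gt0 : 0 < d2 S. Proof. exact: (dm_gt0 S true). Qed.

Lemma B1_gt0 : 0 < B1 S. Proof. by rewrite divr_gt0 ?c112_gt0 ?d1_gt0. Qed.
Lemma B2_gt0 : 0 < B2 S. Proof. by rewrite divr_gt0 ?c122_gt0 ?d2_gt0. Qed.
Lemma C1_gt0 : 0 < C1 S. Proof. by rewrite divr_gt0 ?mulr_gt0 ?c122_gt0 ?d1_gt0. Qed.
Lemma C2_gt0 : 0 < C2 S. Proof. by rewrite divr_gt0 ?mulr_gt0 ?c112_gt0 ?d2_gt0. Qed.

(* At a root y of the cubic both speeds have the same sign. Were they
   nonnegative, d1 A1 >= 2 [112] would force y < 1/2 and d2 A2 >= 2 [122]
   would force y > 2. *)
Lemma einstein_speed_lt0 (y : R) : 0 < y -> einstein_cubic S y = 0 ->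
  speed (A1 S) (B1 S) (C1 S) y < 0 /\ speed (A2 S) (B2 S) (C2 S) y^-1 < 0.
Proof.
move=> y0 py; set h1 := speed _ _ _ y; set h2 := speed _ _ _ y^-1.
have yn0 := lt0r_neq0 y0.
have E : h1 = y * h2.
  apply/eqP; rewrite -subr_eq0; apply/eqP.
  have -> : h1 - y * h2 = einstein_cubic S y / y.
    by rewrite /h1 /h2 /speed /einstein_cubic; field.
  by rewrite py mul0r.
have [a0 b0 D1 D2] : [/\ 0 < c112 S, 0 < c122 S, 0 < d1 S & 0 < d2 S].
  by rewrite c112_gt0 c122_gt0 d1_gt0 d2_gt0.
suff h20 : h2 < 0 by split => //; rewrite E pmulr_rlt0.
rewrite ltNge; apply/negP => h2_ge0.
have h1_ge0 : 0 <= h1 by rewrite E mulr_ge0// ltW.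
have F1 : d1 S * h1 * y = - (d1 S * A1 S) * y + c112 S - c122 S * y ^+ 3 / 2.
  by rewrite /h1 /speed /B1 /C1; field; rewrite yn0 lt0r_neq0.
have F2 : d2 S * h2 * y ^+ 2 = - (d2 S * A2 S) * y ^+ 2 + c122 S * y ^+ 3 - c112 S / 2.
  by rewrite /h2 /speed /B2 /C2; field; rewrite yn0 lt0r_neq0.
have G1 : 0 <= d1 S * h1 * y by rewrite !mulr_ge0 ?(ltW D1) ?(ltW y0).
have G2 : 0 <= d2 S * h2 * y ^+ 2 by rewrite !mulr_ge0 ?(ltW D2) ?exprn_ge0 ?(ltW y0).
have K1 : 2 * c112 S * y <= d1 S * A1 S * y by rewrite ler_pM2r// A1_ge.
have K2 : 2 * c122 S * y ^+ 2 <= d2 S * A2 S * y ^+ 2 by rewrite ler_pM2r ?exprn_gt0// A2_ge.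
have y3 : 0 < c122 S * y ^+ 3 by rewrite mulr_gt0 ?exprn_gt0.
have L1 : c112 S * (2 * y) < c112 S * 1 by lra.
have L2 : c122 S * y ^+ 2 * 2 < c122 S * y ^+ 2 * y.
  have -> : c122 S * y ^+ 2 * y = c122 S * y ^+ 3 by ring.
  lra.
rewrite ltr_pM2l// in L1; rewrite ltr_pM2l ?mulr_gt0 ?exprn_gt0// in L2.
lra.
Qed.

End Flow.

Lemma type_I_of_bounds (R : realType) (n : nat) (S : two_summand_space R n)
    (T C y : R) (x : R -> R * R) :
  0 < T -> 0 < C -> 0 < y -> speed (A1 S) (B1 S) (C1 S) y < 0 ->
  (forall t, 0 <= t -> t < T ->
    [/\ 0 < (x t).1, 0 < (x t).2, T - t <= C * (x t).1,
        (x t).1 <= C * (x t).2 & (x t).2 <= C * (x t).1]) ->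
  (x t).1 @[t --> T^'-] --> (0 : R) ->
  ((x t).1 / (x t).2) @[t --> T^'-] --> y ->
  type_I_singularity S x T.
Proof.
move=> T0 C0 y0 h_y bnd x1_to ratio_to; split; last first.
  (* The curvature bound asks for a comparability constant of at least 1. *)
  have D1 : 1 <= C + 1 by rewrite lerDr ltW.
  have [B [B0 HB]] := Rm_norm_upper S D1.
  apply: (@le_lt_trans _ _ (C * B)%:E); last exact: ltry.
  apply: ge_ereal_sup => _ [t /andP[t0 tT] <-]; rewrite lee_fin.
  have [x1 x2 b1 b2 b3] := bnd t t0 tT.
  have Dx : comparable_wt (C + 1) (x t).
    by split=> //; rewrite mulrDl mul1r; [apply: (le_trans b2) | apply: (le_trans b3)];
      rewrite lerDl ltW.
  have -> : C * B = C * (x t).1 * (B / (x t).1) by field; rewrite lt0r_neq0.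
  apply: ler_pM => //; [by rewrite subr_ge0 ltW | exact: sqrtr_ge0 | exact: HB].
apply/eq_infty => M.
have [e ei] := ej_nonempty S false; have e1 := ej_mem ei.
pose N : R := (size (ej S false) + size (ej S true))%:R.
have N0 : 0 < N.
  by rewrite ltr0n addn_gt0 (leq_ltn_trans (leq0n (index e (ej S false))))// index_mem.
(* On a Q-unit vector of p1 the Ricci form is -[speed]/2. Near T the speed is below half its
   negative limit, that is below -2c, so the Ricci form exceeds c. *)
pose c := - speed (A1 S) (B1 S) (C1 S) y / 4.
have c0 : 0 < c by rewrite divr_gt0 ?oppr_gt0.
have M1 : 0 < `|M| + 1 by rewrite ltr_wpDl.
(* Below this threshold c / (N x1) exceeds |M| + 1, and |Rm| is at least c / (N x1). *)
have ev1 : \forall t \near T^'-, (x t).1 < c / (N * (`|M| + 1)).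
  by apply: (cvgr_lt _ x1_to); apply: divr_gt0 => //; exact: mulr_gt0.
have sp_to : speed (A1 S) (B1 S) (C1 S) ((x t).1 / (x t).2) @[t --> T^'-] -->
    speed (A1 S) (B1 S) (C1 S) y.
  by apply: continuous_cvg ratio_to; exact: speed_continuous.
have ev2 : \forall t \near T^'-,
    speed (A1 S) (B1 S) (C1 S) ((x t).1 / (x t).2) < - (2 * c).
  by apply: (cvgr_lt _ sp_to); rewrite /c; move: h_y; set q := speed _ _ _ y => h_y; lra.
have ev3 : \forall t \near T^'-, 0 < t by exact: nbhs_left_gt.
have ev4 : \forall t \near T^'-, t < T by exact: nbhs_left_lt.
have [t [k1 k2 k3 k4]] : exists t, [/\ (x t).1 < c / (N * (`|M| + 1)),
    speed (A1 S) (B1 S) (C1 S) ((x t).1 / (x t).2) < - (2 * c), 0 < t & t < T].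
  by near T^'- => t; exists t; split; near: t.
have [x1 x2 _ _ _] := bnd t (ltW k3) k4.
apply: (@le_trans _ _ (Rm_norm S (x t))%:E); last first.
  by apply: ereal_sup_ubound; exists t => //=; rewrite (ltW k3).
rewrite lee_fin; apply: (le_trans (ler_norm M)).
have := Ric_le_Rm_norm x1 x2 ei; rewrite (Ric_p1 x1 x2 e1 e1) (ej_norm ei) mulr1 -/N => H.
have cH : c <= N * ((x t).1 * Rm_norm S (x t)).
  apply: le_trans H; apply: le_trans (ler_norm _).
  by move: k2; set q := speed _ _ _ _ => k2; lra.
rewrite ltr_pdivlMr ?mulr_gt0// in k1.
have : N * (x t).1 * (`|M| + 1) < N * (x t).1 * Rm_norm S (x t).
  have -> : N * (x t).1 * (`|M| + 1) = (x t).1 * (N * (`|M| + 1)) by ring.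
  by apply: (lt_le_trans k1); rewrite -mulrA.
by rewrite ltr_pM2l ?mulr_gt0// => /ltW; apply: le_trans; rewrite lerDl.
Unshelve. all: by end_near. Qed.

Set Strict Implicit.
Unset Implicit Arguments.

Theorem theorem5p7 (R : realType) (n : nat) (S : two_summand_space R n)
    (h112 : c112 S <> 0) (h122 : c122 S <> 0)
    (ybar : R)
    (hEinstein : unique_einstein_up_to_scaling S)
    (hybar_gt0 : 0 < ybar)
    (hybar_root : einstein_cubic S ybar = 0)
    (hybar_unique : forall y : R, einstein_cubic S y = 0 -> y = ybar) :
  (forall x0 : R * R, 0 < x0.1 -> 0 < x0.2 -> x0.1 / x0.2 <> ybar ->
     exists (T : R) (x : R -> R * R),
       0 < T /\
       is_unique_maximal_HRF S x0 T x /\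
       type_I_singularity S x T /\
       ((x t).1 @[t --> T^'-] --> (0 : R)) /\
       ((x t).2 @[t --> T^'-] --> (0 : R)) /\
       ((x t).1 / (x t).2 @[t --> T^'-] --> ybar)) /\
  (forall (T : R) (x : R -> R * R),
     is_HRF S [set t | t < T] x ->
     ~ (exists2 t : R, t < T & (x t).1 / (x t).2 <> ybar)).
Proof.
have [B1p C1p B2p C2p] : [/\ 0 < B1 S, 0 < C1 S, 0 < B2 S & 0 < C2 S].
  by rewrite B1_gt0// C1_gt0// B2_gt0// C2_gt0.
have [h1 h2] := einstein_speed_lt0 h112 h122 hybar_gt0 hybar_root.
split; last first.
  (* On an ancient solution the ratio equals ybar at every time; what is excluded are ancient
     solutions with another ratio at some time. *)
  move=> T x /HRF_flow F [t tT]; apply.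
  exact: (flow_ancient_ratio B1p C1p B2p C2p hybar_gt0 hybar_root hybar_unique F tT).
move=> x0 x01 x02 yne.
have [T [u [v [[T0 uE vE F] uniq [u_to v_to y_to] [C [C0 HC]]]]]] :=
  flow_solution B1p C1p B2p C2p hybar_gt0 hybar_root hybar_unique h1 h2 x01 x02 yne.
exists T, (fun t => (u t, v t)); split => //; split; last split => //.
- split; first by rewrite uE vE -surjective_pairing.
    by apply/HRF_flow.
  move=> T' z T'0 z0 /HRF_flow Fz.
  have agree t : 0 <= t -> (t%:E < T')%E -> [/\ t < T, (z t).1 = u t & (z t).2 = v t].
    move=> t0 tT'; apply: (uniq _ _ _ t Fz t0); rewrite ?z0// => s /=.
    rewrite in_itv /= => /andP[s0 st]; split => //.
    by apply: le_lt_trans tT'; rewrite lee_fin.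
  split.
    (* A solution living beyond T would include the time T itself, where agreement yields T < T. *)
    rewrite leNgt; apply/negP => TT'.
    by have [] := agree T (ltW T0) TT'; rewrite ltxx.
  move=> t t0 tT'; have [_ <- <-] := agree t t0 tT'.
  by rewrite -surjective_pairing.
- apply: (type_I_of_bounds T0 C0 hybar_gt0 h1) => // t t0 tT.
  have tI : [set t | 0 <= t < T] t by rewrite /= t0.
  have [ut vt _ _] := F t tI.
  by have [b1 _ b3 b4] := HC t t0 tT.
Qed.
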